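(* For all integers $n\ge3$ and $d\ge4$, the constructible set $\mathcal{S}_2(d,n)$ is reducible.
   Context: Work over $\mathbb{C}$. The strength of a nonzero homogeneous polynomial $f$ of degree $d$ in $n+1$ variables is the minimal $r\ge1$ such that $f=\sum_{i=1}^r t_is_i$ with $t_i,s_i$ homogeneous of degrees $e_i$ and $d-e_i$, $1\le e_i\le d-1$ ($+\infty$ if no such decomposition exists). $\mathcal{S}_2(d,n)\subseteq|\mathcal{O}_{\mathbb{P}^n}(d)|$ denotes the set of degree $d$ hypersurfaces $\{f=0\}\subset\mathbb{P}^n$ whose equation $f$ has strength exactly $2$. *)

(* Defs.v *)
From mathcomp Require Import all_boot all_algebra.
From mathcomp Require Import Rstruct complex.
From mathcomp Require Import mpoly.

Unset Printing Implicit Defensive.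

Import GRing.Theory.
Local Open Scope ring_scope.

Definition CC : closedFieldType := (Rdefinitions.R)[i].

Notation poly_n n := {mpoly CC[n.+1]}.

Definition has_strength_decomp (n d r : nat) (f : poly_n n) : Prop :=
  exists (e : 'I_r -> nat) (t s : 'I_r -> poly_n n),
    (forall i, (1 <= e i <= d.-1)%N /\ t i \is (e i).-homog
               /\ s i \is (d - e i)%N.-homog)
    /\ f = \sum_(i < r) t i * s i.

Definition strength_eq (n d r : nat) (f : poly_n n) : Prop :=
  f != 0 /\ f \is d.-homog /\ (1 <= r)%N /\ has_strength_decomp n d r f
  /\ forall r', (1 <= r' < r)%N -> ~ has_strength_decomp n d r' f.

(* A point of |O_{P^n}(d)| = P(H^0(O(d))) is represented by a nonzero
   degree-d form (up to nonzero scalars); all the subsets of |O(d)| below are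
   predicates on forms that are invariant under nonzero scaling. *)
Definition S2 (n d : nat) (f : poly_n n) : Prop := strength_eq n d 2 f.

Inductive polyfun (n : nat) : (poly_n n -> CC) -> Prop :=
  | pf_const (c : CC) : polyfun n (fun _ => c)
  | pf_coef (m : 'X_{1..n.+1}) : polyfun n (fun f => f@_m)
  | pf_add phi psi : polyfun n phi -> polyfun n psi ->
      polyfun n (fun f => phi f + psi f)
  | pf_mul phi psi : polyfun n phi -> polyfun n psi ->
      polyfun n (fun f => phi f * psi f).

Definition hom_polyfun (n d k : nat) (phi : poly_n n -> CC) : Prop :=
  polyfun n phi /\
  forall (c : CC) (f : poly_n n), f \is d.-homog -> phi (c *: f) = c ^+ k * phi f.

Definition zariski_closed (n d : nat) (Z : poly_n n -> Prop) : Prop :=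
  exists (I : Type) (k : I -> nat) (phi : I -> poly_n n -> CC),
    (forall i, hom_polyfun n d (k i) (phi i)) /\
    forall f, Z f <-> (f \is d.-homog /\ f != 0 /\ forall i, phi i f = 0).

Definition proj_reducible (n d : nat) (S : poly_n n -> Prop) : Prop :=
  exists Z1 Z2 : poly_n n -> Prop,
    zariski_closed n d Z1 /\ zariski_closed n d Z2 /\
    (forall f, S f -> Z1 f \/ Z2 f) /\
    (exists f, S f /\ ~ Z1 f) /\ (exists f, S f /\ ~ Z2 f).

(* Main.v *)
(* Idea. A form of strength at most two is t1 s1 + t2 s2 with (deg t1, deg t2)
   = (a, b) and 1 <= a <= b <= d/2. All coordinates but the first four are set
   to zero, which reduces everything to quaternary forms. Let W(a, b) be the set
   of quaternary forms of the given type. It suffices to find two homogeneous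
   polynomials in the coefficients: phi vanishing on W(1, 1) but not at some form
   of strength exactly two, and psi vanishing on all W(a, b) with b >= 2 but not
   on W(1, 1). Products t s belong to some W(a, b) with b >= 2, so nonvanishing
   of psi on W(1, 1) also forces strength exactly two.

   Surfaces of W(1, 1) contain a line. For phi we use that
   w^d = (xz - y^2)(x^(d-2) + y z^(d-3)) is irreducible, has strength two and
   contains no line: by Krull's theorem the equations expressing that a line lies
   on it generate, in the Pluecker coordinates, an ideal containing all monomials
   of some degree, so some maximal minor of the corresponding Sylvester type
   matrix is nonzero there, while it vanishes for every surface with a line.

   For psi, normalising t1, s1, t2, s2 shows that W(a, b) has fewer parameters
   than W(1, 1), so some explicit coefficients, which are algebraically
   independent on W(1, 1), satisfy a polynomial relation on W(a, b). For d = 4 the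
   dimensions of W(1, 1) and W(a, b) agree; there phi is added to the coefficients
   and the relation is divided by a power of phi, which does not vanish on
   W(a, b), before restricting to phi = 0. *)
Require Import Defs.
From HB Require Import structures.
From mathcomp Require Import all_boot all_algebra.
From mathcomp Require Import Rstruct complex.
From mathcomp Require Import mpoly.
From mathcomp Require Import ring zify.
From mathcomp Require Import generic_quotient ring_quotient.
From mathcomp Require classical_sets boolp.
Set Implicit Arguments.
Unset Strict Implicit.
Unset Printing Implicit Defensive.
Import GRing.Theory.
Local Open Scope ring_scope.

(** * Polynomial functions along affine lines *)

(** Closures and dimensions never appear. The quadruples (t1, s1, t2, s2) of a fixed type form a
    vector space, so if two polynomial functions on it have product zero, one of them vanishes.
    Restriction to affine lines reduces this to univariate polynomials, and it allows every
    vanishing statement to be tested at generic quadruples only. Upper bounds on dimensions become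
    algebraic relations, found by counting monomials; the lower bound for W(1, 1) is an explicit
    deformation. The number to beat is binomial(d+3, 3) + 2 - d, the projective dimension expected
    for surfaces of degree d with a line: d + 1 conditions for each line of a 4-dimensional
    Grassmannian. It exceeds the number of normalised parameters of every other type when d >= 5,
    and equals it for the types (1, 2) and (2, 2) when d = 4. The quartic cyclic surface belongs to
    both of these, so phi does not vanish identically on the two spaces where it serves as an extra
    coordinate. *)

Lemma natCC_neq0 (n : nat) : (n.+1%:R : CC) != 0.
Proof. by have := @Num.Theory.pnatr_eq0 Rdefinitions.R[i] n.+1 => H; rewrite [_ == _]H. Qed.

(** In characteristic 0 the naturals are infinitely many distinct roots. They lie in the image of
    [CC] in any domain over it, so identities known only at complex points still become polynomial
    identities over [L]. *)
Lemma poly_nat_roots (L : idomainType) (p : {poly L}) :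
  (forall n, n.+1%:R != 0 :> L) -> (forall n : nat, p.[n%:R] = 0) -> p = 0.
Proof.
move=> char0 p0; apply/eqP/negPn/negP => pN0.
have injL : injective (fun n : nat => n%:R : L).
  move=> i j /= ij; wlog lij : i j ij / (i <= j)%N.
    by move=> H; case/orP: (leq_total i j) => /H; [exact | move=> Hs; apply/esym/Hs].
  apply/eqP; rewrite eqn_leq lij /= leqNgt; apply/negP => ltij.
  have /eqP : (j - i)%:R = 0 :> L by rewrite natrB // ij subrr.
  by rewrite -(prednK (n := j - i)) ?subn_gt0 // (negbTE (char0 _)).
have := @max_poly_roots _ p (map (fun n : nat => n%:R) (iota 0 (size p))) pN0.
rewrite map_inj_uniq ?iota_uniq // size_map size_iota ltnn => H.
by suff: false by []; apply: H => //; apply/allP => x /mapP[k _ ->]; rewrite rootE p0.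
Qed.

Section FunAlgebra.
Variable T : Type.

(** Abstracts what [polyfun], [poly1], [polyM] and [along_lines] share, so that sums, determinants
    and products of forms are treated once for all four. *)
Definition fun_algebra (A : (T -> CC) -> Prop) : Prop :=
  [/\ forall c, A (fun=> c),
      forall f g, A f -> A g -> A (fun x => f x + g x)
    & forall f g, A f -> A g -> A (fun x => f x * g x)].

Variables (A : (T -> CC) -> Prop) (algA : fun_algebra A).

Lemma fa_const c : A (fun=> c). Proof. by case: algA. Qed.

Lemma fa_add f g : A f -> A g -> A (fun x => f x + g x).
Proof. by case: algA => _ + _; apply. Qed.

Lemma fa_mul f g : A f -> A g -> A (fun x => f x * g x).
Proof. by case: algA => _ _; apply. Qed.

Lemma fa_ext f g : f =1 g -> A f -> A g.
Proof. by move/boolp.funext => ->. Qed.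

Lemma fa_opp f : A f -> A (fun x => - f x).
Proof.
move=> Af; apply: (@fa_ext (fun x => -1 * f x)) => [x|]; first by rewrite mulN1r.
exact: fa_mul (fa_const _) Af.
Qed.

Lemma fa_exp f k : A f -> A (fun x => f x ^+ k).
Proof.
move=> Af; elim: k => [|k IH]; first exact: fa_const.
by apply: (@fa_ext (fun x => f x * f x ^+ k)) (fa_mul Af IH) => x; rewrite exprS.
Qed.

Lemma fa_sum (I : Type) (r : seq I) (P : pred I) (F : I -> T -> CC) :
  (forall i, A (F i)) -> A (fun x => \sum_(i <- r | P i) F i x).
Proof.
move=> AF; elim: r => [|i r IH].
  by apply: fa_ext (fa_const 0) => x; rewrite big_nil.
case Pi: (P i).
  by apply: fa_ext (fa_add (AF i) IH) => x; rewrite big_cons Pi.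
by apply: fa_ext IH => x; rewrite big_cons Pi.
Qed.

Lemma fa_prod (I : Type) (r : seq I) (P : pred I) (F : I -> T -> CC) :
  (forall i, A (F i)) -> A (fun x => \prod_(i <- r | P i) F i x).
Proof.
move=> AF; elim: r => [|i r IH].
  by apply: fa_ext (fa_const 1) => x; rewrite big_nil.
case Pi: (P i).
  by apply: fa_ext (fa_mul (AF i) IH) => x; rewrite big_cons Pi.
by apply: fa_ext IH => x; rewrite big_cons Pi.
Qed.

Lemma fa_det k (M : T -> 'M[CC]_k) :
  (forall i j, A (fun x => M x i j)) -> A (fun x => \det (M x)).
Proof.
move=> AM; apply: fa_sum => s.
by apply: fa_mul; [exact: fa_const | apply: fa_prod].
Qed.

Definition family n (G : T -> {mpoly CC[n]}) := forall m, A (fun x => (G x)@_m).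

Lemma family_const n (p : {mpoly CC[n]}) : family (fun=> p).
Proof. by move=> m; exact: fa_const. Qed.

Lemma family_ext n (F G : T -> {mpoly CC[n]}) : F =1 G -> family F -> family G.
Proof. by move/boolp.funext => ->. Qed.

Lemma family_add n (F G : T -> {mpoly CC[n]}) :
  family F -> family G -> family (fun x => F x + G x).
Proof.
move=> fF fG m; apply: fa_ext (fa_add (fF m) (fG m)) => x.
by rewrite mcoeffD.
Qed.

Lemma family_scale n f (G : T -> {mpoly CC[n]}) :
  A f -> family G -> family (fun x => f x *: G x).
Proof.
by move=> Af fG m; apply: fa_ext (fa_mul Af (fG m)) => x; rewrite mcoeffZ.
Qed.

Lemma family_mul n (F G : T -> {mpoly CC[n]}) :
  family F -> family G -> family (fun x => F x * G x).
Proof.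
move=> fF fG m; apply: (fa_ext (fun x => esym (mcoeffM (F x) (G x) m))).
by apply: fa_sum => k; apply: fa_mul.
Qed.

Lemma family_sum n (I : Type) (r : seq I) (P : pred I)
    (F : I -> T -> {mpoly CC[n]}) :
  (forall i, family (F i)) -> family (fun x => \sum_(i <- r | P i) F i x).
Proof.
move=> fF m; apply: (@fa_ext (fun x => \sum_(i <- r | P i) (F i x)@_m)).
  by move=> x; rewrite raddf_sum.
by apply: fa_sum => i; exact: fF.
Qed.

Lemma fa_polyfun n phi (G : T -> poly_n n) :
  polyfun n phi -> family G -> A (fun x => phi (G x)).
Proof.
move=> pphi fG; elim: pphi => [c|m|f g _ Hf _ Hg|f g _ Hf _ Hg].
- exact: fa_const.
- exact: fG.
- exact: fa_add.
- exact: fa_mul.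
Qed.

End FunAlgebra.

Lemma polyfun_algebra n : fun_algebra (polyfun n).
Proof. by split; [exact: pf_const | exact: pf_add | exact: pf_mul]. Qed.

Definition poly1 (f : CC -> CC) := exists p : {poly CC}, forall x, f x = p.[x].

Lemma poly1_algebra : fun_algebra poly1.
Proof.
split=> [c|f g [p fp] [q gq]|f g [p fp] [q gq]].
- by exists c%:P => x; rewrite hornerC.
- by exists (p + q) => x; rewrite hornerD fp gq.
- by exists (p * q) => x; rewrite hornerM fp gq.
Qed.

Lemma poly1_id : poly1 id.
Proof. by exists 'X => x; rewrite hornerX. Qed.

Lemma poly1_nz f g : poly1 f -> poly1 g -> (forall x, f x * g x = 0) ->
  forall x0, f x0 != 0 -> forall x, g x = 0.
Proof.
move=> [p fp] [q gq] fg x0 fx0.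
have /eqP : p * q = 0.
  by apply: poly_nat_roots natCC_neq0 _ => n; rewrite hornerM -fp -gq fg.
rewrite mulf_eq0 => /orP[/eqP p0|/eqP q0]; last by move=> x; rewrite gq q0 horner0.
by rewrite fp p0 horner0 eqxx in fx0.
Qed.

Definition polyM M (f : ('I_M -> CC) -> CC) :=
  exists p : {mpoly CC[M]}, forall v, f v = p.@[v].

Lemma polyM_algebra M : fun_algebra (@polyM M).
Proof.
split=> [c|f g [p fp] [q gq]|f g [p fp] [q gq]].
- by exists c%:MP => v; rewrite mevalC.
- by exists (p + q) => v; rewrite mevalD fp gq.
- by exists (p * q) => v; rewrite mevalM fp gq.
Qed.

Lemma polyM_coord M (i : 'I_M) : polyM (fun v => v i).
Proof. by exists 'X_i => v; rewrite mevalXU. Qed.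

Section AlongLines.
Variable V : lmodType CC.

Definition along_lines (H : V -> CC) := forall p q, poly1 (fun x => H (p + x *: q)).

Lemma along_lines_algebra : fun_algebra along_lines.
Proof.
have [c ad mu] := poly1_algebra.
by split=> [k|f g Hf Hg|f g Hf Hg] p q; [exact: c|exact: ad|exact: mu].
Qed.

(** This replaces irreducibility of [S]: on the line joining [p0] to [p], [H1] is a nonzero
    polynomial, so [H2] vanishes along the line. In the applications [H1] is a genericity condition
    with an explicit witness [p0]. *)
Lemma along_lines_domain (S : V -> Prop) H1 H2 :
  (forall p q x, S p -> S q -> S (p + x *: (q - p))) ->
  along_lines H1 -> along_lines H2 ->
  (forall p, S p -> H1 p * H2 p = 0) ->
  forall p0, S p0 -> H1 p0 != 0 -> forall p, S p -> H2 p = 0.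
Proof.
move=> Sline l1 l2 H12 p0 Sp0 Hp0 p Sp.
have E := poly1_nz (l1 p0 (p - p0)) (l2 p0 (p - p0)).
have /E : forall x, H1 (p0 + x *: (p - p0)) * H2 (p0 + x *: (p - p0)) = 0.
  by move=> x; apply/H12/Sline.
by move/(_ 0); rewrite scale0r addr0 => /(_ Hp0 1); rewrite scale1r addrC subrK.
Qed.

(** Nonempty open conditions on [S] can be met simultaneously; otherwise [along_lines_domain] would
    make one of the factors vanish on all of [S]. *)
Lemma along_lines_prod_neq0 (S : V -> Prop) (I : eqType) (r : seq I) (H : I -> V -> CC) :
  (forall p q x, S p -> S q -> S (p + x *: (q - p))) ->
  (exists p, S p) ->
  (forall i, along_lines (H i)) ->
  (forall i, i \in r -> exists2 p, S p & H i p != 0) ->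
  exists2 p, S p & \prod_(i <- r) H i p != 0.
Proof.
move=> Sline S0 lH; elim: r => [|i r IH] Hr.
  by case: S0 => p Sp; exists p; rewrite ?big_nil ?oner_neq0.
have [p Sp Hp] := Hr i (mem_head _ _).
have [|q Sq Hq] := IH; first by move=> j jr; apply: Hr; rewrite inE jr orbT.
case: (boolp.pselect (exists2 p, S p & \prod_(i <- i :: r) H i p != 0)) => // N.
have lr : along_lines (fun p => \prod_(i <- r) H i p).
  by apply: (fa_prod along_lines_algebra).
case/eqP: Hq; apply: (along_lines_domain Sline (lH i) lr _ Sp Hp Sq).
move=> z Sz; apply/eqP/negPn/negP => Nz; apply: N; exists z => //.
by rewrite big_cons.
Qed.

End AlongLines.

(** * The cyclic surface contains no line *)

Section NoLine.
Variables (L : idomainType) (iota : {rmorphism CC -> L}).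

Lemma iota_char0 (n : nat) : n.+1%:R != 0 :> L.
Proof. by rewrite -(rmorph_nat iota) fmorph_eq0 natCC_neq0. Qed.

(** Over a domain the orders at 0 of [P] and [Q] add up to [D], and the order of [P] is less than
    its size; hence the order of [Q] exceeds [j]. *)
Lemma monomial_factor (P Q : {poly L}) c D j : c != 0 -> P * Q = c *: 'X^D ->
  (size P + j <= D)%N -> Q`_j = 0.
Proof.
move=> c0 PQ.
have PN0 : P != 0.
  apply/eqP => P0; move: PQ; rewrite P0 mul0r => /esym/eqP.
  by rewrite scale_poly_eq0 (negbTE c0) /= -size_poly_eq0 size_polyXn.
have ex : exists i, P`_i != 0.
  by exists (size P).-1; rewrite -lead_coefE lead_coef_eq0.
case: (ex_minnP ex) => i Pi imin.
have ilt : (i < size P)%N.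
  by rewrite ltnNge; apply/negP => H; rewrite nth_default ?eqxx in Pi.
have low l : (l < i)%N -> P`_l = 0.
  by move=> li; apply/eqP/negPn/negP => /imin; rewrite leqNgt li.
elim/ltn_ind: j => j IH szj.
have := coefM P Q (i + j)%N; rewrite PQ coefZ coefXn.
rewrite (ltn_eqF (leq_trans _ szj)) ?mulr0; last by rewrite -addSn leq_add2r.
have ij : (i < (i + j).+1)%N by rewrite ltnS leq_addr.
rewrite (bigD1 (Ordinal ij)) //= addKn big1 ?addr0 => [/esym/eqP|[l Hl] /=].
  by rewrite mulf_eq0 (negbTE Pi) => /eqP.
rewrite -val_eqE /= => li; case: (ltnP l i) => [/low ->|il]; first by rewrite mul0r.
have {li}il : (i < l)%N by rewrite ltn_neqAle eq_sym li.
by rewrite IH ?mulr0 //; move: szj; lia.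
Qed.

(** Polynomials in y over a domain form a domain; for linear forms the values at the basis vectors
    and at their pairwise sums suffice. *)
Lemma forms_prod_eq0 (u0 u1 u2 p0 p1 p2 : L) :
  (forall y0 y1 y2 : CC, (u0 * iota y0 + u1 * iota y1 + u2 * iota y2) *
                         (p0 * iota y0 + p1 * iota y1 + p2 * iota y2) = 0) ->
  [|| p0 != 0, p1 != 0 | p2 != 0] -> [/\ u0 = 0, u1 = 0 & u2 = 0].
Proof.
move=> H.
have E00 := H 1 0 0; have E11 := H 0 1 0; have E22 := H 0 0 1.
have E01 := H 1 1 0; have E02 := H 1 0 1; have E12 := H 0 1 1.
rewrite ?rmorph0 ?rmorph1 ?(mulr0, mulr1, addr0, add0r) in E00 E11 E22 E01 E02 E12.
have dom (a b : L) : a * b = 0 -> b != 0 -> a = 0.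
  by move=> /eqP; rewrite mulf_eq0 => /orP[/eqP|->].
case/or3P => p; [have u := dom _ _ E00 p | have u := dom _ _ E11 p
                | have u := dom _ _ E22 p].
- split=> //; apply: (dom _ p0) => //.
    by transitivity ((u0 + u1) * (p0 + p1) - u0 * (p0 + p1) - u1 * p1);
      [ring | rewrite E01 E11 u; ring].
  by transitivity ((u0 + u2) * (p0 + p2) - u0 * (p0 + p2) - u2 * p2);
    [ring | rewrite E02 E22 u; ring].
- split=> //; apply: (dom _ p1) => //.
    by transitivity ((u0 + u1) * (p0 + p1) - u1 * (p0 + p1) - u0 * p0);
      [ring | rewrite E01 E00 u; ring].
  by transitivity ((u1 + u2) * (p1 + p2) - u1 * (p1 + p2) - u2 * p2);
    [ring | rewrite E12 E22 u; ring].
- split=> //; apply: (dom _ p2) => //.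
    by transitivity ((u0 + u2) * (p0 + p2) - u2 * (p0 + p2) - u0 * p0);
      [ring | rewrite E02 E00 u; ring].
  by transitivity ((u1 + u2) * (p1 + p2) - u2 * (p1 + p2) - u1 * p1);
    [ring | rewrite E12 E11 u; ring].
Qed.

(* The surface w^(k+4) = (xz - y^2)(x^(k+2) + y z^(k+1)) contains no line: the
   points of the line with Pluecker coordinates (l, p) are (l x y + e p, - p.y). *)
Lemma no_line k (l0 l1 l2 p0 p1 p2 : L) :
  (forall y0 y1 y2 e : CC,
     let v0 := l1 * iota y2 - l2 * iota y1 + iota e * p0 in
     let v1 := l2 * iota y0 - l0 * iota y2 + iota e * p1 in
     let v2 := l0 * iota y1 - l1 * iota y0 + iota e * p2 in
     (- (p0 * iota y0 + p1 * iota y1 + p2 * iota y2)) ^+ k.+4 =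
     (v0 * v2 - v1 ^+ 2) * (v0 ^+ k.+2 + v1 * v2 ^+ k.+1)) ->
  [/\ l0 = 0, l1 = 0, l2 = 0, p0 = 0 & p1 = 0 /\ p2 = 0].
Proof.
move=> H.
have [pN0|/norP[/negPn/eqP p00 /norP[/negPn/eqP p10 /negPn/eqP p20]]] :=
  boolP [|| p0 != 0, p1 != 0 | p2 != 0]; last first.
  (* For p = 0 the points l x y fill a line in the plane w = 0, where the equation is a product; six
     choices of y exclude each pattern of nonzero entries of l. *)
  have E y0 y1 y2 : (((l1 * iota y2 - l2 * iota y1) * (l0 * iota y1 - l1 * iota y0)
     - (l2 * iota y0 - l0 * iota y2) ^+ 2) == 0) ||
     ((l1 * iota y2 - l2 * iota y1) ^+ k.+2 +
       (l2 * iota y0 - l0 * iota y2) * (l0 * iota y1 - l1 * iota y0) ^+ k.+1 == 0).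
    have /= := H y0 y1 y2 0; rewrite p00 p10 p20 rmorph0 !mul0r !addr0 oppr0 expr0n /=.
    by move/esym/eqP; rewrite mulf_eq0.
  have E0 := E 1 0 0; have E1 := E 0 1 0; have E2 := E 0 0 1.
  have F0 := E 0 1 1; have F1 := E 1 0 1; have F2 := E 1 1 0.
  have z1 : (0 : L) ^+ k.+1 = 0 by rewrite expr0n.
  have z2 : (0 : L) ^+ k.+2 = 0 by rewrite expr0n.
  have e1 (a : L) : (a ^+ k.+1 == 0) = (a == 0) by rewrite expf_eq0.
  have e2 (a : L) : (a ^+ k.+2 == 0) = (a == 0) by rewrite expf_eq0.
  have e3 (a : L) : (a ^+ 2 == 0) = (a == 0) by rewrite expf_eq0.
  have z3 : (0 : L) ^+ 2 = 0 by rewrite expr0n.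
  pose R := (rmorph0, rmorph1, mulr0, mulr1, addr0, add0r, sub0r, subr0, mul0r, z1, z2,
    z3, e1, e2, e3, sqrrN, oppr0, oppr_eq0, mulf_eq0, subrr, eqxx, orbT, orbF, orbb,
    mulNr, mulrN).
  rewrite !R in E0 E1 E2 F0 F1 F2.
  case: (eqVneq l0 0) E0 E1 E2 F0 F1 F2 => [->|n0];
  case: (eqVneq l1 0) => [->|n1]; case: (eqVneq l2 0) => [->|n2];
  by rewrite ?R ?(negbTE n0) ?(negbTE n1) ?(negbTE n2).
have F (y0 y1 y2 : CC) : p0 * iota y0 + p1 * iota y1 + p2 * iota y2 != 0 ->
  let A0 := l1 * iota y2 - l2 * iota y1 in
  let A1 := l2 * iota y0 - l0 * iota y2 in
  let A2 := l0 * iota y1 - l1 * iota y0 in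
  [/\ p0 * p2 - p1 ^+ 2 = 0, p0 ^+ k.+2 + p1 * p2 ^+ k.+1 = 0,
     p0 * A2 + A0 * p2 - 2%:R * p1 * A1 = 0,
     k.+2%:R * p0 ^+ k.+1 * A0 + A1 * p2 ^+ k.+1 + p1 * (k.+1%:R * p2 ^+ k * A2) = 0
   & [|| l0 != 0, l1 != 0 | l2 != 0]].
  set pi := (X in X != 0) => piN0 A0 A1 A2.
  (* With e = 1 and y scaled by X, the point is p + X A and its last coordinate is - X pi. So P Q is
     a multiple of X^(k+4) while P and Q have degrees at most 2 and k+2: both vanish to order two at
     0, i.e. the line through p in direction A is tangent there to both plane curves. *)
  pose lin a b : {poly L} := a%:P + b *: 'X.
  have linE a b x : (lin a b).[x] = a + x * b.
    by rewrite /lin hornerD hornerC hornerZ hornerX mulrC.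
  have lin0 a b : (lin a b)`_0 = a by rewrite -horner_coef0 linE mul0r addr0.
  have szlin a b : (size (lin a b) <= 2)%N.
    rewrite (leq_trans (size_polyD _ _)) // geq_max (leq_trans (size_polyC_leq1 _)) //.
    by rewrite (leq_trans (size_scale_leq _ _)) // size_polyX.
  have dlin a b : (lin a b)^`() = b%:P.
    by rewrite /lin derivD derivC derivZ derivX add0r -mul_polyC mulr1.
  pose hE := (linE, horner_exp, hornerC, hornerX, hornerMn, hornerD, hornerN, hornerM).
  pose P := lin p0 A0 * lin p2 A2 - lin p1 A1 ^+ 2.
  pose Q := lin p0 A0 ^+ k.+2 + lin p1 A1 * lin p2 A2 ^+ k.+1.
  have PQ : P * Q = (- pi) ^+ k.+4 *: 'X^(k.+4).
    apply/eqP; rewrite -subr_eq0; apply/eqP; apply: (poly_nat_roots iota_char0) => n.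
    rewrite hornerD hornerN hornerZ hornerXn /P /Q !hE.
    have := H (n%:R * y0) (n%:R * y1) (n%:R * y2) 1; rewrite rmorph1 !mul1r.
    rewrite !rmorphM !rmorph_nat /=.
    have -> : - (p0 * (n%:R * iota y0) + p1 * (n%:R * iota y1) + p2 * (n%:R * iota y2))
       = (- pi) * n%:R by rewrite /pi; ring.
    rewrite exprMn => ->; rewrite /A0 /A1 /A2; apply/eqP; rewrite subr_eq0; apply/eqP.
    congr (_ * _); first by ring.
    by congr (_ ^+ _ + _ * _ ^+ _); ring.
  have cN0 : (- pi) ^+ k.+4 != 0 by rewrite expf_eq0 /= oppr_eq0.
  have szM (a b : {poly L}) i j : (size a <= i.+1)%N -> (size b <= j.+1)%N ->
      (size (a * b)%R <= (i + j).+1)%N.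
    by move=> sa sb; have := @size_polyMleq _ a b; move: sa sb; lia.
  have szP : (size P < k.+4)%N.
    rewrite (leq_trans (n := 4)) // ltnS (leq_trans (size_polyD _ _)) // geq_max size_polyN.
    by rewrite expr2 !(szM _ _ 1%N 1%N).
  have szpow a b n : (size (lin a b ^+ n) <= n.+1)%N.
    rewrite (leq_trans (size_poly_exp_leq _ _)) // ltnS.
    by case: (size _) (szlin a b) => [|[|[|]]] //= _; lia.
  have szQ : (size Q < k.+4)%N.
    rewrite ltnS (leq_trans (size_polyD _ _)) // geq_max (szpow _ _ k.+2) /=.
    by rewrite (szM _ _ 1%N k.+1) ?szlin ?szpow.
  have QP : Q * P = (- pi) ^+ k.+4 *: 'X^(k.+4) by rewrite mulrC.
  have [Q0 Q1] : Q`_0 = 0 /\ Q`_1 = 0.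
    by split; apply: (monomial_factor cN0 PQ); rewrite ?addn0 ?addn1 // ltnW.
  have [P0 P1] : P`_0 = 0 /\ P`_1 = 0.
    by split; apply: (monomial_factor cN0 QP); rewrite ?addn0 ?addn1 // ltnW.
  have d1 (R : {poly L}) : R`_1 = (R^`()).[0] by rewrite horner_coef0 coef_deriv.
  split.
  - by rewrite -P0 -horner_coef0 /P !hE; ring.
  - by rewrite -Q0 -horner_coef0 /Q !hE !mul0r !addr0.
  - rewrite -P1 d1 /P derivD derivN expr2 !derivM !dlin !hE; ring.
  - rewrite -Q1 d1 /Q derivD derivM !deriv_exp !dlin !hE.
    rewrite !mul0r !addr0 /=; ring.
  apply/negPn/negP => /norP[/negPn/eqP l00 /norP[/negPn/eqP l10 /negPn/eqP l20]].
  have PP : P = 0.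
    apply: (poly_nat_roots iota_char0) => n; rewrite !hE.
    move: P0; rewrite -horner_coef0 /P !hE !mul0r !addr0 => <-.
    by rewrite /A0 /A1 /A2 l00 l10 l20; ring.
  move: PQ; rewrite PP mul0r => /esym/eqP.
  by rewrite scale_poly_eq0 (negbTE cN0) /= -size_poly_eq0 size_polyXn.
have /boolp.existsNP [y0 /boolp.existsNP [y1 /boolp.existsNP [y2 /eqP piN0]]] :
  ~ (forall y0 y1 y2 : CC, p0 * iota y0 + p1 * iota y1 + p2 * iota y2 = 0).
  move=> Z; have := Z 1 0 0; have := Z 0 1 0; have := Z 0 0 1.
  rewrite rmorph0 rmorph1 !(mulr0, mulr1, addr0, add0r) => a b c.
  by rewrite a b c eqxx in pN0.
have [Et Es _ _ lN0] := F _ _ _ piN0.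
have piF z0 z1 z2 := F z0 z1 z2.
(* The tangency condition is linear in y but known only where p.y is nonzero. Multiplied by p.y it
   holds everywhere, and [forms_prod_eq0] removes the factor again. The outcome is that the gradient
   (p2, -2 p1, p0) of the quadric is parallel to l; below, (g0, g1, g2) is the gradient of the other
   curve. *)
have [T0 T1 T2] : [/\ (- (2%:R * p1)) * l2 - p0 * l1 = 0,
    p0 * l0 - p2 * l2 = 0 & p2 * l1 - (- (2%:R * p1)) * l0 = 0].
  apply: (forms_prod_eq0 (p0 := p0) (p1 := p1) (p2 := p2)) pN0 => z0 z1 z2.
  case: (eqVneq (p0 * iota z0 + p1 * iota z1 + p2 * iota z2) 0) => [->|]; first by rewrite mulr0.
  move/F => [_ _ E _ _]; apply/eqP; rewrite mulf_eq0; apply/orP; left; apply/eqP.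
  by rewrite -[RHS]E; ring.
pose g0 := k.+2%:R * p0 ^+ k.+1; pose g1 := p2 ^+ k.+1.
pose g2 := k.+1%:R * p1 * p2 ^+ k.
have [S0 S1 S2] : [/\ g1 * l2 - g2 * l1 = 0, g2 * l0 - g0 * l2 = 0 & g0 * l1 - g1 * l0 = 0].
  apply: (forms_prod_eq0 (p0 := p0) (p1 := p1) (p2 := p2)) pN0 => z0 z1 z2.
  case: (eqVneq (p0 * iota z0 + p1 * iota z1 + p2 * iota z2) 0) => [->|]; first by rewrite mulr0.
  move/F => [_ _ _ E _]; apply/eqP; rewrite mulf_eq0; apply/orP; left; apply/eqP.
  by rewrite -[RHS]E /g0 /g1 /g2; ring.
(* both gradients are parallel to l, hence to each other *)
have [X01 X02] : p2 * g1 + 2%:R * p1 * g0 = 0 /\ p2 * g2 - p0 * g0 = 0.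
  have dom (a b : L) : a * b = 0 -> b != 0 -> a = 0.
    by move=> /eqP; rewrite mulf_eq0 => /orP[/eqP|->].
  case/or3P: lN0 => ln; split; apply: (dom _ _ _ ln).
  - transitivity (- p2 * (g0 * l1 - g1 * l0) + g0 * (p2 * l1 - (- (2%:R * p1)) * l0)); first by ring.
    by rewrite S2 T2; ring.
  - transitivity (p2 * (g2 * l0 - g0 * l2) - g0 * (p0 * l0 - p2 * l2)); first by ring.
    by rewrite S1 T1; ring.
  - transitivity (g1 * (p2 * l1 - (- (2%:R * p1)) * l0) - (- (2%:R * p1)) * (g0 * l1 - g1 * l0)); first by ring.
    by rewrite S2 T2; ring.
  - transitivity (- p2 * (g1 * l2 - g2 * l1) + p2 * (g1 * l2) - p0 * (g0 * l1 - g1 * l0) - p0 * g1 * l0); first by ring.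
    rewrite S0 S2.
    transitivity (- g1 * (p0 * l0 - p2 * l2)); first by ring.
    by rewrite T1; ring.
  - transitivity (p2 * (g1 * l2 - g2 * l1) + g2 * (p2 * l1) - (- (2%:R * p1)) * (g0 * l2)); first by ring.
    rewrite S0.
    transitivity (g2 * (p2 * l1 - (- (2%:R * p1)) * l0) + (- (2%:R * p1)) * (g2 * l0 - g0 * l2)); first by ring.
    by rewrite S1 T2; ring.
  - transitivity (g2 * (p2 * l2 - p0 * l0) + p0 * (g2 * l0 - g0 * l2)); first by ring.
    by rewrite S1 -opprB T1; ring.
have p00 : p0 = 0.
  (* By [Es], [p2 * g2] equals -(k+1) p0^(k+2), while [p0 * g0] is (k+2) p0^(k+2); the coefficients
     add up to 2k+3. *)
  have : (2 * k + 3)%:R * p0 ^+ k.+2 = 0.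
    transitivity (- (p2 * g2 - p0 * g0) + k.+1%:R * (p0 ^+ k.+2 + p1 * p2 ^+ k.+1)).
      by rewrite /g0 /g2 !exprS; ring.
    by rewrite X02 Es; ring.
  move/eqP; rewrite mulf_eq0 expf_eq0 /= => /orP[|/eqP //].
  by rewrite addnS (negbTE (iota_char0 _)).
have p10 : p1 = 0.
  by move: Et; rewrite p00 mul0r sub0r => /eqP; rewrite oppr_eq0 expf_eq0 => /andP[_ /eqP].
have p20 : p2 = 0.
  move: X01; rewrite p10 mulr0 mul0r addr0 /g1 -exprS => /eqP.
  by rewrite expf_eq0 => /andP[_ /eqP].
by move: pN0; rewrite p00 p10 p20 eqxx.
Qed.

End NoLine.

(** * Krull's theorem *)

Section Ideals.
Variable R : comNzRingType.

Inductive ideal_gen (G : R -> Prop) : R -> Prop :=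
| ideal_gen0 : ideal_gen G 0
| ideal_gen_gen g : G g -> ideal_gen G g
| ideal_genD x y : ideal_gen G x -> ideal_gen G y -> ideal_gen G (x + y)
| ideal_genM r x : ideal_gen G x -> ideal_gen G (r * x).

Lemma ideal_gen_sub (G G' : R -> Prop) x :
  (forall g, G g -> ideal_gen G' g) -> ideal_gen G x -> ideal_gen G' x.
Proof.
move=> sub; elim=> [|g Gg|y z _ Hy _ Hz|r y _ Hy].
- exact: ideal_gen0.
- exact: sub.
- exact: ideal_genD.
- exact: ideal_genM.
Qed.

Lemma ideal_gen_adjoin (G : R -> Prop) a x :
  ideal_gen (fun g => G g \/ g = a) x ->
  exists i r, ideal_gen G i /\ x = i + r * a.
Proof.
elim=> [|g [Gg|->]|y z _ [i [r [Gi ->]]] _ [j [s [Gj ->]]]|s y _ [i [r [Gi ->]]]].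
- by exists 0, 0; split; [exact: ideal_gen0 | rewrite mul0r addr0].
- by exists g, 0; split; [exact: ideal_gen_gen | rewrite mul0r addr0].
- by exists 0, 1; split; [exact: ideal_gen0 | rewrite mul1r add0r].
- by exists (i + j), (r + s); split; [exact: ideal_genD | ring].
- by exists (s * i), (s * r); split; [exact: ideal_genM | ring].
Qed.

(** Zorn is applied to sets of extra generators instead of ideals. A membership in the ideal of a
    chain's union uses finitely many generators, hence already holds for one member, or for [G]
    alone, which covers the empty chain. *)
Lemma exists_max_avoiding (G : R -> Prop) u :
  (forall e, ~ ideal_gen G (u ^+ e)) ->
  exists A : R -> Prop,
    (forall e, ~ ideal_gen (fun g => G g \/ A g) (u ^+ e)) /\
    forall a, ~ A a -> exists e, ideal_gen (fun g => (G g \/ A g) \/ g = a) (u ^+ e).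
Proof.
move=> Gu.
pose P (A : classical_sets.set R) := forall e, ~ ideal_gen (fun g => G g \/ A g) (u ^+ e).
have [F FP Ftot|A [PA Amax]] := @classical_sets.Zorn_bigcup R P.
  move=> e H.
  suff [GX|[X FX XX]] : ideal_gen G (u ^+ e) \/
      exists2 X, F X & ideal_gen (fun g => G g \/ X g) (u ^+ e).
  - exact: Gu GX.
  - exact: FP FX _ XX.
  elim: H => [|g [Gg|[X FX Xg]]|x y _ Hx _ Hy|r x _ Hx].
  - by left; exact: ideal_gen0.
  - by left; exact: ideal_gen_gen.
  - by right; exists X => //; apply: ideal_gen_gen; right.
  - case: Hx Hy => [Gx|[X FX Xx]] [Gy|[Y FY Yy]].
    + by left; exact: ideal_genD.
    + right; exists Y => //; apply: ideal_genD => //.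
      by apply: ideal_gen_sub Gx => g Gg; apply: ideal_gen_gen; left.
    + right; exists X => //; apply: ideal_genD => //.
      by apply: ideal_gen_sub Gy => g Gg; apply: ideal_gen_gen; left.
    + right; case: (Ftot X Y FX FY) => XY.
        exists Y => //; apply: ideal_genD => //; apply: ideal_gen_sub Xx => g [Gg|Xg];
          apply: ideal_gen_gen; [by left | by right; apply: XY].
      exists X => //; apply: ideal_genD => //; apply: ideal_gen_sub Yy => g [Gg|Yg];
        apply: ideal_gen_gen; [by left | by right; apply: XY].
  - case: Hx => [Gx|[X FX Xx]]; first by left; exact: ideal_genM.
    by right; exists X => //; exact: ideal_genM.
exists A; split=> // a Aa; apply/boolp.not_existsP => H.
apply: (Amax (fun g => A g \/ g = a)).
  by split; [move=> g Ag; left | move=> sub; apply: Aa; apply: sub; right].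
move=> e He; apply: (H e); apply: ideal_gen_sub He => g [Gg|[Ag|->]];
  apply: ideal_gen_gen; by [left; left | left; right | right].
Qed.

End Ideals.

Section DomainUnits.
Variables (Q : comNzRingType).
Hypothesis dom : forall x y : Q, x * y = 0 -> (x == 0) || (y == 0).

Definition domain_of of (forall x y : Q, x * y = 0 -> (x == 0) || (y == 0)) : Type := Q.
Local Notation D := (domain_of dom).

HB.instance Definition _ := GRing.ComNzRing.on D.

(** An [idomainType] carries units and inverses, which the quotient by a prime ideal does not
    provide; they are chosen classically on an alias of the ring. *)
Definition domain_unit : pred D := fun x => boolp.asbool (exists y : D, y * x = 1).

Definition domain_inv (x : D) : D :=
  match boolp.pselect (exists y : D, y * x = 1) with
  | left h => projT1 (boolp.cid h)
  | right _ => x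
  end.

Lemma domain_mulVr : {in domain_unit, left_inverse 1 domain_inv *%R}.
Proof.
move=> x /boolp.asboolP ux; rewrite /domain_inv.
by case: boolp.pselect => // h; case: boolp.cid.
Qed.

Lemma domain_unitP (x y : D) : y * x = 1 -> x \in domain_unit.
Proof. by move=> yx; apply/boolp.asboolP; exists y. Qed.

Lemma domain_inv_out : {in [predC domain_unit], domain_inv =1 id}.
Proof.
move=> x /boolp.asboolP ux; rewrite /domain_inv.
by case: boolp.pselect.
Qed.

HB.instance Definition _ :=
  GRing.ComNzRing_hasMulInverse.Build D domain_mulVr domain_unitP domain_inv_out.
HB.instance Definition _ := GRing.ComUnitRing_isIntegral.Build D dom.

Definition domain_idomain : idomainType := D.

Definition to_domain : Q -> domain_idomain := id.

Lemma to_domain_additive : zmod_morphism to_domain. Proof. by []. Qed.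
Lemma to_domain_multiplicative : monoid_morphism to_domain. Proof. by []. Qed.
HB.instance Definition _ := GRing.isZmodMorphism.Build Q domain_idomain to_domain to_domain_additive.
HB.instance Definition _ := GRing.isMonoidMorphism.Build Q domain_idomain to_domain to_domain_multiplicative.

End DomainUnits.

Section PrimeQuotient.
Local Open Scope quotient_scope.
Variables (R : comNzRingType) (S : {pred R}).

Definition prime_pred of idealr_closed S & prime_idealr_closed S : {pred R} := S.

Variables (idealS : idealr_closed S) (primeS : prime_idealr_closed S).
Local Notation I := (prime_pred idealS primeS).

HB.instance Definition _ := isIdealr.Build R I idealS.
HB.instance Definition _ := isPrimeIdealrClosed.Build R I primeS.

Lemma prime_quotient :
  exists (L : idomainType) (h : {rmorphism R -> L}), forall x, (h x == 0) = (x \in S).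
Proof.
pose Q := {ideal_quot I}.
have dom : forall x y : Q, x * y = 0 -> (x == 0) || (y == 0).
  exact: Quotient.rquot_IdomainAxiom.
exists (domain_idomain dom), (@to_domain Q dom \o \pi_Q) => x.
rewrite -[x \in S]/(x \in I) -[x in RHS]subr0.
by rewrite Quotient.idealrBE (rmorph0 (\pi_Q)).
Qed.

End PrimeQuotient.

(** An ideal maximal among those containing [G] and no power of [u] is prime: two elements outside
    it yield powers of [u], whose product returns to the ideal if the product of the elements lies
    in it. In the quotient domain [u] would be nonzero. *)
Lemma krull_nilpotent (R : comNzRingType) (G : R -> Prop) (u : R) :
  (forall (L : idomainType) (h : {rmorphism R -> L}),
     (forall g, G g -> h g = 0) -> h u = 0) ->
  exists e, ideal_gen G (u ^+ e).
Proof.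
move=> Hu; apply: boolp.contrapT => /boolp.forallNP N.
have [A [A1 A2]] := exists_max_avoiding N.
pose GA g := G g \/ A g.
pose I : {pred R} := fun x => boolp.asbool (ideal_gen GA x).
have inI x : reflect (ideal_gen GA x) (x \in I) by apply: boolp.asboolP.
have idealI : idealr_closed I.
  split; first by apply/inI; exact: ideal_gen0.
    by apply/inI => H; apply: (A1 0%N); rewrite expr0.
  by move=> a x y /inI Ix /inI Iy; apply/inI/ideal_genD => //; exact: ideal_genM.
have primeI : prime_idealr_closed I.
  move=> x y /inI Ixy; apply/negPn/negP => /norP[/negP Ix /negP Iy].
  have [|e He] := A2 x; first by move=> Ax; apply: Ix; apply/inI/ideal_gen_gen; right.
  have [|e' He'] := A2 y; first by move=> Ay; apply: Iy; apply/inI/ideal_gen_gen; right.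
  have [i [r [Ii E]]] := ideal_gen_adjoin He.
  have [j [s [Ij E']]] := ideal_gen_adjoin He'.
  apply: (A1 (e + e')%N); rewrite exprD E E'.
  rewrite (_ : _ * _ = (j + s * y) * i + (r * x * j + r * s * (x * y))); last by ring.
  apply: ideal_genD; first exact: ideal_genM.
  by apply: ideal_genD; apply: ideal_genM.
have [L [h hI]] := prime_quotient idealI primeI.
have /eqP : h u = 0.
  by apply: Hu => g Gg; apply/eqP; rewrite hI; apply/inI/ideal_gen_gen; left.
by rewrite hI => /inI Iu; apply: (A1 1%N); rewrite expr1.
Qed.

(** * A resultant for lines on a surface *)

Notation mp := {mpoly CC[4]}.
Definition o0 : 'I_4 := @Ordinal 4 0 isT.
Definition o1 : 'I_4 := @Ordinal 4 1 isT.
Definition o2 : 'I_4 := @Ordinal 4 2 isT.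
Definition o3 : 'I_4 := @Ordinal 4 3 isT.

Lemma ord4P (P : 'I_4 -> Prop) : P o0 -> P o1 -> P o2 -> P o3 -> forall i, P i.
Proof.
move=> P0 P1 P2 P3 [[|[|[|[|i]]]] Hi] //.
- by rewrite (_ : Ordinal Hi = o0) //; apply: val_inj.
- by rewrite (_ : Ordinal Hi = o1) //; apply: val_inj.
- by rewrite (_ : Ordinal Hi = o2) //; apply: val_inj.
- by rewrite (_ : Ordinal Hi = o3) //; apply: val_inj.
Qed.

Lemma big_ord4 (R : Type) (idx : R) (op : Monoid.law idx) (F : 'I_4 -> R) :
  \big[op/idx]_(i < 4) F i = op (F o0) (op (F o1) (op (F o2) (F o3))).
Proof.
rewrite !big_ord_recl big_ord0 Monoid.mulm1.
by congr (op _ (op _ (op _ _))); congr F; apply: val_inj.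
Qed.

Lemma prod_ord4 (R : pzRingType) (F : 'I_4 -> R) :
  \prod_(i < 4) F i = F o0 * (F o1 * (F o2 * F o3)).
Proof. exact: big_ord4. Qed.

Section Homogeneous.
Variable n : nat.
Implicit Types p q : {mpoly CC[n]}.

Lemma homog_mevalZ d p (t : CC) (v : 'I_n -> CC) : p \is d.-homog ->
  p.@[fun i => t * v i] = t ^+ d * p.@[v].
Proof.
move=> hp; rewrite !mevalE big_distrr /=; apply: eq_big_seq => m mp.
rewrite mulrCA; congr (_ * _).
under eq_bigr do rewrite exprMn.
by rewrite big_split prodrXr -mdegE (dhomog_mf hp mp).
Qed.

Lemma homog_sum d p : p \is d.-homog ->
  p = \sum_(m : 'X_{1..n < d.+1} | mdeg m == d) p@_m *: 'X_[m].
Proof.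
move=> hp; rewrite {1}(@mpolywE _ _ d.+1 p); last first.
  by rewrite msizeE; apply/bigmax_leqP_seq => m mp _; rewrite (dhomog_mf hp mp).
rewrite [LHS](bigID (fun m : 'X_{1..n < d.+1} => mdeg m == d)) /= [X in _ + X]big1 ?addr0 //.
by move=> m md; rewrite (dhomog_nemf_coeff hp md) scale0r.
Qed.

Lemma mcoeff_pihomog d p m : (pihomog mdeg d p)@_m = if mdeg m == d then p@_m else 0.
Proof.
case: eqVneq => [md|]; last exact: dhomog_nemf_coeff (pihomogP _ _ _).
set K := maxn (msize p) d.+1; have dK : (d < K)%N by rewrite leq_maxr.
transitivity (\sum_(j < K) (pihomog mdeg j p)@_m).
  rewrite (bigD1 (Ordinal dK)) //= [X in _ = _ + X]big1 ?addr0 // => j jd.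
  apply: dhomog_nemf_coeff (pihomogP _ _ _) _.
  by apply: contra jd => /eqP dj; apply/eqP/val_inj; exact: etrans (esym dj) md.
rewrite [in RHS](@pihomog_partitionE _ _ mdeg K p) ?leq_maxl //.
exact/esym/(raddf_sum (mcoeff m)).
Qed.

Lemma homog_comp d p k (lq : n.-tuple {mpoly CC[k]}) :
  p \is d.-homog -> (forall i, tnth lq i \is 1.-homog) -> p \mPo lq \is d.-homog.
Proof.
move=> hp hq; rewrite (homog_sum hp) raddf_sum; apply: rpred_sum => m /eqP md.
rewrite /= linearZ; apply: dhomogZ; rewrite /= comp_mpolyX.
suff : \prod_(i < n) tnth lq i ^+ m i \is (\sum_(i < n) m i).-homog by rewrite -mdegE md.
elim/big_rec2 : _ => [|i q e _ He]; first exact: dhomog1.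
by apply: dhomogM => //; have := dhomogMn (m i) (hq i); rewrite mul1n.
Qed.

End Homogeneous.

(** A [polyfun] reads finitely many coefficients whereas [F] may depend on all of them; the
    agreement is therefore in one degree, while linearity of [phi] holds on all polynomials. *)
Lemma linear_polyfun n d (F : poly_n n -> CC) :
  (forall a f g, F (a *: f + g) = a * F f + F g) ->
  exists phi, [/\ polyfun n phi, forall c f, phi (c *: f) = c * phi f
    & forall f, f \is d.-homog -> phi f = F f].
Proof.
move=> lF.
have F0 : F 0 = 0 by have := lF (-1) 0 0; rewrite scaleN1r oppr0 addr0 mulN1r addNr.
have FD f g : F (f + g) = F f + F g by have := lF 1 f g; rewrite scale1r mul1r.
have FZ c f : F (c *: f) = c * F f by have := lF c f 0; rewrite F0 !addr0.
exists (fun f => \sum_(m : 'X_{1..n.+1 < d.+1} | mdeg m == d) f@_m * F 'X_[m]).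
split.
- apply: (fa_sum (polyfun_algebra n)) => m; apply: pf_mul; [exact: pf_coef | exact: pf_const].
- by move=> c f; rewrite big_distrr /=; apply: eq_bigr => m _; rewrite mcoeffZ mulrA.
- move=> f hf; rewrite [in RHS](homog_sum hf) (big_morph _ FD F0).
  by apply: eq_bigr => m _; rewrite FZ.
Qed.

Definition u6 (i : nat) (Hi : (i < 6)%N) : {mpoly CC[6]} := 'X_(Ordinal Hi).

(* As [y] and [e] vary, [line_pt] runs over the line with Pluecker coordinates ('X_0, 'X_1, 'X_2)
   and ('X_3, 'X_4, 'X_5). *)
Definition line_pt (y : CC * CC * CC * CC) : 4.-tuple {mpoly CC[6]} :=
  let: (y0, y1, y2, e) := y in
  [tuple y2 *: @u6 1 isT - y1 *: @u6 2 isT + e *: @u6 3 isT;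
         y0 *: @u6 2 isT - y2 *: @u6 0 isT + e *: @u6 4 isT;
         y1 *: @u6 0 isT - y0 *: @u6 1 isT + e *: @u6 5 isT;
         - (y0 *: @u6 3 isT + y1 *: @u6 4 isT + y2 *: @u6 5 isT)].

Lemma line_ptE y0 y1 y2 e (v := line_pt (y0, y1, y2, e)) :
  [/\ tnth v o0 = y2 *: @u6 1 isT - y1 *: @u6 2 isT + e *: @u6 3 isT,
      tnth v o1 = y0 *: @u6 2 isT - y2 *: @u6 0 isT + e *: @u6 4 isT,
      tnth v o2 = y1 *: @u6 0 isT - y0 *: @u6 1 isT + e *: @u6 5 isT
    & tnth v o3 = - (y0 *: @u6 3 isT + y1 *: @u6 4 isT + y2 *: @u6 5 isT)].
Proof. by []. Qed.

Definition quadric_t : mp := 'X_o0 * 'X_o2 - 'X_o1 ^+ 2.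
Definition curve_s k : mp := 'X_o0 ^+ k.+2 + 'X_o1 * 'X_o2 ^+ k.+1.
Definition cyclic_surface k : mp := 'X_o3 ^+ k.+4 - quadric_t * curve_s k.

Lemma homogX1 n (i : 'I_n) : ('X_i : {mpoly CC[n]}) \is 1.-homog.
Proof. by rewrite dhomogX; apply/eqP; exact: mdeg1. Qed.

Lemma homogXn n (i : 'I_n) k : ('X_i ^+ k : {mpoly CC[n]}) \is k.-homog.
Proof. by have := dhomogMn k (homogX1 i); rewrite mul1n. Qed.

Lemma quadric_t_homog : quadric_t \is 2.-homog.
Proof.
apply: rpredB; last exact: homogXn.
exact: (dhomogM (homogX1 _) (homogX1 _)).
Qed.

Lemma curve_s_homog k : curve_s k \is (k.+2).-homog.
Proof.
apply: rpredD; first exact: homogXn.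
exact: (dhomogM (homogX1 _) (homogXn _ _)).
Qed.

Lemma cyclic_surface_homog k : cyclic_surface k \is (k.+4).-homog.
Proof.
apply: rpredB; first exact: homogXn.
exact: (dhomogM quadric_t_homog (curve_s_homog _)).
Qed.

Lemma rmorph_cyclic_surface (S : comNzRingType) (h : {rmorphism mp -> S}) k :
  h (cyclic_surface k) = h 'X_o3 ^+ k.+4 - (h 'X_o0 * h 'X_o2 - h 'X_o1 ^+ 2) *
    (h 'X_o0 ^+ k.+2 + h 'X_o1 * h 'X_o2 ^+ k.+1).
Proof.
have hs : h (curve_s k) = h 'X_o0 ^+ k.+2 + h 'X_o1 * h 'X_o2 ^+ k.+1.
  apply: etrans (rmorphD h _ _) _; congr (_ + _); first exact: rmorphXn.
  by apply: etrans (rmorphM h _ _) _; congr (_ * _); exact: rmorphXn.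
have ht : h quadric_t = h 'X_o0 * h 'X_o2 - h 'X_o1 ^+ 2.
  apply: etrans (rmorphB h _ _) _; congr (_ - _); first exact: rmorphM.
  exact: rmorphXn.
rewrite -hs -ht; apply: etrans (rmorphB h _ _) _; congr (_ - _); first exact: rmorphXn.
exact: rmorphM.
Qed.

(** A domain in which all the equations hold provides a sextuple as in [no_line]. That lemma covers
    every sextuple, including those violating the Pluecker relation, so all six variables lie in the
    radical. *)
Lemma line_pt_nilpotent k (i : 'I_6) :
  exists e, ideal_gen (fun g => exists y, g = cyclic_surface k \mPo line_pt y) ('X_i ^+ e).
Proof.
apply: krull_nilpotent => L h hg.
pose iota := (h \o @mpolyC 6 CC) : {rmorphism CC -> L}.
have hZ c p : h (c *: p) = h p * iota c by rewrite -mul_mpolyC rmorphM mulrC.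
have [|a b c d [e f]] := @no_line L iota k (h (@u6 0 isT)) (h (@u6 1 isT)) (h (@u6 2 isT))
  (h (@u6 3 isT)) (h (@u6 4 isT)) (h (@u6 5 isT)).
  move=> y0 y1 y2 e /=.
  have := hg _ (ex_intro _ (y0, y1, y2, e) erefl).
  pose g : {rmorphism mp -> L} := h \o comp_mpoly (line_pt (y0, y1, y2, e)).
  rewrite -[h _]/(g _) rmorph_cyclic_surface.
  have gX j : g 'X_j = h (tnth (line_pt (y0, y1, y2, e)) j).
    by rewrite (tnth_nth 0) -comp_mpolyXU.
  have [E0 E1 E2 E3] := line_ptE y0 y1 y2 e.
  have g0 : g 'X_o0 = h (@u6 1 isT) * iota y2 - h (@u6 2 isT) * iota y1 + iota e * h (@u6 3 isT).
    by rewrite gX E0 (rmorphD h) (rmorphB h) !hZ [iota e * _]mulrC.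
  have g1 : g 'X_o1 = h (@u6 2 isT) * iota y0 - h (@u6 0 isT) * iota y2 + iota e * h (@u6 4 isT).
    by rewrite gX E1 (rmorphD h) (rmorphB h) !hZ [iota e * _]mulrC.
  have g2 : g 'X_o2 = h (@u6 0 isT) * iota y1 - h (@u6 1 isT) * iota y0 + iota e * h (@u6 5 isT).
    by rewrite gX E2 (rmorphD h) (rmorphB h) !hZ [iota e * _]mulrC.
  have g3 : g 'X_o3 = - (h (@u6 3 isT) * iota y0 + h (@u6 4 isT) * iota y1 + h (@u6 5 isT) * iota y2).
    by rewrite gX E3 (rmorphN h) !(rmorphD h) !hZ.
  by rewrite g0 g1 g2 g3 => /eqP; rewrite subr_eq0 => /eqP.
have hX (j : nat) (Hj Hj' : (j < 6)%N) : h (u6 Hj) = 0 -> h 'X_(Ordinal Hj') = 0.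
  by rewrite /u6 (bool_irrelevance Hj Hj').
by case: i => [[|[|[|[|[|[|i]]]]]] Hi] //; apply: (@hX _ isT).
Qed.

Lemma ideal_gen_comb (R : comNzRingType) (Y : Type) (c : Y -> R) x :
  ideal_gen (fun g => exists y, g = c y) x ->
  exists s : seq (Y * R), x = \sum_(z <- s) z.2 * c z.1.
Proof.
elim=> [|g [y ->]|u v _ [s ->] _ [s' ->]|r u _ [s ->]].
- by exists [::]; rewrite big_nil.
- by exists [:: (y, 1)]; rewrite big_seq1 mul1r.
- by exists (s ++ s'); rewrite big_cat.
- exists [seq (z.1, r * z.2) | z <- s].
  by rewrite big_map big_distrr /=; apply: eq_bigr => z _; rewrite mulrA.
Qed.

Lemma line_pt_monomials k :
  exists E, forall m : 'X_{1..6}, mdeg m = E ->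
    ideal_gen (fun g => exists y, g = cyclic_surface k \mPo line_pt y) 'X_[m].
Proof.
have /boolp.choice [e He] := @line_pt_nilpotent k.
pose M := (\max_i e i)%N.
(* Of six exponents with this sum, one is at least [M], hence at least the nilpotency exponent of
   its variable. *)
exists (6 * M).+1 => m mE.
have [i Mi] : exists i, (M <= m i)%N.
  apply: boolp.contrapT => /boolp.forallNP N.
  have : (mdeg m <= \sum_(i < 6) M)%N.
    by rewrite mdegE; apply: leq_sum => i _; rewrite leqNgt; apply/negP => /ltnW /N.
  by rewrite sum_nat_const card_ord mE ltnn.
have ei : (U_(i) *+ e i <= m)%MM.
  apply/mnm_lepP => j; rewrite mulmnE mnm1E; case: (eqVneq i j) => [<-|_] //.
  by rewrite mul1n (leq_trans _ Mi) // /M (leq_bigmax i).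
by rewrite -(submK ei) mpolyXD -mpolyXn; apply: ideal_genM.
Qed.

(** Points of the line are bilinear in (y, e) and the Pluecker vector, so a form that vanishes on
    the line given by v vanishes on the one given by t v as well. *)
Lemma line_pt_scale (t : CC) y0 y1 y2 e (v : 'I_6 -> CC) (f : mp) :
  (f \mPo line_pt (y0, y1, y2, e)).@[fun i => t * v i] =
  (f \mPo line_pt (t * y0, t * y1, t * y2, t * e)).@[v].
Proof.
rewrite !comp_mpoly_meval; apply: meval_eq.
have E a b : a * (t * b) = t * a * b by rewrite mulrA (mulrC a).
have uE i (Hi : (i < 6)%N) w : (u6 Hi).@[w] = w (Ordinal Hi) by exact: mevalXU.
have [E0 E1 E2 E3] := line_ptE y0 y1 y2 e.
have [F0 F1 F2 F3] := line_ptE (t * y0) (t * y1) (t * y2) (t * e).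
apply: ord4P.
- by rewrite E0 F0 !mevalD !mevalN !mevalZ !uE !E.
- by rewrite E1 F1 !mevalD !mevalN !mevalZ !uE !E.
- by rewrite E2 F2 !mevalD !mevalN !mevalZ !uE !E.
- by rewrite E3 F3 !mevalN !mevalD !mevalZ !uE !E.
Qed.

(** Each monomial of degree E is a combination of substitutions into the cyclic surface. Keeping the
    multipliers and replacing the surface by f gives one row for each monomial; phi is the
    determinant of the coefficients in degree E. The matrix is the identity at the cyclic surface,
    and it annihilates the vector of monomials at v if f contains the line v. *)
Lemma resultant_lines k :
  exists phi N, [/\ polyfun 3 phi, forall c f, phi (c *: f) = c ^+ N * phi f,
    phi (cyclic_surface k) != 0
  & forall f : mp, f \is (k.+4).-homog ->
    (exists2 v : 'I_6 -> CC, exists i, v i != 0 &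
        forall y, (f \mPo line_pt y).@[v] = 0) -> phi f = 0].
Proof.
have [E HE] := line_pt_monomials k.
pose b := map (@bmnm 6 E.+1) (filter (fun m : 'X_{1..6 < E.+1} => mdeg m == E) (enum {: 'X_{1..6 < E.+1}})).
have ub : uniq b.
  by rewrite map_inj_uniq; [exact/filter_uniq/enum_uniq | move=> x y; exact: val_inj].
have bE m : (m \in b) = (mdeg m == E).
  apply/mapP/idP => [[m'] /=|md]; first by rewrite mem_filter => /andP[+ _] ->.
  have lt : (mdeg m < E.+1)%N by rewrite (eqP md).
  by exists (BMultinom lt); rewrite // mem_filter md mem_enum.
pose N := size b.
have bi (i : 'I_N) : mdeg (nth 0%MM b i) = E by apply/eqP; rewrite -bE mem_nth.
have /boolp.choice [s Hs] : forall i : 'I_N, exists s,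
    'X_[nth 0%MM b i] = \sum_(z <- s) z.2 * (cyclic_surface k \mPo line_pt z.1) :> {mpoly CC[6]}.
  move=> i; apply: (ideal_gen_comb (c := fun y => cyclic_surface k \mPo line_pt y)).
  exact: HE (bi i).
pose row i f := \sum_(z <- s i) z.2 * (f \mPo line_pt z.1).
have row_lin i a (f g : mp) : row i (a *: f + g) = a *: row i f + row i g.
  rewrite /row scaler_sumr -big_split /=; apply: eq_bigr => z _.
  by rewrite linearP mulrDr scalerAr.
have /boolp.choice [B HB] : forall ij : 'I_N * 'I_N, exists B : mp -> CC,
   [/\ polyfun 3 B, forall c f, B (c *: f) = c * B f
     & forall f, f \is (k.+4).-homog -> B f = (row ij.1 f)@_(nth 0%MM b ij.2)].
  move=> [i j]; apply: linear_polyfun => a f g /=.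
  by rewrite row_lin mcoeffD mcoeffZ.
exists (fun f => \det (\matrix_(i, j) B (i, j) f)), N; split.
- apply: (fa_det (polyfun_algebra 3)) => i j.
  by have [pB _ _] := HB (i, j); apply: fa_ext pB => f; rewrite mxE.
- move=> c f; rewrite -detZ; congr (\det _); apply/matrixP => i j.
  by rewrite !mxE; case: (HB (i, j)).
- rewrite (_ : \matrix_(i, j) _ = 1%:M) ?det1 ?oner_neq0 //.
  apply/matrixP => i j; rewrite !mxE; case: (HB (i, j)) => _ _ -> /=; last first.
    exact: cyclic_surface_homog.
  by rewrite /row -Hs mcoeffX nth_uniq.
move=> f hf [v [i0 vi0] vf].
have vt i t : (row i f).@[fun i => t * v i] = 0.
  rewrite /row raddf_sum big1_seq // => -[[[[y0 y1] y2] e] h] _ /=.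
  by rewrite mevalM line_pt_scale vf mulr0.
(* The multipliers need not be homogeneous; vanishing at all multiples of v isolates the part of
   degree E. *)
have vrow i : (pihomog mdeg E (row i f)).@[v] = 0.
  set G := row i f.
  pose K := maxn (msize G) E.+1.
  pose p : {poly CC} := \poly_(j < K) (pihomog mdeg j G).@[v].
  have p0 : p = 0.
    apply: poly_nat_roots natCC_neq0 _ => n; rewrite -(vt i n%:R) -/G.
    rewrite [in RHS](@pihomog_partitionE _ _ mdeg K G) ?leq_maxl // raddf_sum horner_poly.
    by apply: eq_bigr => j _; rewrite mulrC; apply/esym/homog_mevalZ/pihomogP.
  have := coef_poly K (fun j => (pihomog mdeg j G).@[v]) E.
  by rewrite -/p p0 coef0 leq_maxr.
apply/eqP; rewrite -det_tr; apply/det0P.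
(* The kernel vector is nonzero because of the E-th power of the nonzero coordinate [v i0]. *)
exists (\row_j \prod_l v l ^+ (nth 0%MM b j) l).
  have mb : (U_(i0) *+ E)%MM \in b by rewrite bE mdegMn mdeg1 mul1n.
  apply/eqP => /rowP /(_ (Ordinal (introT idP (etrans (index_mem _ _) mb)))).
  rewrite !mxE nth_index // => /eqP; rewrite prodf_seq_eq0 => /hasP[l _].
  by rewrite mulmnE mnm1E expf_eq0; case: (eqVneq i0 l) => [<-|]; rewrite ?(negbTE vi0) ?andbF ?mul0n.
apply/rowP => i; rewrite !mxE -[RHS](vrow i).
rewrite (homog_sum (pihomogP mdeg E (row i f))) raddf_sum /=.
transitivity (\sum_(m <- b) (row i f)@_m * \prod_l v l ^+ m l).
  rewrite (big_nth 0%MM) big_mkord; apply: eq_bigr => j _.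
  by rewrite !mxE mulrC; congr (_ * _); case: (HB (i, j)) => _ _ /(_ _ hf).
rewrite big_map big_filter big_enum_cond /=; apply: eq_big => [m|m /eqP mE].
  by [].

by rewrite mevalZ mevalX mcoeff_pihomog mE eqxx.
Qed.

(** * Pairs of products of given degrees *)

(** Nested pairs inherit the module structure that affine lines require. *)
Definition quad : lmodType CC := (mp * mp * (mp * mp))%type.

Definition det_form (p : quad) : mp := p.1.1 * p.1.2 + p.2.1 * p.2.2.

Definition of_type d e b (p : quad) : Prop :=
  [/\ p.1.1 \is e.-homog, p.1.2 \is (d - e)%N.-homog,
      p.2.1 \is b.-homog & p.2.2 \is (d - b)%N.-homog].

Lemma of_type_line d e b p q x :
  of_type d e b p -> of_type d e b q -> of_type d e b (p + x *: (q - p)).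
Proof.
move=> [p1 p2 p3 p4] [q1 q2 q3 q4].
by split; apply: rpredD => //; apply: dhomogZ; apply: rpredB.
Qed.

Lemma det_form_homog d e b p : (e <= d)%N -> (b <= d)%N ->
  of_type d e b p -> det_form p \is d.-homog.
Proof.
move=> ed bd [p1 p2 p3 p4]; apply: rpredD.
  by rewrite -(subnKC ed); apply: dhomogM; rewrite // subnKC.
by rewrite -(subnKC bd); apply: dhomogM; rewrite // subnKC.
Qed.

Lemma family_line (V : lmodType CC) (F : V -> mp) p q :
  linear F -> family poly1 (fun x => F (p + x *: q)).
Proof.
move=> lF; apply: (@family_ext _ _ _ (fun x => F p + x *: F q)).
  by move=> x; rewrite [p + _]addrC lF addrC.
apply: (family_add poly1_algebra); first exact: (family_const poly1_algebra).
exact: (family_scale poly1_algebra poly1_id (family_const poly1_algebra _)).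
Qed.

Lemma along_lines_coef (F : quad -> mp) m :
  linear F -> along_lines (fun p => (F p)@_m).
Proof. by move=> lF p q; exact: (family_line p q lF). Qed.

Lemma along_lines_det_form phi : polyfun 3 phi ->
  along_lines (fun p => phi (det_form p)).
Proof.
move=> pphi p q; apply: (fa_polyfun poly1_algebra pphi).
apply: (family_add poly1_algebra); apply: (family_mul poly1_algebra); exact: family_line.
Qed.

Lemma homog1E n (p : {mpoly CC[n]}) : p \is 1.-homog -> p = \sum_i p@_U_(i) *: 'X_i.
Proof.
move=> hp; apply/mpolyP => m; rewrite raddf_sum /=.
have [/mdeg1P [i /eqP ->]|m1] := boolP (mdeg m == 1%N).
  rewrite (bigD1 i) //= big1 ?addr0 => [|j ji]; rewrite mcoeffZ mcoeffX ?eqxx ?mulr1 //.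
  by rewrite eq_mnm1 (negbTE ji) mulr0.
rewrite (dhomog_nemf_coeff hp m1) big1 // => i _; rewrite mcoeffZ mcoeffX.
case: (eqVneq U_(i)%MM m) => [im|]; last by rewrite mulr0.
by rewrite -im mdeg1 in m1.
Qed.

Lemma meval_homog1 (p : mp) v : p \is 1.-homog ->
  p.@[v] = p@_U_(o0) * v o0 + p@_U_(o1) * v o1 + p@_U_(o2) * v o2 + p@_U_(o3) * v o3.
Proof.
by move/homog1E => {1}->; rewrite raddf_sum /= big_ord4 /= !mevalZ !mevalXU !addrA.
Qed.

Lemma line_pt_eval (v : 'I_6 -> CC) y0 y1 y2 e (w := line_pt (y0, y1, y2, e))
    (c := fun i (Hi : (i < 6)%N) => v (Ordinal Hi)) :
  [/\ (tnth w o0).@[v] = y2 * @c 1%N isT - y1 * @c 2%N isT + e * @c 3%N isT,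
      (tnth w o1).@[v] = y0 * @c 2%N isT - y2 * @c 0%N isT + e * @c 4%N isT,
      (tnth w o2).@[v] = y1 * @c 0%N isT - y0 * @c 1%N isT + e * @c 5%N isT
    & (tnth w o3).@[v] = - (y0 * @c 3%N isT + y1 * @c 4%N isT + y2 * @c 5%N isT)].
Proof.
have vE i (Hi : (i < 6)%N) : (u6 Hi).@[v] = @c i Hi by exact: mevalXU.
have [E0 E1 E2 E3] := line_ptE y0 y1 y2 e; split.
- by rewrite [tnth _ _]E0 !mevalD !mevalN !mevalZ !vE.
- by rewrite [tnth _ _]E1 !mevalD !mevalN !mevalZ !vE.
- by rewrite [tnth _ _]E2 !mevalD !mevalN !mevalZ !vE.
- by rewrite [tnth _ _]E3 !mevalN !mevalD !mevalZ !vE.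
Qed.

(* the Pluecker coordinates of the intersection of the planes a and b *)
Lemma plane_on_line (R : comPzRingType)
    (a0 a1 a2 a3 b0 b1 b2 b3 y0 y1 y2 e c0 c1 c2 c3 c4 c5 w0 w1 w2 w3 : R) :
  c0 = a3 * b0 - b3 * a0 -> c1 = a3 * b1 - b3 * a1 -> c2 = a3 * b2 - b3 * a2 ->
  c3 = a1 * b2 - a2 * b1 -> c4 = a2 * b0 - a0 * b2 -> c5 = a0 * b1 - a1 * b0 ->
  w0 = y2 * c1 - y1 * c2 + e * c3 -> w1 = y0 * c2 - y2 * c0 + e * c4 ->
  w2 = y1 * c0 - y0 * c1 + e * c5 -> w3 = - (y0 * c3 + y1 * c4 + y2 * c5) ->
  a0 * w0 + a1 * w1 + a2 * w2 + a3 * w3 = 0 /\ b0 * w0 + b1 * w1 + b2 * w2 + b3 * w3 = 0.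
Proof. by do 10![move=> ->]; split; ring. Qed.

Lemma exists_fun6 (T : Type) (c0 c1 c2 c3 c4 c5 : T) :
  exists v : 'I_6 -> T, [/\ v (@Ordinal 6 0 isT) = c0, v (@Ordinal 6 1 isT) = c1,
    v (@Ordinal 6 2 isT) = c2, v (@Ordinal 6 3 isT) = c3 &
    v (@Ordinal 6 4 isT) = c4 /\ v (@Ordinal 6 5 isT) = c5].
Proof. by exists (fun i => nth c0 [:: c0; c1; c2; c3; c4; c5] i). Qed.

(** The line t1 = t2 = 0 lies on the surface. [D] is the last of its Pluecker coordinates, so
    generically the vector is nonzero as [resultant_lines] requires. *)
Lemma resultant_lines_type11 k phi :
  polyfun 3 phi ->
  (forall f : mp, f \is (k.+4).-homog ->
    (exists2 v : 'I_6 -> CC, exists i, v i != 0 &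
        forall y, (f \mPo line_pt y).@[v] = 0) -> phi f = 0) ->
  forall p, of_type k.+4 1 1 p -> phi (det_form p) = 0.
Proof.
move=> pphi phi0.
pose D (p : quad) := p.1.1@_U_(o0) * p.2.1@_U_(o1) - p.1.1@_U_(o1) * p.2.1@_U_(o0).
have lD : along_lines D.
  have aa := along_lines_algebra quad.
  apply: (fa_add aa); last apply: (fa_opp aa); apply: (fa_mul aa); exact: along_lines_coef.
pose p0 : quad := (('X_o0, 'X_o0 ^+ k.+3), ('X_o1, 'X_o1 ^+ k.+3)).
have Sp0 : of_type k.+4 1 1 p0.
  by split; rewrite /= ?subSS ?subn0; [exact: homogX1|exact: homogXn|exact: homogX1|exact: homogXn].
have Dp0 : D p0 != 0.
  by rewrite /D /= !mcoeffXU /= mulr1 mulr0 subr0 oner_neq0.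
apply: (along_lines_domain (@of_type_line k.+4 1 1) lD (along_lines_det_form pphi) _ Sp0 Dp0).
move=> p Sp; have [->|Dp] := eqVneq (D p) 0; first by rewrite mul0r.
rewrite (phi0 (det_form p)) ?mulr0 //; first exact: det_form_homog Sp.
have [h1 h2 h3 h4] := Sp.
pose a i := p.1.1@_U_(i); pose b i := p.2.1@_U_(i).
have [v [v0 v1 v2 v3 [v4 v5]]] := exists_fun6 (a o3 * b o0 - b o3 * a o0)
  (a o3 * b o1 - b o3 * a o1) (a o3 * b o2 - b o3 * a o2) (a o1 * b o2 - a o2 * b o1)
  (a o2 * b o0 - a o0 * b o2) (a o0 * b o1 - a o1 * b o0).
exists v; first by exists (@Ordinal 6 5 isT); rewrite v5.
move=> [[[y0 y1] y2] e]; have [w0 w1 w2 w3] := line_pt_eval v y0 y1 y2 e.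
have [Ea Eb] := plane_on_line v0 v1 v2 v3 v4 v5 w0 w1 w2 w3.
rewrite comp_mpoly_meval /det_form mevalD !mevalM.
have -> : p.1.1.@[fun i => (tnth (line_pt (y0, y1, y2, e)) i).@[v]] = 0.
  by apply: etrans (meval_homog1 _ h1) _; exact: Ea.
have -> : p.2.1.@[fun i => (tnth (line_pt (y0, y1, y2, e)) i).@[v]] = 0.
  by apply: etrans (meval_homog1 _ h3) _; exact: Eb.
by rewrite !mul0r addr0.
Qed.

(* Restrict to the plane through (1,1,1,0): there the surface is w^(k+4) = 0
   with a reduced first order term, so no product of forms is possible. *)
Lemma cyclic_surface_irreducible k e (t s : mp) :
  (1 <= e <= k.+3)%N -> t \is e.-homog -> s \is (k.+4 - e)%N.-homog ->
  cyclic_surface k <> t * s.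
Proof.
move=> /andP[e1 e2] ht hs E.
(* evaluation at (1 + u, 1, 1, w) *)
pose pt (u w : CC) (i : 'I_4) : CC := if i == o0 then 1 + u else if i == o3 then w else 1.
(* At (1 + u, 1, 1, w) the quadric takes the value u and the curve (1 + u)^(k+2) + 1. *)
have Ev u w : t.@[pt u w] * s.@[pt u w] = w ^+ k.+4 - u * ((1 + u) ^+ k.+2 + 1).
  have X i : meval (pt u w) 'X_i = pt u w i by exact: mevalXU.
  rewrite -mevalM -E (rmorph_cyclic_surface (meval (pt u w))) ![GRing.RMorphism.sort _ _]X.
  rewrite /pt [_ == _]/= !expr1n !mulr1.
  by congr (_ - _ * _); rewrite addrC addKr.
have polyw c (q : mp) v : q \is c.-homog ->
    exists2 r : {poly CC}, (size r <= c.+1)%N & forall w, q.@[pt v w] = r.[w].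
  move=> hq; exists (\sum_(m <- msupp q) (q@_m * (1 + v) ^+ m o0) *: 'X^(m o3)).
    rewrite big_seq; apply: (big_ind (fun r : {poly CC} => size r <= c.+1)%N).
    - by rewrite size_poly0.
    - by move=> x y sx sy; rewrite (leq_trans (size_polyD _ _)) // geq_max sx.
    move=> m mq; rewrite (leq_trans (size_scale_leq _ _)) // size_polyXn ltnS.
    have <- : mdeg m = c := dhomog_mf hq mq.
    by rewrite mdegE (bigD1 o3) //= leq_addr.
  move=> w; rewrite mevalE horner_sum; apply: eq_bigr => m _.
  by rewrite hornerZ hornerXn prod_ord4 /pt [_ == _]/= !expr1n !mul1r mulrA.
have polyu (q : mp) : exists r : {poly CC}, forall u, q.@[pt u 0] = r.[u].
  exists (\sum_(m <- msupp q) (q@_m * 0 ^+ m o3) *: (1 + 'X) ^+ m o0).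
  move=> u; rewrite mevalE horner_sum; apply: eq_bigr => m _.
  rewrite hornerZ horner_exp hornerD hornerC hornerX prod_ord4 /pt [_ == _]/= !expr1n !mul1r.
  by rewrite -!mulrA; congr (_ * _); exact: mulrC.
have [rt szt Et] := polyw _ _ 0 ht; have [rs szs Es] := polyw _ _ 0 hs.
have rts : rt * rs = 1 *: 'X^(k.+4).
  rewrite scale1r; apply/eqP; rewrite -subr_eq0; apply/eqP.
  apply: poly_nat_roots natCC_neq0 _ => n.
  by rewrite hornerD hornerN hornerM hornerXn -Et -Es Ev mul0r subr0 subrr.
have N1 : (1 : CC) != 0 by exact: oner_neq0.
(* For u = 0 the product is w^(k+4) and both factors have degree less than k+4 in w, so both vanish
   at w = 0. *)
have t0 : t.@[pt 0 0] = 0.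
  rewrite Et horner_coef0; apply: (monomial_factor N1 (P := rs) (D := k.+4)).
    by rewrite mulrC.
  by rewrite addn0 (leq_trans szs) // ltn_subrL e1.
have s0 : s.@[pt 0 0] = 0.
  rewrite Es horner_coef0; apply: (monomial_factor N1 rts).
  by rewrite addn0 (leq_trans szt) // ltnS.
have [pt' Ept] := polyu t; have [ps Eps] := polyu s.
have : pt' * ps = - ('X * ((1 + 'X) ^+ k.+2 + 1)).
  apply/eqP; rewrite -subr_eq0; apply/eqP.
  apply: poly_nat_roots natCC_neq0 _ => n.
  rewrite hornerD !hornerN !hornerM -Ept -Eps Ev expr0n /= sub0r hornerX hornerD horner_exp.
  by rewrite hornerD hornerC hornerX opprK addNr.
(* Since both factors vanish at u = w = 0, the product has derivative 0 in u there; the other side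
   has derivative -2. *)
move/(congr1 (fun q => (q^`()).[0])); rewrite derivM hornerD !hornerM -Ept -Eps t0 s0.
rewrite mulr0 mul0r addr0 derivN hornerN derivM derivX hornerD !hornerM hornerX mul0r addr0.
rewrite hornerC mul1r hornerD horner_exp hornerD hornerX hornerC addr0 expr1n.
by move/esym/eqP; rewrite oppr_eq0 -(natrD _ 1 1) (negbTE (natCC_neq0 1)).
Qed.

(** * Algebraic dependence *)

Lemma card_bmultinom_le M s : (#|{: 'X_{1..M < s}}| <= s ^ M)%N.
Proof.
have lt (m : 'X_{1..M < s}) i : (m i < s)%N.
  by rewrite (leq_ltn_trans _ (bmdeg m)) // mdegE (bigD1 i) //= leq_addr.
rewrite -[X in (X ^ _)%N]card_ord -[M in (_ ^ M)%N]card_ord -card_ffun.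
apply: (@leq_card _ _ (fun m : 'X_{1..M < s} => [ffun i => Ordinal (lt m i)])).
move=> m m' /ffunP mm; apply/val_inj/mnmP => i.
by have := mm i; rewrite !ffunE => /(congr1 val).
Qed.

Lemma linear_relation (I : finType) M s (G : I -> {mpoly CC[M]}) :
  (forall i, (msize (G i) <= s)%N) -> (s ^ M < #|I|)%N ->
  exists2 c : I -> CC, exists i, c i != 0 & \sum_i c i *: G i = 0.
Proof.
move=> szG sI.
pose A := \matrix_(i < #|I|, j < #|{: 'X_{1..M < s}}|) (G (enum_val i))@_(enum_val j).
have /rowV0Pn[v /sub_kermxP vA v0] : kermx A != 0.
  rewrite kermx_eq0 /row_free; apply/negP => /eqP rA.
  have := rank_leq_col A; rewrite rA leqNgt.
  by rewrite (leq_ltn_trans (card_bmultinom_le _ _) sI).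
exists (fun i => v 0 (enum_rank i)).
  case/rV0Pn: v0 => j vj; exists (enum_val j); by rewrite enum_valK.
apply/mpolyP => m; rewrite mcoeff0 (raddf_sum (mcoeff m)) /=.
have [ms|ms] := ltnP (mdeg m) s; last first.
  apply: big1 => i _; rewrite mcoeffZ memN_msupp_eq0 ?mulr0 //.
  by apply: msize_mdeg_ge; rewrite (leq_trans (szG i)).
have := congr1 (fun B : 'rV_ _ => B 0 (enum_rank (BMultinom ms))) vA.
rewrite !mxE => E; apply: etrans E; rewrite (reindex (@enum_val I I)) /=; last first.
  by apply: onW_bij; exact: enum_val_bij.
by apply: eq_bigr => i _; rewrite mcoeffZ !mxE enum_valK enum_rankK.
Qed.

Section SizeBound.
Variable M : nat.
Implicit Types p q : {mpoly CC[M]}.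

Lemma msize_mul p q i j : (msize p <= i.+1)%N -> (msize q <= j.+1)%N ->
  (msize (p * q) <= (i + j).+1)%N.
Proof.
move=> hp hq; have [->|p0] := eqVneq p 0; first by rewrite mul0r msize0.
have [->|q0] := eqVneq q 0; first by rewrite mulr0 msize0.
rewrite msizeM //; move: (mmeasure mdeg p) (mmeasure mdeg q) hp hq => a b.
by case: a b => [|a] [|b] //=; rewrite ?addn0 ?add0n ?addnS ?ltnS; lia.
Qed.

Lemma msize_exp p i k : (msize p <= i.+1)%N -> (msize (p ^+ k) <= (k * i).+1)%N.
Proof.
move=> hp; elim: k => [|k IH]; first by rewrite expr0 msize1.
by rewrite exprS mulSn msize_mul.
Qed.

Lemma msize_prod (I : Type) (r : seq I) (P : I -> {mpoly CC[M]}) (b : I -> nat) :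
  (forall i, (msize (P i) <= (b i).+1)%N) ->
  (msize (\prod_(i <- r) P i)%R <= (\sum_(i <- r) b i).+1)%N.
Proof.
move=> hP; elim: r => [|i r IH]; first by rewrite !big_nil msize1.
by rewrite !big_cons msize_mul.
Qed.

End SizeBound.

(* [F0] only serves to make every term homogeneous of weight [q * sum e]. *)
Lemma algebraic_relation M R (F0 : {mpoly CC[M]}) (F : 'I_R -> {mpoly CC[M]})
    (e : 'I_R -> nat) : (M < R)%N ->
  exists q (c : {ffun 'I_R -> 'I_q.+1} -> CC), (exists a, c a != 0) /\
    \sum_a c a *: (F0 ^+ (q * \sum_l e l - \sum_l e l * a l) * \prod_l F l ^+ a l) = 0.
Proof.
move=> MR.
pose C := (msize F0 * (\sum_l e l) + \sum_l msize (F l))%N.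
(* Every term has degree at most qC, so at most (qC+1)^M <= (C+1)^M (q+1)^M = q (q+1)^M monomials
   occur. This is less than (q+1)^(M+1) <= (q+1)^R, the number of terms. *)
pose q := (C.+1 ^ M)%N.
have [||c c0 cG] := @linear_relation {ffun 'I_R -> 'I_q.+1} M (q * C).+1
   (fun a => F0 ^+ (q * \sum_l e l - \sum_l e l * a l) * \prod_l F l ^+ a l).
- move=> a; rewrite (leq_trans (@msize_mul _ _ _
     (q * (\sum_l e l) * msize F0) (\sum_l q * msize (F l)) _ _)) //.
  + rewrite (leq_trans (@msize_exp _ _ (msize F0) _ _)) ?leqnSn // ltnS.
    by rewrite leq_mul2r leq_subr orbT.
  + apply: msize_prod => l; rewrite (leq_trans (@msize_exp _ _ (msize (F l)) _ _)) //.
    by rewrite ltnS leq_mul // -ltnS ltn_ord.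
  + by rewrite -big_distrr /= ltnS -mulnA -mulnDr leq_mul2l [((\sum_l e l) * _)%N]mulnC leqnn orbT.
- rewrite card_ffun !card_ord.
  have H : ((q * C).+1 ^ M <= q * q.+1 ^ M)%N.
    rewrite -[q in (_ <= q * _)%N]/(C.+1 ^ M)%N -expnMn.
    have lex m n k : (m <= n)%N -> (m ^ k <= n ^ k)%N.
      by move=> mn; elim: k => // k IH; rewrite !expnS leq_mul.
    by apply: lex; rewrite mulSn mulnS; lia.
  rewrite (leq_ltn_trans H) // (leq_trans _ (@leq_pexp2l q.+1 M.+1 R _ _)) //.
  by rewrite expnS ltn_mul2r expn_gt0 ltnSn.
by exists q, c.
Qed.

(** * Relations on a slice of normalised parameters *)

Definition supported (S : seq 'X_{1..4}) (t : mp) : Prop := {subset msupp t <= S}.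

Lemma supportedP S t : supported S t <-> forall m, m \notin S -> t@_m = 0.
Proof.
split=> [St m mS|H m]; first by apply: memN_msupp_eq0; apply: contra mS; exact: St.
by rewrite mcoeff_msupp; apply: contraR => /H ->.
Qed.

Lemma supported_line S t u x : supported S t -> supported S u ->
  supported S (t + x *: (u - t)).
Proof.
move=> /supportedP St /supportedP Su; apply/supportedP => m mS.
by rewrite mcoeffD mcoeffZ mcoeffB St // Su // subrr mulr0 addr0.
Qed.

Lemma supportedZ S t x : supported S t -> supported S (x *: t).
Proof. by move=> /supportedP St; apply/supportedP => m mS; rewrite mcoeffZ St ?mulr0. Qed.

Lemma supported_sum S t : uniq S -> supported S t ->
  t = \sum_(i < size S) t@_(nth 0%MM S i) *: 'X_[nth 0%MM S i].
Proof.
move=> uS /supportedP St; rewrite -(big_mkord xpredT (fun i => t@_(nth 0%MM S i) *: 'X_[nth 0%MM S i])).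
rewrite -(big_nth 0%MM xpredT (fun m => t@_m *: 'X_[m])).
apply/mpolyP => m; rewrite (raddf_sum (mcoeff m)) /=.
have [mS|mS] := boolP (m \in S); last first.
  rewrite St // big1_seq // => l /andP[_ lS]; rewrite mcoeffZ mcoeffX.
  by case: eqVneq lS mS => [->->|]; rewrite ?mulr0.
rewrite (bigD1_seq m) //= mcoeffZ mcoeffX eqxx mulr1 big1 ?addr0 // => l lm.
by rewrite mcoeffZ mcoeffX (negbTE lm) mulr0.
Qed.

Section Relation.
Variables (R : nat) (z0 : mp -> CC) (z : 'I_R -> mp -> CC) (e : 'I_R -> nat).

(** The power of [z0] brings every term to weight q times the sum of the [e l], making the sum
    homogeneous in f; the subtraction is exact because [a l] is at most q. *)
Definition weighted_sum q (c : {ffun 'I_R -> 'I_q.+1} -> CC) (f : mp) : CC :=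
  \sum_a c a * (z0 f ^+ (q * \sum_l e l - \sum_l e l * a l) * \prod_l z l f ^+ a l).

Hypotheses (z0P : polyfun 3 z0) (zP : forall l, polyfun 3 (z l)).
Hypotheses (z0Z : forall c f, z0 (c *: f) = c * z0 f).
Hypotheses (zZ : forall l c f, z l (c *: f) = c ^+ e l * z l f).

Lemma weighted_sum_polyfun q c : polyfun 3 (@weighted_sum q c).
Proof.
have A := polyfun_algebra 3.
apply: (fa_sum A) => a; apply: (fa_mul A); first exact: fa_const A _.
apply: (fa_mul A); first exact: fa_exp.
by apply: (fa_prod A) => l; exact: fa_exp.
Qed.

Lemma weighted_sumZ q c x f :
  @weighted_sum q c (x *: f) = x ^+ (q * \sum_l e l) * weighted_sum c f.
Proof.
rewrite /weighted_sum mulr_sumr; apply: eq_bigr => a _.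
rewrite [RHS]mulrCA; congr (_ * _); rewrite z0Z exprMn.
rewrite (eq_bigr (fun l => x ^+ (e l * a l) * z l f ^+ a l)) => [|l _]; last by rewrite zZ exprMn -exprM.
rewrite big_split /= prodrXr mulrACA -exprD subnK //.
by rewrite big_distrr /=; apply: leq_sum => l _; rewrite mulnC leq_mul2r -ltnS ltn_ord orbT.
Qed.

Variables (L1 L2 L3 L4 : seq 'X_{1..4}) (m1 m2 m3 : 'X_{1..4}).
Hypotheses (u1 : uniq (m1 :: L1)) (u2 : uniq (m2 :: L2)) (u3 : uniq (m3 :: L3)) (u4 : uniq L4).

Definition in_slice (p : quad) : Prop :=
  [/\ supported (m1 :: L1) p.1.1, supported (m3 :: L3) p.1.2,
      supported (m2 :: L2) p.2.1 & supported L4 p.2.2].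

Let M := (size L1 + size L2 + size L3 + size L4)%N.

(** The parameter vector concatenates the free coefficients on [L1], [L2], [L3] and [L4]. Reading it
    at natural positions lets [gen] address a block by its offset. *)
Let ext (v : 'I_M -> CC) (n : nat) : CC := if insub n is Some i then v i else 0.

Let gen off L v : mp := \sum_(i < size L) ext v (off + i) *: 'X_[nth 0%MM L i].

Let slice v : quad :=
  (('X_[m1] + gen 0 L1 v, 'X_[m3] + gen (size L1 + size L2) L3 v),
   ('X_[m2] + gen (size L1) L2 v, gen (size L1 + size L2 + size L3) L4 v)).

Lemma slice_family phi : polyfun 3 phi -> polyM (fun v => phi (det_form (slice v))).
Proof.
move=> pphi; have A := @polyM_algebra M; apply: (fa_polyfun A pphi).
have gfam off L : family (@polyM M) (gen off L).
  apply: (family_sum A) => i; apply: (family_scale A); last exact: family_const.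
  by rewrite /ext; case: insub => [j|]; [exact: polyM_coord | exact: (fa_const A)].
have fs m off L : family (@polyM M) (fun v => 'X_[m] + gen off L v).
  by apply: (family_add A) => //; exact: family_const.
by apply: (family_add A); apply: (family_mul A); [exact: fs|exact: fs|exact: fs|exact: gfam].
Qed.

Local Ltac slia := match goal with H : is_true (_ < _)%N |- _ => move: H end;
  move: (size L1) (size L2) (size L3) (size L4); lia.

Lemma slice_normal p : in_slice p ->
  p.1.1@_m1 = 1 -> p.1.2@_m3 = 1 -> p.2.1@_m2 = 1 -> exists v, p = slice v.
Proof.
case: p => [[t1 v1] [t2 v2]] [/= s1 s3 s2 s4] e1 e3 e2.
pose w n := if (n < size L1)%N then t1@_(nth 0%MM L1 n)
  else if (n - size L1 < size L2)%N then t2@_(nth 0%MM L2 (n - size L1))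
  else if (n - size L1 - size L2 < size L3)%N then v1@_(nth 0%MM L3 (n - size L1 - size L2))
  else v2@_(nth 0%MM L4 (n - size L1 - size L2 - size L3)).
exists (fun i => w i).
have extE n : (n < M)%N -> ext (fun i => w i) n = w n by move=> nM; rewrite /ext insubT.
have consE m L t off : uniq (m :: L) -> supported (m :: L) t -> t@_m = 1 ->
    (forall i, (i < size L)%N -> ext (fun i => w i) (off + i) = t@_(nth 0%MM L i)) ->
    t = 'X_[m] + gen off L (fun i => w i).
  move=> um sm tm tE; apply: etrans (supported_sum um sm) _.
  rewrite big_ord_recl /= tm scale1r /gen.
  by congr (_ + _); apply: eq_bigr => i _; rewrite /= tE.
have E1 : t1 = 'X_[m1] + gen 0 L1 (fun i => w i).
  apply: consE => // i iL; rewrite add0n extE ?/w ?iL // /M.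
  by rewrite (leq_trans iL) // -!addnA leq_addr.
have E3 : v1 = 'X_[m3] + gen (size L1 + size L2) L3 (fun i => w i).
  apply: consE => // i iL; rewrite extE /w; last by rewrite /M; slia.
  rewrite ifF; last by slia.
  rewrite ifF; last by slia.
  by rewrite ifT; [congr (_@_(nth _ _ _)); slia | slia].
have E2 : t2 = 'X_[m2] + gen (size L1) L2 (fun i => w i).
  apply: consE => // i iL; rewrite extE /w; last by rewrite /M; slia.
  rewrite ifF; last by slia.
  by rewrite ifT; [congr (_@_(nth _ _ _)); slia | slia].
have E4 : v2 = gen (size L1 + size L2 + size L3) L4 (fun i => w i).
  apply: etrans (supported_sum u4 s4) _; apply: eq_bigr => -[i iL] _; congr (_ *: _).
  rewrite [nat_of_ord _]/=; rewrite extE /w; last by rewrite /M; slia.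
  rewrite ifF; last by slia.
  rewrite ifF; last by slia.
  rewrite ifF; last by slia.
  by congr (_@_(nth _ _ _)); slia.
by rewrite /slice -E1 -E2 -E3 -E4.
Qed.

(* The torus scaling t1, s1, t2 and the whole form accounts for the three
   leading coefficients that may be normalised to 1. *)
Lemma slice_relation : (M < R)%N ->
  exists q (c : {ffun 'I_R -> 'I_q.+1} -> CC), (exists a, c a != 0) /\
    forall p, in_slice p -> weighted_sum c (det_form p) = 0.
Proof.
move=> MR.
have [P0 HP0] := slice_family z0P.
have /boolp.choice [P HP] : forall l, exists P : {mpoly CC[M]},
    forall v, z l (det_form (slice v)) = P.@[v] by move=> l; exact: slice_family.
have [q [c [c0 Hc]]] := algebraic_relation P0 P e MR.
exists q, c; split=> //.
have onslice v : weighted_sum c (det_form (slice v)) = 0.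
  rewrite -[RHS](meval0 v) -Hc (raddf_sum (meval v)) /=; apply: eq_bigr => a _.
  rewrite mevalZ mevalM (rmorphXn (meval v)) (rmorph_prod (meval v)) /= HP0.
  by congr (_ * (_ * _)); apply: eq_bigr => l _; rewrite (rmorphXn (meval v)) /= HP.
have Sline p r x : in_slice p -> in_slice r -> in_slice (p + x *: (r - p)).
  by move=> [? ? ? ?] [? ? ? ?]; split; exact: supported_line.
pose D (p : quad) := p.1.1@_m1 * (p.1.2@_m3 * p.2.1@_m2).
have lD : along_lines D.
  have aa := along_lines_algebra quad.
  by apply: (fa_mul aa); [|apply: (fa_mul aa)]; exact: along_lines_coef.
pose p0 : quad := (('X_[m1], 'X_[m3]), ('X_[m2], 0)).
have Sp0 : in_slice p0.
  by split=> m; rewrite /= ?msuppX ?msupp0 // inE => /eqP ->; rewrite mem_head.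
have Dp0 : D p0 != 0 by rewrite /D /= !mcoeffX !eqxx !mulr1 oner_neq0.
move=> p Sp; move: p Sp.
apply: (along_lines_domain Sline lD (along_lines_det_form (weighted_sum_polyfun c)) _ Sp0 Dp0).
move=> p Sp; have [->|] := eqVneq (D p) 0; first by rewrite mul0r.
rewrite /D !mulf_eq0 !negb_or => /and3P[d1 d3 d2].
set a1 := p.1.1@_m1 in d1 *; set a3 := p.1.2@_m3 in d3 *; set a2 := p.2.1@_m2 in d2 *.
have [p1 p3 p2 p4] := Sp.
(* The scalar on s2 is chosen so that both products are divided by the same a1 a3. *)
have [||||v Ev] := @slice_normal ((a1^-1 *: p.1.1, a3^-1 *: p.1.2),
    (a2^-1 *: p.2.1, (a2 / (a1 * a3)) *: p.2.2)).
- by split; exact: supportedZ.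
- by rewrite /= mcoeffZ mulVf.
- by rewrite /= mcoeffZ mulVf.
- by rewrite /= mcoeffZ mulVf.
have -> : det_form p = (a1 * a3) *: det_form (slice v).
  rewrite -Ev /det_form scalerDr; congr (_ + _) => /=.
    rewrite -scalerAl -scalerAr !scalerA -[LHS]scale1r; congr (_ *: _).
    by rewrite [a1 * a3]mulrC mulfK // mulfV.
  rewrite -scalerAl -scalerAr !scalerA -[LHS]scale1r; congr (_ *: _).
  by rewrite mulrA divfK // mulfV ?mulf_neq0.
by rewrite weighted_sumZ onslice !mulr0.
Qed.

End Relation.

(** * Reduction to normalised parameters *)

Section Division.
Variables (c : nat) (t : mp).
Let x0a : 'X_{1..4} := (U_(o0) *+ c)%MM.
Hypotheses (ht : t \is c.-homog) (t0 : t@_x0a != 0).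

Lemma mnm_top (m : 'X_{1..4}) : mdeg m = c -> (c <= m o0)%N -> m = x0a.
Proof.
move=> mE am; have := mE; rewrite mdegE (bigD1 o0) //=.
set S := (X in (_ + X)%N) => E.
have z : S = 0%N by move: E am; move: (m o0) S => x y; lia.
have mo : m o0 = c by move: E; rewrite z addn0.
apply/mnmP => i; rewrite mulmnE mnm1E.
have [<-|i0] := eqVneq o0 i; first by rewrite mul1n.
have : (m i <= S)%N by rewrite /S (bigD1 i) 1?eq_sym //= leq_addr.
by rewrite z leqn0 mul0n => /eqP.
Qed.

(** In such high degree in the first variable only the term x^c of t can contribute. *)
Lemma mcoeff_top (n m : 'X_{1..4}) : (n o0 + c <= m o0)%N ->
  (t * 'X_[n])@_m = t@_x0a * (m == (x0a + n)%MM)%:R.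
Proof.
move=> nm; rewrite {1}(mpolyE t) mulr_suml (raddf_sum (mcoeff m)) /=.
have xt : x0a \in msupp t by rewrite mcoeff_msupp.
rewrite (bigD1_seq x0a) //= -scalerAl -mpolyXD mcoeffZ mcoeffX eq_sym.
rewrite big1_seq ?addr0 // => l /andP[lx lt].
rewrite -scalerAl -mpolyXD mcoeffZ mcoeffX; case: eqVneq => [E|]; last by rewrite mulr0.
case/eqP: lx; apply: mnm_top; first exact: dhomog_mf lt.
by have := congr1 (fun w : 'X_{1..4} => w o0) E; rewrite mnmDE; lia.
Qed.

(** Division with remainder by t, whose leading coefficient in the first variable is a nonzero
    constant. *)
Lemma homog_divide k (h : mp) : h \is k.-homog ->
  exists2 r : mp, r \is (k - c)%N.-homog & forall m : 'X_{1..4}, (c <= m o0)%N -> (h - t * r)@_m = 0.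
Proof.
move=> hh.
(* After j rounds the remainder has degree at most k - j in the first variable. *)
suff H j : (j <= k.+1 - c)%N -> exists2 r : mp, r \is (k - c)%N.-homog &
    forall m : 'X_{1..4}, (k.+1 - j <= m o0)%N -> (h - t * r)@_m = 0.
  have [r hr Hr] := H _ (leqnn _); have [ak|ka] := leqP c k.+1.
    by exists r => // m am; apply: Hr; rewrite subKn.
  exists 0 => [|m am]; first exact: rpred0.
  rewrite mulr0 subr0; apply: dhomog_nemf_coeff hh _.
  apply: contraTneq am => /= mk; rewrite -ltnNge (leq_ltn_trans _ (ltnW ka)) // -mk.
  by rewrite mdegE (bigD1 o0) //= leq_addr.
elim: j => [_|j IH jk].
  exists 0 => [|m am]; first exact: rpred0.
  rewrite mulr0 subr0; apply: dhomog_nemf_coeff hh _.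
  apply: contraTneq am => /= mk; rewrite -ltnNge subn0 ltnS -mk.
  by rewrite mdegE (bigD1 o0) //= leq_addr.
have [r hr Hr] := IH (ltnW jk).
pose g := h - t * r.
have ak : (c <= k)%N by lia.
have hg : g \is k.-homog.
  by apply: rpredB => //; rewrite -(subnKC ak); apply: dhomogM => //; rewrite subnKC.
pose e := (k - j)%N.
have ae : (c <= e)%N by rewrite /e; lia.
have xm (m : 'X_{1..4}) : (e <= m o0)%N -> (x0a <= m)%MM.
  move=> em; apply/mnm_lepP => i; rewrite mulmnE mnm1E.
  by case: eqVneq => [<-|]; rewrite ?mul1n //; lia.
(* The part of g of top degree e in x, divided by the leading term of t. *)
pose r' := (t@_x0a)^-1 *: \sum_(m <- msupp g | m o0 == e) g@_m *: 'X_[m - x0a].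
have hr' : r' \is (k - c)%N.-homog.
  apply: dhomogZ; rewrite big_seq_cond; apply: rpred_sum => m /andP[mg /eqP me].
  apply: dhomogZ; rewrite dhomogX; apply/eqP.
  have mk : mdeg m = k := dhomog_mf hg mg.
  have := congr1 (@mdeg 4) (submK (xm m _)); rewrite me leqnn => /(_ isT).
  by rewrite mdegD mk mdegMn mdeg1 mul1n => <-; rewrite addnK.
exists (r + r') => [|m me]; first exact: rpredD.
rewrite mulrDr opprD addrA -/g mcoeffB.
have -> : (t * r')@_m = (if m o0 == e then g@_m else 0).
  rewrite /r' -scalerAr mcoeffZ mulr_sumr (raddf_sum (mcoeff m)) /=.
  rewrite (eq_bigr (fun m' => g@_m' * (t@_x0a * (m == m')%:R))); last first.
    move=> m' /eqP me'; rewrite -scalerAr mcoeffZ mcoeff_top.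
      by rewrite addmC submK // xm // me'.
    rewrite mnmBE me' mulmnE mnm1E eqxx mul1n subnK //; exact: me.
  have [mg|mg] := boolP (m \in msupp g); last first.
    rewrite big1_seq ?mulr0 => [|m' /andP[_ m'g]].
      by rewrite (memN_msupp_eq0 mg) if_same.
    by case: eqVneq m'g mg => [<- ->|]; rewrite ?mulr0.
  have [m0e|m0e] := eqVneq (m o0) e.
    rewrite big_mkcond (bigD1_seq m) //= m0e !eqxx mulr1 big1 ?addr0.
      by rewrite mulrC mulfK.
    by move=> m' mm'; rewrite [m == _]eq_sym (negbTE mm') !mulr0 if_same.
  rewrite big1 ?mulr0 // => m' /eqP me'; case: eqVneq => [mm'|]; rewrite ?mulr0 //.
  by rewrite mm' me' eqxx in m0e.
case: eqVneq => [|m0e]; first by rewrite subrr.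
have jk' : (j <= k)%N by lia.
by rewrite subr0; apply: Hr; rewrite subSn // ltn_neqAle eq_sym m0e; rewrite subSS in me.
Qed.

End Division.

(* Division of t2 and s2 by t1, the quotients being absorbed into s1. *)
Lemma dense_reduced d c b phi : (1 <= c <= b)%N -> (c + b <= d)%N -> polyfun 3 phi ->
  (forall p, of_type d c b p ->
     (forall m : 'X_{1..4}, (c <= m o0)%N -> p.2.1@_m = 0 /\ p.2.2@_m = 0) -> phi (det_form p) = 0) ->
  forall p, of_type d c b p -> phi (det_form p) = 0.
Proof.
move=> /andP[a1 ab] abd.
have adb : (c <= d - b)%N by lia.
have E1 : (d - c = (b - c) + (d - b))%N by lia.
have E2 : (d - c = b + (d - b - c))%N by lia.
move=> pphi H.
pose x0a : 'X_{1..4} := (U_(o0) *+ c)%MM.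
pose D (p : quad) := p.1.1@_x0a.
have lD : along_lines D by exact: along_lines_coef.
pose p0 : quad := (('X_[x0a], 0), (0, 0)).
have Sp0 : of_type d c b p0.
  split; rewrite /= ?rpred0 // dhomogX; apply/eqP; apply: etrans (mdegMn _ _) _.
  by rewrite mdeg1 mul1n.
have Dp0 : D p0 != 0 by rewrite /D /= mcoeffX eqxx oner_neq0.
apply: (along_lines_domain (@of_type_line d c b) lD (along_lines_det_form pphi) _ Sp0 Dp0).
move=> p Sp; have [->|D0] := eqVneq (D p) 0; first by rewrite mul0r.
have [h1 h2 h3 h4] := Sp.
have [r hr Hr] := homog_divide h1 D0 h3; have [q hq Hq] := homog_divide h1 D0 h4.
set t1 := p.1.1 in D0 h1 Hr Hq *.
pose t2 := p.2.1 - t1 * r; pose s2 := p.2.2 - t1 * q.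
have ht2 : t2 \is b.-homog.
  by apply: rpredB => //; rewrite -(subnKC ab); apply: dhomogM; rewrite // subnKC.
have hs2 : s2 \is (d - b)%N.-homog.
  by apply: rpredB => //; rewrite -(subnKC adb); apply: dhomogM; rewrite // subnKC.
have -> : det_form p = det_form ((t1, p.1.2 + r * p.2.2 + t2 * q), (t2, s2)).
  by rewrite /det_form /= /t2 /s2 -/t1; ring.
rewrite H ?mulr0 //; last by move=> m am; split; [exact: Hr | exact: Hq].
split=> //=; apply: rpredD; first apply: rpredD => //.
  by rewrite E1; exact: dhomogM.
by rewrite E2; exact: dhomogM.
Qed.

(* the off-diagonal entries of adj(P) adj(A0) M P, where the columns (v, e1),
   (v, e2) of P are eigenvectors of the matrix adj(A0) A1 = [[u, v], [w, z]] *)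
Lemma diagonalise_pencil (R : comPzRingType) (p0 q0 r0 s0 t1 t2 s1 s2 v e1 e2 : R) :
  let g11 := s0 * t1 + q0 * s2 in let g12 := s0 * t2 - q0 * s1 in
  let g21 := r0 * t1 - p0 * s2 in let g22 := r0 * t2 + p0 * s1 in
  let n11 := e2 * (g11 * v + g12 * e1) - v * (g21 * v + g22 * e1) in
  let n12 := e2 * (g11 * v + g12 * e2) - v * (g21 * v + g22 * e2) in
  let n21 := v * (g21 * v + g22 * e1) - e1 * (g11 * v + g12 * e1) in
  let n22 := v * (g21 * v + g22 * e2) - e1 * (g11 * v + g12 * e2) in
  n11 * n22 - n12 * n21 = (p0 * s0 + q0 * r0) * (v * (e2 - e1)) ^+ 2 * (t1 * s1 + t2 * s2).
Proof. by move=> /=; ring. Qed.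

(** At x^2 the matrix M is A0, and adj(A0) A0 is scalar, hence diagonal in every basis. *)
Lemma pencil_diagonal0 (R : comPzRingType) (p0 q0 r0 s0 v e1 e2 : R) :
  let g11 := s0 * p0 + q0 * r0 in let g12 := s0 * q0 - q0 * s0 in
  let g21 := r0 * p0 - p0 * r0 in let g22 := r0 * q0 + p0 * s0 in
  e2 * (g11 * v + g12 * e2) - v * (g21 * v + g22 * e2) = 0 /\
  v * (g21 * v + g22 * e1) - e1 * (g11 * v + g12 * e1) = 0.
Proof. by move=> /=; split; ring. Qed.

(** At y^2 the matrix M is A1, and the two quadratic equations say that (v, e1) and (v, e2) are
    eigenvectors of adj(A0) A1. *)
Lemma pencil_diagonal1 (R : comPzRingType) (p0 q0 r0 s0 p1 q1 r1 s1 e1 e2 : R) :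
  let u := s0 * p1 + q0 * r1 in let v := s0 * q1 - q0 * s1 in
  let w := r0 * p1 - p0 * r1 in let z := r0 * q1 + p0 * s1 in
  e1 ^+ 2 = (z - u) * e1 + v * w -> e2 ^+ 2 = (z - u) * e2 + v * w ->
  e2 * (u * v + v * e2) - v * (w * v + z * e2) = 0 /\
  v * (w * v + z * e1) - e1 * (u * v + v * e1) = 0.
Proof.
move=> u v w z E1 E2; split.
  by transitivity (v * (e2 ^+ 2 - ((z - u) * e2 + v * w))); [ring | rewrite E2 subrr mulr0].
by transitivity (v * (((z - u) * e1 + v * w) - e1 ^+ 2)); [ring | rewrite E1 subrr mulr0].
Qed.

Lemma exists_quadratic_root (b c : CC) : exists e : CC, e ^+ 2 = b * e + c.
Proof.
have [//|e He] := @solve_monicpoly CC 2 (fun i => if i == 0%N then c else b).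
by exists e; rewrite He !big_ord_recl big_ord0 /= expr0 expr1 mulr1 addr0 addrC.
Qed.

(** The form is the determinant of the matrix M with rows (t1, t2) and (-s2, s1), which constant
    matrices on both sides only rescale. Diagonalising its coefficients A0 at x^2 and A1 at y^2
    simultaneously clears four coefficients of t2 and s2. Division by t1 would clear only two and
    leave 35 parameters, against the 33 that are allowed. *)
Lemma dense_type22 phi : polyfun 3 phi ->
  (forall p, of_type 4 2 2 p ->
     (forall m, m = (U_(o0) *+ 2)%MM \/ m = (U_(o1) *+ 2)%MM ->
        p.2.1@_m = 0 /\ p.2.2@_m = 0) -> phi (det_form p) = 0) ->
  forall p, of_type 4 2 2 p -> phi (det_form p) = 0.
Proof.
move=> pphi H.
pose m0 : 'X_{1..4} := (U_(o0) *+ 2)%MM; pose m1 : 'X_{1..4} := (U_(o1) *+ 2)%MM.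
pose c0 (F : quad -> mp) p := (F p)@_m0; pose c1 (F : quad -> mp) p := (F p)@_m1.
pose T1 (p : quad) := p.1.1; pose S1 (p : quad) := p.1.2.
pose T2 (p : quad) := p.2.1; pose S2 (p : quad) := p.2.2.
pose del p := c0 T1 p * c0 S1 p + c0 T2 p * c0 S2 p.
pose u p := c0 S1 p * c1 T1 p + c0 T2 p * c1 S2 p.
pose v p := c0 S1 p * c1 T2 p - c0 T2 p * c1 S1 p.
pose w p := c0 S2 p * c1 T1 p - c0 T1 p * c1 S2 p.
pose z p := c0 S2 p * c1 T2 p + c0 T1 p * c1 S1 p.
pose disc p := (z p - u p) ^+ 2 + 4%:R * (v p * w p).
(* Genericity: A0 is invertible, the eigenvectors can have first entry v, and the eigenvalues are
   distinct. *)
pose D p := del p * (v p * disc p).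
have aa := along_lines_algebra quad.
have lc0 (F : quad -> mp) : linear F -> along_lines (c0 F) by exact: along_lines_coef.
have lc1 (F : quad -> mp) : linear F -> along_lines (c1 F) by exact: along_lines_coef.
have lcc (F G : quad -> mp) : linear F -> linear G -> along_lines (fun p => c0 F p * c1 G p).
  by move=> lF lG; apply: (fa_mul aa); [exact: lc0 | exact: lc1].
have lu : along_lines u by apply: (fa_add aa); exact: lcc.
have lv : along_lines v by apply: (fa_add aa); [|apply: (fa_opp aa)]; exact: lcc.
have lw : along_lines w by apply: (fa_add aa); [|apply: (fa_opp aa)]; exact: lcc.
have lz : along_lines z by apply: (fa_add aa); exact: lcc.
have ldisc : along_lines disc.
  apply: (fa_add aa).
    by apply: (fa_exp aa); apply: (fa_add aa) => //; exact: (fa_opp aa).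
  by apply: (fa_mul aa); [exact: (fa_const aa) | exact: (fa_mul aa)].
have lD : along_lines D.
  apply: (fa_mul aa); last exact: (fa_mul aa).
  by apply: (fa_add aa); apply: (fa_mul aa); exact: lc0.
(* Here A0 is the identity and A1 a quarter turn, with discriminant -4. *)
pose b0 : quad := (('X_[m0], 'X_[m0]), ('X_[m1], 'X_[m1])).
have m01 : (m0 == m1) = false.
  by apply/eqP => /(congr1 (fun m : 'X_{1..4} => m o0)); rewrite !mulmnE !mnm1E.
have Sb0 : of_type 4 2 2 b0.
  by split; rewrite /= dhomogX; apply/eqP; apply: etrans (mdegMn _ _) _; rewrite mdeg1.
have Db0 : D b0 != 0.
  have m10 : (m1 == m0) = false by rewrite eq_sym.
  have f1 : c0 T1 b0 = 1 by rewrite [LHS]mcoeffX eqxx.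
  have f2 : c0 S1 b0 = 1 by rewrite [LHS]mcoeffX eqxx.
  have f3 : c0 T2 b0 = 0 by rewrite [LHS]mcoeffX m10.
  have f4 : c0 S2 b0 = 0 by rewrite [LHS]mcoeffX m10.
  have f5 : c1 T1 b0 = 0 by rewrite [LHS]mcoeffX m01.
  have f6 : c1 S1 b0 = 0 by rewrite [LHS]mcoeffX m01.
  have f7 : c1 T2 b0 = 1 by rewrite [LHS]mcoeffX eqxx.
  have f8 : c1 S2 b0 = 1 by rewrite [LHS]mcoeffX eqxx.
  rewrite /D /del /disc /u /v /w /z f1 f2 f3 f4 f5 f6 f7 f8.
  rewrite !(mulr0, mulr1, mul0r, addr0, add0r, sub0r, subr0, mul1r, subrr) expr0n add0r.
  by rewrite mulrN1 oppr_eq0 (natCC_neq0 3).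
apply: (along_lines_domain (@of_type_line 4 2 2) lD (along_lines_det_form pphi) _ Sb0 Db0).
move=> p Sp; have [->|] := eqVneq (D p) 0; first by rewrite mul0r.
rewrite /D !mulf_eq0 !negb_or => /and3P[d0 v0 disc0].
have [e1 He1] := exists_quadratic_root (z p - u p) (v p * w p).
pose e2 := z p - u p - e1.
have He2 : e2 ^+ 2 = (z p - u p) * e2 + v p * w p.
  have -> : v p * w p = e1 ^+ 2 - (z p - u p) * e1 by rewrite He1 addrC addKr.
  by rewrite /e2; ring.
have disc_e : disc p = (e2 - e1) ^+ 2.
  rewrite /disc.
  have -> : v p * w p = e1 ^+ 2 - (z p - u p) * e1 by rewrite He1 addrC addKr.
  by rewrite /e2; ring.
pose C (x : CC) : mp := x%:MP.
have hCl x (g : mp) : g \is 2.-homog -> C x * g \is 2.-homog.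
  by rewrite /C mul_mpolyC; exact: dhomogZ.
have hCr x (g : mp) : g \is 2.-homog -> g * C x \is 2.-homog.
  by move=> hg; rewrite (mulrC g (C x)); exact: (hCl x g hg).
have cCl x (g : mp) m : (C x * g)@_m = x * g@_m by exact: mcoeffCM.
have cCr x (g : mp) m : (g * C x)@_m = g@_m * x by rewrite (mulrC g) cCl mulrC.
have [h1 h2 h3 h4] := Sp.
pose p0 := c0 T1 p; pose q0 := c0 T2 p; pose r0 := c0 S2 p; pose s0 := c0 S1 p.
pose g11 : mp := C s0 * T1 p + C q0 * S2 p.
pose g12 : mp := C s0 * T2 p - C q0 * S1 p.
pose g21 : mp := C r0 * T1 p - C p0 * S2 p.
pose g22 : mp := C r0 * T2 p + C p0 * S1 p.
pose n11 : mp := C e2 * (g11 * C (v p) + g12 * C e1) - C (v p) * (g21 * C (v p) + g22 * C e1).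
pose n12 : mp := C e2 * (g11 * C (v p) + g12 * C e2) - C (v p) * (g21 * C (v p) + g22 * C e2).
pose n21 : mp := C (v p) * (g21 * C (v p) + g22 * C e1) - C e1 * (g11 * C (v p) + g12 * C e1).
pose n22 : mp := C (v p) * (g21 * C (v p) + g22 * C e2) - C e1 * (g11 * C (v p) + g12 * C e2).
pose kap := del p * (v p * (e2 - e1)) ^+ 2.
have kap0 : kap != 0.
  rewrite /kap mulf_neq0 // expf_neq0 // mulf_neq0 //.
  by apply: contraNneq disc0; rewrite disc_e => ->; rewrite expr0n.
have detE : n11 * n22 + n12 * - n21 = C kap * det_form p.
  have -> : C kap = (C p0 * C s0 + C q0 * C r0) * (C (v p) * (C e2 - C e1)) ^+ 2.
    apply: etrans (mpolyCM _ _ _) _; congr (_ * _).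
      by apply: etrans (mpolyCD _ _ _) _; rewrite !mpolyCM.
    by apply: etrans (rmorphXn (@mpolyC 4 CC) 2 _) _; congr (_ ^+ 2);
      apply: etrans (mpolyCM _ _ _) _; congr (_ * _); exact: mpolyCB.
  by rewrite mulrN; exact: diagonalise_pencil.
have hg : [/\ g11 \is 2.-homog, g12 \is 2.-homog, g21 \is 2.-homog & g22 \is 2.-homog].
  by split; first [apply: rpredB | apply: rpredD]; exact: hCl.
have [hg11 hg12 hg21 hg22] := hg.
have -> : det_form p = det_form ((C kap^-1 * n11, n22), (C kap^-1 * n12, - n21)).
  rewrite /det_form /= -!mulrA -mulrDr detE mulrA /C -mpolyCM mulVf // mul1r.
  by [].
rewrite H ?mulr0 //.
  split; rewrite /= ?rpredN; first [apply: (hCl) | idtac];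
    by apply: rpredB; apply: hCl; apply: rpredD; apply: hCr.
move=> m mE.
have g11E : g11@_m = s0 * (T1 p)@_m + q0 * (S2 p)@_m by rewrite mcoeffD !cCl.
have g12E : g12@_m = s0 * (T2 p)@_m - q0 * (S1 p)@_m by rewrite mcoeffB !cCl.
have g21E : g21@_m = r0 * (T1 p)@_m - p0 * (S2 p)@_m by rewrite mcoeffB !cCl.
have g22E : g22@_m = r0 * (T2 p)@_m + p0 * (S1 p)@_m by rewrite mcoeffD !cCl.
have [n12E n21E] : n12@_m = 0 /\ n21@_m = 0.
  rewrite !mcoeffB !cCl !mcoeffD !cCr g11E g12E g21E g22E; case: mE => ->.
    exact: (pencil_diagonal0 p0 q0 r0 s0 (v p) e1 e2).
  exact: (pencil_diagonal1 He1 He2).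
by split; [apply: etrans (cCl _ _ _) _; rewrite n12E mulr0
          | apply: etrans (mcoeffN _ _) _; rewrite n21E oppr0].
Qed.

(** * Counting monomials *)

Definition monomials k : seq 'X_{1..4} :=
  [seq s2m t | t : k.-tuple 'I_4 <- enum (basis 4 k)].

Lemma mem_monomials k m : (m \in monomials k) = (mdeg m == k).
Proof. by rewrite -basis_cover. Qed.

Lemma uniq_monomials k : uniq (monomials k).
Proof. exact: uniq_basis. Qed.

Definition nmono k := size (monomials k).

Lemma nmonoE k : (6 * nmono k = k.+1 * k.+2 * k.+3)%N.
Proof.
rewrite /nmono size_basis (_ : 'C(k + 3, k) = 'C(k + 3, 3)); last first.
  by rewrite -[in RHS]bin_sub ?leq_addl // addnK.
rewrite -[LHS]/(3`! * _)%N mulnC bin_ffact addn3 !ffactnS ffactn0 /=; lia.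
Qed.

Lemma supported_monomials k t : t \is k.-homog -> supported (monomials k) t.
Proof. by move=> ht m mt; rewrite mem_monomials; apply/eqP; exact: (dhomog_mf ht mt). Qed.

Definition low_monomials a k := [seq m : 'X_{1..4} <- monomials k | (m o0 < a)%N].

Lemma size_low_monomials a k : (a <= k)%N ->
  (size (low_monomials a k) + nmono (k - a) = nmono k)%N.
Proof.
move=> ak; pose x0a : 'X_{1..4} := (U_(o0) *+ a)%MM.
have E : perm_eq [seq (m + x0a)%MM | m <- monomials (k - a)]
    [seq m : 'X_{1..4} <- monomials k | ~~ (m o0 < a)%N].
  apply: uniq_perm.
  - by rewrite map_inj_uniq ?uniq_monomials //; exact: addIm.
  - by rewrite filter_uniq ?uniq_monomials.
  move=> m; rewrite mem_filter mem_monomials -leqNgt; apply/mapP/andP.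
    move=> [m']; rewrite mem_monomials => /eqP m'k ->.
    by rewrite mnmDE mulmnE mnm1E eqxx mul1n leq_addl mdegD m'k mdegMn mdeg1 mul1n subnK.
  move=> [am /eqP mk].
  have xm : (x0a <= m)%MM.
    by apply/mnm_lepP => i; rewrite mulmnE mnm1E; case: eqVneq => [<-|]; rewrite ?mul1n.
  exists (m - x0a)%MM; last by rewrite submK.
  have := congr1 (@mdeg 4) (submK xm); rewrite mdegD mk mdegMn mdeg1 mul1n => <-.
  by rewrite mem_monomials addnK.
have := perm_size E; rewrite size_map -/(nmono _) => ->.
rewrite /nmono /low_monomials !size_filter -(count_predC (fun m : 'X_{1..4} => m o0 < a)%N).
by [].
Qed.

Definition zw_mono d j : 'X_{1..4} := (U_(o2) *+ j + U_(o3) *+ (d - j))%MM.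

Lemma zw_monoE d j : [/\ zw_mono d j o0 = 0%N, zw_mono d j o1 = 0%N,
  zw_mono d j o2 = j & zw_mono d j o3 = (d - j)%N].
Proof. by split; rewrite mnmDE !mulmnE !mnm1E /= ?mul0n ?mul1n ?addn0. Qed.

Lemma mdeg_zw_mono d j : (j <= d)%N -> mdeg (zw_mono d j) = d.
Proof. by move=> jd; rewrite mdegD !mdegMn !mdeg1 !mul1n subnKC. Qed.

Lemma sum_ord4 (F : 'I_4 -> nat) : (\sum_(i < 4) F i = F o0 + (F o1 + (F o2 + F o3)))%N.
Proof. exact: big_ord4. Qed.

Definition xy_monomials d := [seq m : 'X_{1..4} <- monomials d | (0 < m o0 + m o1)%N].

Lemma size_xy_monomials d : (size (xy_monomials d) + d.+1 = nmono d)%N.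
Proof.
have E : perm_eq [seq zw_mono d j | j <- iota 0 d.+1]
    [seq m : 'X_{1..4} <- monomials d | ~~ (0 < m o0 + m o1)%N].
  apply: uniq_perm.
  - rewrite map_inj_in_uniq ?iota_uniq // => i j _ _ /(congr1 (fun m : 'X_{1..4} => m o2)).
    by have [_ _ -> _] := zw_monoE d i; have [_ _ -> _] := zw_monoE d j.
  - by rewrite filter_uniq ?uniq_monomials.
  move=> m; rewrite mem_filter mem_monomials -leqNgt leqn0 addn_eq0; apply/mapP/andP.
    move=> [j]; rewrite mem_iota add0n /= ltnS => jd ->.
    by have [-> -> _ _] := zw_monoE d j; rewrite mdeg_zw_mono.
  move=> [/andP[/eqP m0 /eqP m1] /eqP md].
  have := md; rewrite mdegE sum_ord4 m0 m1 !add0n => md'.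
  exists (m o2); first by rewrite mem_iota /= add0n ltnS -md' leq_addr.
  have [z0 z1 z2 z3] := zw_monoE d (m o2).
  apply/mnmP; apply: ord4P; rewrite ?z0 ?z1 ?z2 ?z3 // -md'.
  by rewrite addKn.
have := perm_size E; rewrite size_map size_iota => ->.
rewrite /nmono /xy_monomials !size_filter.
by rewrite -(count_predC (fun m : 'X_{1..4} => 0 < m o0 + m o1)%N).
Qed.

Lemma size_filter_neq (T : eqType) (s : seq T) x : uniq s -> x \in s ->
  ((size [seq y <- s | y != x]).+1 = size s)%N.
Proof.
move=> us xs; rewrite size_filter -(count_predC (pred1 x) s) /= count_uniq_mem // xs add1n.
by congr (_.+1).
Qed.

(** Combined with [size_coords] and the size of the slice, this is exactly the strict inequality
    needed by [separate_strict]. After b = a + x and d = 2b + y the case split shifts the variables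
    so that only nonnegative coefficients remain. The two cases using y >= 1 are the types (2, 2)
    and (1, 2), for which the inequality fails at d = 4. *)
Lemma type_count a b d : (1 <= a <= b)%N -> (2 <= b)%N -> (b + b <= d)%N -> (5 <= d)%N ->
  (nmono a + nmono b + nmono (d - a) + nmono (d - b) + d
   <= nmono d + nmono (b - a) + nmono (d - b - a) + 4)%N.
Proof.
move=> ab b2 bd d5.
suff : (6 * nmono a + 6 * nmono b + 6 * nmono (d - a) + 6 * nmono (d - b) + 6 * d
   <= 6 * nmono d + 6 * nmono (b - a) + 6 * nmono (d - b - a) + 24)%N by lia.
rewrite !nmonoE.
have [x bE] : exists x, b = (a + x)%N by exists (b - a)%N; lia.
have [y dE] : exists y, d = (b + b + y)%N by exists (d - (b + b))%N; lia.
rewrite {d bd}dE in d5 *; rewrite {b}bE in ab b2 d5 *.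
have -> : (a + x + (a + x) + y - a = a + x + x + y)%N by lia.
have -> : (a + x + (a + x) + y - (a + x) = a + x + y)%N by lia.
have -> : (a + x + y - a = x + y)%N by lia.
have -> : (a + x - a = x)%N by lia.
have [x2|x2] := leqP 2 x.
  have [A aE] : exists A, a = A.+1 by exists a.-1; lia.
  have [X xE] : exists X, x = X.+2 by exists (x - 2)%N; lia.
  rewrite aE xE; clear; nia.
have [x0|x1] := posnP x.
  have [a3|a3] := leqP 3 a.
    have [A aE] : exists A, a = A.+3 by exists (a - 3)%N; lia.
    rewrite aE x0; clear; nia.
  have aE : a = 2 by lia.
  have [Y yE] : exists Y, y = Y.+1 by exists y.-1; lia.
  rewrite aE x0 yE; clear; nia.
have xE : x = 1%N by lia.
have [a2|a2] := leqP 2 a.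
  have [A aE] : exists A, a = A.+2 by exists (a - 2)%N; lia.
  rewrite aE xE; clear; nia.
have aE : a = 1%N by lia.
have [Y yE] : exists Y, y = Y.+1 by exists y.-1; lia.
rewrite aE xE yE; clear; nia.
Qed.

(** * Nonvanishing points and linear substitutions *)

Lemma digits_unique B n (m m' : nat -> nat) :
  (forall i, m i < B)%N -> (forall i, m' i < B)%N ->
  (\sum_(i < n) m i * B ^ i = \sum_(i < n) m' i * B ^ i)%N ->
  forall i, (i < n)%N -> m i = m' i.
Proof.
elim: n m m' => // n IH m m' mB m'B; rewrite !big_ord_recl !expn0 !muln1 /=.
have E (w : nat -> nat) : (\sum_(i < n) w (bump 0 i) * B ^ bump 0 i =
    B * \sum_(i < n) w i.+1 * B ^ i)%N.
  by rewrite big_distrr /=; apply: eq_bigr => i _; rewrite /bump /= add1n expnS mulnCA.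
rewrite !E => H.
have B0 : (0 < B)%N by rewrite (leq_ltn_trans _ (mB 0%N)).
have m00 : m 0%N = m' 0%N.
  have := congr1 (modn^~ B) H; rewrite ![(_ + B * _)%N]addnC.
  by rewrite ![(B * _)%N]mulnC !modnMDl !modn_small.
move: H; rewrite m00 => /addnI/eqP; rewrite eqn_pmul2l // => /eqP H.
by case=> // i; rewrite ltnS; apply: (IH (fun i => m i.+1) (fun i => m' i.+1)).
Qed.

(* Kronecker substitution *)
Lemma mpoly_nonzero_point n (P : {mpoly CC[n]}) : P != 0 -> exists v, P.@[v] != 0.
Proof.
move=> P0.
pose B := msize P.
pose E (m : 'X_{1..n}) := (\sum_(i < n) m i * B ^ i)%N.
have mB (m : 'X_{1..n}) i : m \in msupp P -> (m i < B)%N.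
  move=> mP; rewrite (leq_ltn_trans _ (msize_mdeg_lt mP)) // mdegE (bigD1 i) //=.
  by rewrite leq_addr.
have Einj : {in msupp P &, injective E}.
  move=> m m' mP m'P mm'.
  pose w (l : 'X_{1..n}) k := if insub k is Some i then l i else 0%N.
  have wE (l : 'X_{1..n}) (i : 'I_n) : w l i = l i by rewrite /w valK.
  have B0 : (0 < B)%N by rewrite lt0n /B msize_poly_eq0.
  have wB l k : l \in msupp P -> (w l k < B)%N.
    by move=> lP; rewrite /w; case: insub => [i|//]; exact: mB.
  apply/mnmP => i; rewrite -!wE; apply: (@digits_unique B n (w m) (w m')) => // [k|k|].
  - exact: wB.
  - exact: wB.
  by transitivity (E m); [|rewrite mm']; apply: eq_bigr => k _; rewrite wE.
pose Q : {poly CC} := \sum_(m <- msupp P) P@_m *: 'X^(E m).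
have [m mP] : exists m, m \in msupp P.
  by exists (mlead P); exact: mlead_supp.
have Qm : Q`_(E m) = P@_m.
  rewrite /Q coef_sum (bigD1_seq m) //= coefZ coefXn eqxx mulr1 big1_seq ?addr0 //.
  move=> m' /andP[m'm m'P]; rewrite coefZ coefXn.
  case: eqVneq => [EE|]; last by rewrite mulr0.
  by rewrite (Einj _ _ m'P mP (esym EE)) eqxx in m'm.
have Q0 : Q != 0.
  by apply: contraTneq mP => Q0; rewrite mcoeff_msupp -Qm Q0 coef0 eqxx.
apply: boolp.contrapT => /boolp.forallNP N.
case/eqP: Q0; apply: poly_nat_roots natCC_neq0 _ => x.
have /negP/negPn/eqP <- := N (fun i => x%:R ^+ (B ^ i)).
rewrite mevalE horner_sum; apply: eq_bigr => l _.
rewrite hornerZ hornerXn /E -prodrXr; congr (_ * _).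
by apply: eq_bigr => i _; rewrite -exprM mulnC.
Qed.

Section ZW.

Definition zw_only (h : mp) := forall m : 'X_{1..4}, (0 < m o0 + m o1)%N -> h@_m = 0.

Lemma zw_onlyM g h : zw_only g -> zw_only h -> zw_only (g * h).
Proof.
move=> zg zh m m0; rewrite mcoeffM big1 // => k /eqP mk.
have Em i : m i = (k.1 i + k.2 i)%N by rewrite {1}mk mnmDE.
move: m0; rewrite !Em addnACA addn_gt0 => /orP[/zg ->|/zh ->]; by rewrite ?mul0r ?mulr0.
Qed.

Lemma zw_onlyD g h : zw_only g -> zw_only h -> zw_only (g + h).
Proof. by move=> zg zh m m0; rewrite mcoeffD zg // zh // addr0. Qed.

Lemma zw_onlyZ c h : zw_only h -> zw_only (c *: h).
Proof. by move=> zh m m0; rewrite mcoeffZ zh // mulr0. Qed.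

Lemma zw_onlyX h k : zw_only h -> zw_only (h ^+ k).
Proof.
move=> zh; elim: k => [|k IH]; last by rewrite exprS; exact: zw_onlyM.
move=> m m0; rewrite expr0 mcoeff1; case: eqVneq m0 => [->|//].
by rewrite !mnm0E.
Qed.

Lemma zw_only2 : zw_only 'X_o2.
Proof. by move=> m; rewrite mcoeffX; case: eqVneq => [<-|//]; rewrite !mnm1E. Qed.

Lemma zw_only3 : zw_only 'X_o3.
Proof. by move=> m; rewrite mcoeffX; case: eqVneq => [<-|//]; rewrite !mnm1E. Qed.

Definition subst_xy (A B : mp) : 4.-tuple mp := [tuple A; B; 'X_o2; 'X_o3].

Lemma mpolyX4 (m : 'X_{1..4}) :
  'X_[m] = 'X_o0 ^+ m o0 * ('X_o1 ^+ m o1 * ('X_o2 ^+ m o2 * 'X_o3 ^+ m o3)) :> mp.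
Proof. by rewrite mpolyXE_id prod_ord4. Qed.

Definition zw_part (m : 'X_{1..4}) : mp := 'X_o2 ^+ m o2 * 'X_o3 ^+ m o3.

Lemma subst_xyX A B m :
  'X_[m] \mPo subst_xy A B = A ^+ m o0 * (B ^+ m o1 * zw_part m).
Proof. by rewrite comp_mpolyX prod_ord4 !(tnth_nth 0). Qed.

(** F minus its restriction to x = A, y = B lies in the ideal of that line; telescoping each
    monomial by geometric sums gives homogeneous quotients, hence a form of type (1, 1). *)
Lemma subst_difference d (F A B : mp) : F \is d.+1.-homog ->
  A \is 1.-homog -> B \is 1.-homog ->
  exists s1 s2, [/\ s1 \is d.-homog, s2 \is d.-homog &
    F - (F \mPo subst_xy A B) = ('X_o0 - A) * s1 + ('X_o1 - B) * s2].
Proof.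
move=> hF hA hB.
have E : F \mPo subst_xy A B = \sum_(m : 'X_{1..4 < d.+2} | mdeg m == d.+1)
    ((F@_m *: 'X_[m]) \mPo subst_xy A B).
  by rewrite {1}(homog_sum hF) raddf_sum.
have -> : F - (F \mPo subst_xy A B) = \sum_(m : 'X_{1..4 < d.+2} | mdeg m == d.+1)
    (F@_m *: 'X_[m] - ((F@_m *: 'X_[m]) \mPo subst_xy A B)).
  by rewrite sumrB -E -homog_sum.
pose Q (h : mp) := exists s1 s2, [/\ s1 \is d.-homog, s2 \is d.-homog &
    h = ('X_o0 - A) * s1 + ('X_o1 - B) * s2].
apply: (big_ind Q).
- by exists 0, 0; rewrite !mulr0 addr0; split; rewrite ?rpred0.
- move=> g h [s1 [s2 [h1 h2 ->]]] [t1 [t2 [k1 k2 ->]]].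
  exists (s1 + t1), (s2 + t2); split; [exact: rpredD | exact: rpredD|].
  by rewrite !mulrDr addrACA.
move=> [m /= _] /eqP md; rewrite comp_mpolyZ subst_xyX -scalerBr mpolyX4 -/(zw_part m).
have geom (g h : mp) k : g \is 1.-homog -> h \is 1.-homog ->
    exists2 s, s \is k.-1.-homog & g ^+ k - h ^+ k = (g - h) * s.
  move=> hg hh; exists (\sum_(i < k) g ^+ (k.-1 - i) * h ^+ i); last exact: subrXX.
  apply: rpred_sum => -[i ik] _ /=.
  have kE : (1 * (k.-1 - i) + 1 * i = k.-1)%N by move: ik; case: k => // k; rewrite /= !mul1n; lia.
  by have := dhomogM (dhomogMn (k.-1 - i) hg) (dhomogMn i hh); rewrite kE.
have md' : (m o0 + (m o1 + (m o2 + m o3)) = d.+1)%N by rewrite -md mdegE sum_ord4.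
have hzw : zw_part m \is (m o2 + m o3)%N.-homog by apply: dhomogM; exact: homogXn.
have [u hu uE] := geom _ _ (m o0) (homogX1 o0) hA.
have [v hv vE] := geom _ _ (m o1) (homogX1 o1) hB.
(* For exponent 0 the difference of powers is zero, but [.-1] would assign the quotient the wrong
   degree. *)
pose s1 : mp := if (m o0 == 0)%N then 0 else u * ('X_o1 ^+ m o1 * zw_part m).
pose s2 : mp := if (m o1 == 0)%N then 0 else A ^+ m o0 * (v * zw_part m).
exists (F@_m *: s1), (F@_m *: s2); split.
- apply: dhomogZ; rewrite /s1; case: eqVneq => [_|m0]; first exact: rpred0.
  have dE : ((m o0).-1 + (m o1 + (m o2 + m o3)) = d)%N by lia.
  by have := dhomogM hu (dhomogM (homogXn o1 (m o1)) hzw); rewrite dE.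
- apply: dhomogZ; rewrite /s2; case: eqVneq => [_|m1]; first exact: rpred0.
  have dE : (1 * m o0 + ((m o1).-1 + (m o2 + m o3)) = d)%N by lia.
  by have := dhomogM (dhomogMn (m o0) hA) (dhomogM hv hzw); rewrite dE.
rewrite -!scalerAr -scalerDr; congr (_ *: _).
have -> : ('X_o0 - A) * s1 = ('X_o0 ^+ m o0 - A ^+ m o0) * ('X_o1 ^+ m o1 * zw_part m).
  rewrite /s1; case: eqVneq => [->|_]; first by rewrite !expr0 subrr mulr0 mul0r.
  by rewrite uE mulrA.
have -> : ('X_o1 - B) * s2 = A ^+ m o0 * (('X_o1 ^+ m o1 - B ^+ m o1) * zw_part m).
  rewrite /s2; case: eqVneq => [->|_]; first by rewrite !expr0 subrr mulr0 mul0r mulr0.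
  by rewrite vE mulrCA -mulrA.
move: ('X_o0 ^+ m o0) (A ^+ m o0) ('X_o1 ^+ m o1) (B ^+ m o1) (zw_part m) => e f g h z.
rewrite mulrBl mulrBl mulrBr.
by rewrite addrA subrK.
Qed.

End ZW.

(** * Independent coefficients on W(1, 1) *)

Definition special_monomials d := [seq zw_mono d j | j <- [:: d; d.-1; 1%N; 0%N]].

(** Coefficients involving x or y are free for surfaces through a given line near x = y = 0; x^d is
    omitted as it is normalised to 1. The four special coefficients in z, w account for the four
    parameters of the line. *)
Definition coords d : seq 'X_{1..4} := special_monomials d ++
  [seq m : 'X_{1..4} <- xy_monomials d | m != (U_(o0) *+ d)%MM].

Lemma zw_mono_inj d : injective (zw_mono d).
Proof.
move=> i j /(congr1 (fun m : 'X_{1..4} => m o2)).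
by have [_ _ -> _] := zw_monoE d i; have [_ _ -> _] := zw_monoE d j.
Qed.

Lemma size_coords d : (2 < d)%N -> (size (coords d) + d = nmono d + 2)%N.
Proof.
move=> d2; have /= := @size_filter_neq _ (xy_monomials d) (U_(o0) *+ d)%MM.
rewrite filter_uniq ?uniq_monomials // mem_filter mem_monomials mdegMn mdeg1 mul1n eqxx andbT.
rewrite !mulmnE !mnm1E eqxx mul1n addn_gt0 (ltn_trans _ d2) // => /(_ isT isT) E.
by rewrite /coords -(size_xy_monomials d) -E /=; lia.
Qed.

Lemma uniq_coords d : (2 < d)%N -> uniq (coords d).
Proof.
move=> d2; rewrite cat_uniq !filter_uniq ?uniq_monomials // andbT.
rewrite map_inj_uniq; last exact: zw_mono_inj.
apply/andP; split; first by rewrite /= !inE; lia.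
apply/hasPn => m; rewrite !mem_filter => /andP[_ /andP[m0 _]].
by apply/mapP => -[j _ mj]; move: m0; rewrite mj; have [-> -> _ _] := zw_monoE d j.
Qed.

Section Dominance.
Variables (d : nat) (d2 : (2 < d)%N).
Let Y := coords d.
Let R := size Y.
Let x0d : 'X_{1..4} := (U_(o0) *+ d)%MM.
Let y (l : 'I_R) := nth 0%MM Y l.

Lemma coords_ge4 : (4 <= R)%N. Proof. by rewrite /R /Y /coords. Qed.

Let sp (i : 'I_4) : 'I_R := widen_ord coords_ge4 i.

Lemma y_spE i : y (sp i) = zw_mono d (nth 0%N [:: d; d.-1; 1%N; 0%N] i).
Proof. by move: i; apply: ord4P. Qed.

Lemma y_sp i : exists j, [/\ y (sp i) = zw_mono d j & (j <= d)%N].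
Proof.
exists (nth 0%N [:: d; d.-1; 1%N; 0%N] i); split; first exact: y_spE.
by move: i; apply: ord4P => /=; lia.
Qed.

Lemma y_xy (l : 'I_R) : (4 <= l)%N ->
  [/\ (0 < y l o0 + y l o1)%N, mdeg (y l) = d & y l != x0d].
Proof.
move=> l4; have : y l \in [seq m : 'X_{1..4} <- xy_monomials d | m != x0d].
  by rewrite /y; case: l l4 => [[|[|[|[|l]]]] Hl] //= _; apply: mem_nth.
by rewrite !mem_filter mem_monomials => /andP[-> /andP[-> /eqP ->]].
Qed.

Lemma y_inj : injective y.
Proof.
move=> l l' /eqP; rewrite nth_uniq ?ltn_ord ?uniq_coords // => /eqP.
exact: val_inj.
Qed.

Let part0 (v : 'I_R -> CC) : mp :=
  \sum_(l < R | (4 <= l)%N && ((y l o0 == 1%N) && (y l o1 == 0%N))) v l *: zw_part (y l).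
Let part1 (v : 'I_R -> CC) : mp :=
  \sum_(l < R | (4 <= l)%N && ((y l o0 == 0%N) && (y l o1 == 1%N))) v l *: zw_part (y l).

Let E (v : 'I_R -> CC) (k : 'I_4) : mp :=
  (if (k < 2)%N then part0 v else part1 v) * (if odd k then 'X_o3 else 'X_o2).

(** The linear map from the four coefficients of A and B to the special coefficients of [curve] at
    first order in e; only the terms of F linear in x, y enter. *)
Let Mx (v : 'I_R -> CC) : 'M[CC]_4 := \matrix_(i, k) - (E v k)@_(y (sp i)).

Lemma det_Mx_polyM : polyM (fun v => \det (Mx v)).
Proof.
have A := @polyM_algebra R.
apply: (fa_det A) => i k.
apply: (fa_ext (f := fun v => - (E v k)@_(y (sp i)))); first by move=> v; rewrite mxE.
apply: (fa_opp A); apply: (family_mul A); last exact: (family_const A).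
by case: ltnP => _; apply: (family_sum A) => l; apply: (family_scale A);
  [exact: polyM_coord | exact: family_const | exact: polyM_coord | exact: family_const].
Qed.

Lemma coords_cover m : mdeg m = d -> (0 < m o0 + m o1)%N -> m != x0d ->
  exists2 l : 'I_R, (4 <= l)%N & y l = m.
Proof.
move=> md m0 mx; pose L := [seq m : 'X_{1..4} <- xy_monomials d | m != x0d].
have mL : m \in L by rewrite !mem_filter mx m0 mem_monomials md eqxx.
have lt : (4 + index m L < R)%N by rewrite -index_mem in mL; exact: mL.
exists (Ordinal lt); first exact: leq_addr.
by rewrite /y /= nth_index.
Qed.

(** For F with linear part x z^(d-1) + y w^(d-1), the multiples of these two cofactors by z and w
    are precisely the four special monomials, which explains their choice. *)
Lemma det_Mx_neq0 : exists v, \det (Mx v) != 0.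
Proof.
pose a : 'X_{1..4} := (U_(o0) + zw_mono d.-1 d.-1)%MM.
pose b : 'X_{1..4} := (U_(o1) + zw_mono d.-1 0)%MM.
have d0 : d = d.-1.+1 by rewrite prednK // (ltn_trans _ d2).
have [za0 za1 za2 za3] := zw_monoE d.-1 d.-1; have [zb0 zb1 zb2 zb3] := zw_monoE d.-1 0.
have [la la4 ya] : exists2 l : 'I_R, (4 <= l)%N & y l = a.
  apply: coords_cover.
  - by rewrite [LHS]mdegD mdeg1 mdeg_zw_mono // add1n -d0.
  - by rewrite [a o0]mnmDE [a o1]mnmDE !mnm1E za0 za1.
  apply/eqP => /(congr1 (fun m : 'X_{1..4} => m o0)).
  by rewrite [a o0]mnmDE mnm1E za0 mulmnE mnm1E /= mul1n => e; move: d2; rewrite -e.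
have [lb lb4 yb] : exists2 l : 'I_R, (4 <= l)%N & y l = b.
  apply: coords_cover.
  - by rewrite [LHS]mdegD mdeg1 mdeg_zw_mono // add1n -d0.
  - by rewrite [b o0]mnmDE [b o1]mnmDE !mnm1E zb0 zb1.
  apply/eqP => /(congr1 (fun m : 'X_{1..4} => m o0)).
  by rewrite [b o0]mnmDE mnm1E zb0 mulmnE mnm1E /= mul1n => e; move: d2; rewrite -e.
have ab : la != lb.
  apply/eqP => e; have := congr1 (fun m : 'X_{1..4} => m o0) (etrans (esym ya) (etrans (congr1 y e) yb)).
  by rewrite [a o0]mnmDE [b o0]mnmDE !mnm1E za0 zb0.
pose v (l : 'I_R) : CC := (l == la)%:R + (l == lb)%:R.
have p0 : part0 v = 'X_o2 ^+ d.-1.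
  rewrite /part0 (bigD1 la) /=; last first.
    by rewrite la4 ya [a o0]mnmDE [a o1]mnmDE !mnm1E za0 za1.
  rewrite big1 ?addr0 => [|l /andP[/andP[l4 /andP[l0 l1]] lla]].
    rewrite /v eqxx (negbTE ab) addr0 scale1r ya /zw_part [a o2]mnmDE [a o3]mnmDE !mnm1E za2 za3 /= !add0n.
    by rewrite subnn expr0 mulr1.
  rewrite /v (negbTE lla) add0r; case: (eqVneq l lb) => [e|_]; last by rewrite scale0r.
  by move: l0; rewrite e yb [b o0]mnmDE mnm1E zb0.
have p1 : part1 v = 'X_o3 ^+ d.-1.
  rewrite /part1 (bigD1 lb) /=; last first.
    by rewrite lb4 yb [b o0]mnmDE [b o1]mnmDE !mnm1E zb0 zb1.
  rewrite big1 ?addr0 => [|l /andP[/andP[l4 /andP[l0 l1]] llb]].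
    rewrite /v eqxx eq_sym (negbTE ab) add0r scale1r yb /zw_part [b o2]mnmDE [b o3]mnmDE !mnm1E zb2 zb3 /= !add0n.
    by rewrite subn0 expr0 mul1r.
  rewrite /v (negbTE llb) addr0; case: (eqVneq l la) => [e|_]; last by rewrite scale0r.
  by move: l0; rewrite e ya [a o0]mnmDE mnm1E za0.
exists v; suff -> : Mx v = (-1)%:M by rewrite det_scalar expf_neq0 // oppr_eq0 oner_neq0.
have Ek k : E v k = 'X_[zw_mono d (nth 0%N [:: d; d.-1; 1%N; 0%N] k)].
  have zX j : 'X_[zw_mono d j] = 'X_o2 ^+ j * 'X_o3 ^+ (d - j) :> mp.
    by rewrite mpolyXD !mpolyXn.
  rewrite zX /E p0 p1; move: k; apply: ord4P => /=.
  - by rewrite subnn expr0 mulr1 -exprSr -d0.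
  - by rewrite -subn1 subKn ?expr1 // (ltn_trans _ d2).
  - by rewrite expr1 subn1 mulrC.
  - by rewrite subn0 expr0 mul1r -exprSr -d0.
apply/matrixP => i k; rewrite !mxE Ek mcoeffX y_spE (inj_eq (@zw_mono_inj d)).
rewrite nth_uniq ?ltn_ord //=; last by rewrite !inE; lia.
by rewrite mulNrn eq_sym.
Qed.

Section Curve.
Variables (v : 'I_R -> CC) (A B : mp).
Hypotheses (hA : A \is 1.-homog) (hB : B \is 1.-homog) (zA : zw_only A) (zB : zw_only B).

Let F : mp := 'X_[x0d] + \sum_(l < R | (4 <= l)%N) v l *: 'X_[y l].

(* [curve e] vanishes on the line x = e A, y = e B. *)
Let curve (e : CC) : mp := F - (F \mPo subst_xy (e *: A) (e *: B)).

Lemma F_homog : F \is d.-homog.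
Proof.
apply: rpredD; first by rewrite dhomogX; apply/eqP; apply: etrans (mdegMn _ _) _; rewrite mdeg1 mul1n.
apply: rpred_sum => l l4; apply: dhomogZ; rewrite dhomogX; apply/eqP.
by have [_ + _] := y_xy l4.
Qed.

Lemma curve_type11 e : exists2 p, of_type d 1 1 p & det_form p = curve e.
Proof.
have dE : d = d.-1.+1 by rewrite prednK // (ltn_trans _ d2).
have hF : F \is d.-1.+1.-homog by rewrite -dE; exact: F_homog.
have [s1 [s2 [h1 h2 E12]]] := subst_difference hF (dhomogZ e hA) (dhomogZ e hB).
exists (('X_o0 - e *: A, s1), ('X_o1 - e *: B, s2)); last by rewrite /curve E12.
by split; rewrite /= ?subn1 //; apply: rpredB; [exact: homogX1 | exact: dhomogZ |
  exact: homogX1 | exact: dhomogZ].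
Qed.

Lemma comp_F e : F \mPo subst_xy (e *: A) (e *: B) =
  e ^+ d *: A ^+ d + \sum_(l < R | (4 <= l)%N)
    (v l * e ^+ (y l o0 + y l o1)) *: (A ^+ y l o0 * (B ^+ y l o1 * zw_part (y l))).
Proof.
have XE m : 'X_[m] \mPo subst_xy (e *: A) (e *: B) =
    e ^+ (m o0 + m o1) *: (A ^+ m o0 * (B ^+ m o1 * zw_part m)).
  by rewrite subst_xyX !exprZn -!scalerAl -!scalerAr scalerA -exprD.
rewrite comp_mpolyD raddf_sum XE; congr (_ + _).
  rewrite /x0d /zw_part !mulmnE !mnm1E /= mul1n !mul0n addn0 !expr0.
  by rewrite !mulr1.
by apply: eq_bigr => l _; rewrite /= comp_mpolyZ XE scalerA.
Qed.

Lemma comp_F_zw e : zw_only (F \mPo subst_xy (e *: A) (e *: B)).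
Proof.
have zz m : zw_only (zw_part m).
  by apply: zw_onlyM; apply: zw_onlyX; [exact: zw_only2 | exact: zw_only3].
rewrite comp_F; apply: zw_onlyD; first exact/zw_onlyZ/zw_onlyX.
apply: (big_ind zw_only) => [m _|g h|l _]; [exact: mcoeff0 | exact: zw_onlyD |].
by apply: zw_onlyZ; apply: zw_onlyM; [exact: zw_onlyX | apply: zw_onlyM; [exact: zw_onlyX|]].
Qed.

Lemma curve_x0d e : (curve e)@_x0d = 1.
Proof.
rewrite mcoeffB comp_F_zw ?subr0; last first.
  by rewrite !mulmnE !mnm1E /= mul1n addn_gt0 (ltn_trans _ d2).
rewrite mcoeffD mcoeffX eqxx (raddf_sum (mcoeff x0d)) big1 ?addr0 // => l l4 /=.
by rewrite mcoeffZ mcoeffX; have [_ _ /negbTE ->] := y_xy l4; rewrite mulr0.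
Qed.

Lemma curve_xy e (l : 'I_R) : (4 <= l)%N -> (curve e)@_(y l) = v l.
Proof.
move=> l4; have [yl _ yx] := y_xy l4.
rewrite mcoeffB comp_F_zw // subr0 mcoeffD mcoeffX eq_sym (negbTE yx) add0r.
rewrite (raddf_sum (mcoeff (y l))) /= (bigD1 l) //= mcoeffZ mcoeffX eqxx mulr1.
rewrite big1 ?addr0 // => k /andP[k4 kl]; rewrite mcoeffZ mcoeffX.
by rewrite (inj_eq y_inj) (negbTE kl) mulr0.
Qed.

(** The special coefficients of [curve e] divided by e, written out as polynomials so that they make
    sense at e = 0. *)
Definition slope (e : CC) (i : 'I_4) : CC :=
  - (e ^+ d.-1 * (A ^+ d)@_(y (sp i)) + \sum_(l < R | (4 <= l)%N)
      v l * e ^+ (y l o0 + y l o1).-1 *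
        (A ^+ y l o0 * (B ^+ y l o1 * zw_part (y l)))@_(y (sp i))).

Lemma curve_special e i : (curve e)@_(y (sp i)) = e * slope e i.
Proof.
have [j [yj jd]] := y_sp i; have [z0 z1 z2 z3] := zw_monoE d j.
have F0 : F@_(y (sp i)) = 0.
  have nz (m : 'X_{1..4}) : (0 < m o0 + m o1)%N -> (m == y (sp i)) = false.
    by move=> m0; apply/eqP => me; move: m0; rewrite me yj z0 z1.
  rewrite mcoeffD mcoeffX nz ?add0r; last first.
    by rewrite !mulmnE !mnm1E /= mul1n addn_gt0 (ltn_trans _ d2).
  rewrite (raddf_sum (mcoeff _)) big1 // => l l4 /=.
  by rewrite mcoeffZ mcoeffX nz ?mulr0 //; have [] := y_xy l4.
rewrite mcoeffB F0 sub0r comp_F mcoeffD mcoeffZ (raddf_sum (mcoeff _)) /slope mulrN mulrDr mulrA.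
have dE : d = d.-1.+1 by rewrite prednK // (ltn_trans _ d2).
congr (- (_ + _)); first by rewrite -exprS -dE.
rewrite mulr_sumr; apply: eq_bigr => l l4; rewrite [LHS]mcoeffZ [RHS]mulrA; congr (_ * _).
by rewrite mulrCA -exprS prednK //; have [] := y_xy l4.
Qed.

Lemma slope_poly i : poly1 (slope^~ i).
Proof.
have AA := poly1_algebra; apply: (fa_opp AA); apply: (fa_add AA).
  by apply: (fa_mul AA); [exact: (fa_exp AA _ poly1_id) | exact: (fa_const AA)].
apply: (fa_sum AA) => l; apply: (fa_mul AA); last exact: (fa_const AA).
by apply: (fa_mul AA); [exact: (fa_const AA) | exact: (fa_exp AA _ poly1_id)].
Qed.

Lemma slope0 i : slope 0 i = - (A * part0 v + B * part1 v)@_(y (sp i)).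
Proof.
rewrite /slope expr0n; have -> : (d.-1 == 0)%N = false by move: d2; case: (d) => [|[|]].
rewrite mul0r add0r; congr (- _); rewrite mcoeffD /part0 /part1 !mulr_sumr.
rewrite !(raddf_sum (mcoeff _)) !big_mkcondr -big_split /=; apply: eq_bigr => l l4.
have [yl _ _] := y_xy l4.
case: (y l o0) (y l o1) yl => [|[|n]] [|[|k]] //= _; rewrite ?expr0 ?expr1 ?mul1r ?mulr1
  ?expr0n ?mulr0 ?mul0r ?addr0 ?add0r //; by rewrite -scalerAr mcoeffZ.
Qed.

End Curve.

Lemma mul_pencil (K : pzRingType) (S : comAlgType K) (a b c e : K) (z w u0 u1 : S) :
  (a *: z + b *: w) * u0 + (c *: z + e *: w) * u1 =
  a *: (u0 * z) + (b *: (u0 * w) + (c *: (u1 * z) + e *: (u1 * w))).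
Proof. by rewrite !mulrDl -!scalerAl -!addrA ![_ * u0]mulrC ![_ * u1]mulrC. Qed.

(* The coefficients of [curve e] are prescribed at the nonspecial coordinates and
   equal [e * slope e] at the four special ones, where A and B prescribe
   [slope 0]. Hence for small [e] the part of [P] of lowest degree in the special
   variables dominates. *)
Lemma dominance (P : {mpoly CC[R]}) : P != 0 ->
  exists p, [/\ of_type d 1 1 p, (det_form p)@_x0d = 1
    & P.@[fun l => (det_form p)@_(y l)] != 0].
Proof.
move=> P0.
pose j (m : 'X_{1..R}) := (\sum_(l < R | (l < 4)%N) m l)%N.
have exj : exists n, has (fun m => j m == n) (msupp P).
  by exists (j (mlead P)); apply/hasP; exists (mlead P) => //; exact: mlead_supp.
case: (ex_minnP exj) => j0 /hasP[m0 m0P /eqP m0j] jmin.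
have jP m : m \in msupp P -> (j0 <= j m)%N.
  by move=> mP; apply: jmin; apply/hasP; exists m.
(* The lowest part of P in the special variables governs the behaviour as e tends to 0; v is taken
   outside its zeros and those of the determinant. *)
pose Pj : {mpoly CC[R]} := \sum_(m <- msupp P | j m == j0) P@_m *: 'X_[m].
have Pj0 : Pj != 0.
  apply/eqP => /(congr1 (mcoeff m0)); rewrite mcoeff0 (raddf_sum (mcoeff _)) big_mkcond /=.
  rewrite (bigD1_seq m0) //= m0j eqxx mcoeffZ mcoeffX eqxx mulr1 big1 ?addr0.
    by move/eqP; apply/negP; rewrite -mcoeff_msupp.
  move=> m mm0; rewrite mcoeffZ mcoeffX (negbTE mm0) mulr0 if_same //.
have [D HD] := det_Mx_polyM.
have D0 : D != 0.
  have [v] := det_Mx_neq0; rewrite HD; apply: contraNneq => ->.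
  by rewrite meval0.
have [v] := mpoly_nonzero_point (mulf_neq0 Pj0 D0).
rewrite mevalM mulf_eq0 negb_or -HD => /andP[Pv Dv].
pose w : 'cV[CC]_4 := \col_i v (sp i).
pose x := invmx (Mx v) *m w.
have Mxx : Mx v *m x = w by rewrite mulKVmx // unitmxE unitfE.
pose A : mp := x o0 0 *: 'X_o2 + x o1 0 *: 'X_o3.
pose B : mp := x o2 0 *: 'X_o2 + x o3 0 *: 'X_o3.
have hA : A \is 1.-homog by apply: rpredD; apply: dhomogZ; exact: homogX1.
have hB : B \is 1.-homog by apply: rpredD; apply: dhomogZ; exact: homogX1.
have zA : zw_only A by apply: zw_onlyD; apply: zw_onlyZ; [exact: zw_only2 | exact: zw_only3].
have zB : zw_only B by apply: zw_onlyD; apply: zw_onlyZ; [exact: zw_only2 | exact: zw_only3].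
have slopev i : slope v A B 0 i = v (sp i).
  rewrite slope0; have := congr1 (fun M : 'cV_4 => M i 0) Mxx; rewrite !mxE => <-.
  have -> : A * part0 v + B * part1 v = \sum_k x k 0 *: E v k.
    rewrite /E big_ord4; exact: mul_pencil.
  rewrite (raddf_sum (mcoeff _)) -sumrN; apply: eq_bigr => k _.
  by rewrite !mxE /= mcoeffZ mulrC mulNr.
pose val e (l : 'I_R) := if (l < 4)%N then slope v A B e (inord l) else v l.
(* P at the coefficients of [curve e] equals e^j0 times Q(e), and Q(0) is the value of [Pj] at v. *)
pose Q e := \sum_(m <- msupp P) P@_m * (e ^+ (j m - j0) * \prod_l val e l ^+ m l).
have AA := poly1_algebra.
have Qpoly : poly1 Q.
  apply: (fa_sum AA) => m; apply: (fa_mul AA); first exact: (fa_const AA).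
  apply: (fa_mul AA); first exact: (fa_exp AA _ poly1_id).
  apply: (fa_prod AA) => l; apply: (fa_exp AA); rewrite /val.
  by case: ltnP => _; [exact: slope_poly | exact: (fa_const AA)].
have val0 l : val 0 l = v l.
  rewrite /val; case: ltnP => // l4; rewrite slopev; congr v; apply: val_inj.
  by rewrite /= inordK.
have Q0 : Q 0 != 0.
  suff -> : Q 0 = Pj.@[v] by [].
  rewrite /Q /Pj (raddf_sum (meval v)) /= [RHS]big_mkcond /= [LHS]big_seq [RHS]big_seq.
  apply: eq_bigr => m mP; rewrite mevalZ mevalX.
  rewrite (eq_bigr (fun l => v l ^+ m l)) => [|l _]; last by rewrite val0.
  rewrite expr0n subn_eq0 (_ : (j m <= j0)%N = (j m == j0)); last first.
    by rewrite eqn_leq jP // andbT.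
  by case: eqVneq => _; rewrite ?mul1r // mul0r mulr0.
have [e e0 Qe] : exists2 e, e != 0 & Q e != 0.
  apply: boolp.contrapT => N.
  have QX r : Q r * r = 0.
    have [->|r0] := eqVneq r 0; first by rewrite mulr0.
    have [->|Qr] := eqVneq (Q r) 0; first by rewrite mul0r.
    by case: N; exists r.
  by have /eqP := poly1_nz Qpoly poly1_id QX Q0 1; apply/negP; exact: oner_neq0.
have [p tp pE] := curve_type11 v hA hB e.
exists p; split=> //; first by rewrite pE curve_x0d.
suff -> : P.@[fun l => (det_form p)@_(y l)] = e ^+ j0 * Q e by rewrite mulf_neq0 ?expf_neq0.
rewrite mevalE /Q mulr_sumr [LHS]big_seq [RHS]big_seq; apply: eq_bigr => m mP.
rewrite mulrCA; congr (_ * _); rewrite mulrA -exprD subnKC ?jP //.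
have coefE l : (det_form p)@_(y l) = (if (l < 4)%N then e else 1) * val e l.
  rewrite pE /val; case: ltnP => [l4|l4]; last by rewrite curve_xy // mul1r.
  have -> : y l = y (sp (inord l)) by congr y; apply: val_inj; rewrite /= inordK.
  exact: curve_special.
under eq_bigr do rewrite coefE exprMn.
rewrite big_split /=; congr (_ * _).
rewrite /j -prodrXr [RHS]big_mkcond; apply: eq_bigr => l _.
by case: ifP; rewrite ?expr1n.
Qed.

End Dominance.

(** * Separating W(1, 1) from the other types *)

Lemma sum_monomials_neq0 (I : finType) (Q : pred I) n (mu : I -> 'X_{1..n}) (c : I -> CC) i :
  {in Q &, injective mu} -> Q i -> c i != 0 -> \sum_(j | Q j) c j *: 'X_[mu j] != 0 :> {mpoly CC[n]}.
Proof.
move=> inj Qi; apply: contraNneq => /(congr1 (mcoeff (mu i))).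
rewrite mcoeff0 (raddf_sum (mcoeff _)) (bigD1 i) //= mcoeffZ mcoeffX eqxx mulr1 big1 ?addr0 => [->//|].
move=> j /andP[Qj ji]; rewrite mcoeffZ mcoeffX; case: eqVneq => [/inj e|]; last by rewrite mulr0.
by rewrite e ?eqxx // in ji.
Qed.

Lemma supported_rem S m t : m \in S -> supported S t -> supported (m :: rem m S) t.
Proof. by move=> mS St x /St; rewrite (perm_mem (perm_to_rem mS)). Qed.

Lemma uniq_rem_head (T : eqType) (S : seq T) m : m \in S -> uniq S -> uniq (m :: rem m S).
Proof. by move=> mS; rewrite (perm_uniq (perm_to_rem mS)). Qed.

Lemma regroup (A : comPzRingType) (u v w s t r : A) :
  (u * v) * ((w * s) * (t * r)) = (u * (w * t)) * (v * (s * r)).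
Proof. by ring. Qed.

Definition separates d a b (psi : mp -> CC) K :=
  [/\ polyfun 3 psi, forall x f, psi (x *: f) = x ^+ K * psi f,
      forall p, of_type d a b p -> psi (det_form p) = 0
    & exists2 p, of_type d 1 1 p & psi (det_form p) != 0].

Section Separate.
Variables (d a b : nat) (L1 L2 L3 L4 : seq 'X_{1..4}) (m1 m2 m3 : 'X_{1..4}).
Hypotheses (d2 : (2 < d)%N).
Hypotheses (u1 : uniq (m1 :: L1)) (u2 : uniq (m2 :: L2)) (u3 : uniq (m3 :: L3)) (u4 : uniq L4).
Hypothesis dense : forall phi, polyfun 3 phi ->
  (forall p, in_slice L1 L2 L3 L4 m1 m2 m3 p -> phi (det_form p) = 0) ->
  forall p, of_type d a b p -> phi (det_form p) = 0.

Let R := size (coords d).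
Let z0 (f : mp) : CC := f@_(U_(o0) *+ d).
Let z (l : 'I_R) (f : mp) : CC := f@_(nth 0%MM (coords d) l).

(** The relation passes from the slice to all of W(a, b) by density. On forms of type (1, 1) with
    x^d coefficient 1 it is a nonzero polynomial in [coords], to which [dominance] applies. *)
Lemma separate_strict : (size L1 + size L2 + size L3 + size L4 < R)%N ->
  exists psi K, separates d a b psi K.
Proof.
move=> MR.
have z0P : polyfun 3 z0 by exact: pf_coef.
have zP l : polyfun 3 (z l) by exact: pf_coef.
have z0Z c f : z0 (c *: f) = c * z0 f by exact: mcoeffZ.
have zZ (l : 'I_R) c f : z l (c *: f) = c ^+ 1 * z l f by rewrite expr1; exact: mcoeffZ.
have [q [c [[a0 c0] Hc]]] := slice_relation z0P zP z0Z zZ u1 u2 u3 u4 MR.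
exists (weighted_sum z0 z (fun=> 1%N) c), (q * \sum_(l < R) 1)%N; split.
- exact: weighted_sum_polyfun.
- by move=> x f; apply: weighted_sumZ.
- by apply: dense => //; exact: weighted_sum_polyfun.
pose mu (r : {ffun 'I_R -> 'I_q.+1}) : 'X_{1..R} := [multinom (r l : nat) | l < R].
have muI : injective mu.
  move=> r s rs; apply/ffunP => l; apply: val_inj.
  by have := congr1 (fun m : 'X_{1..R} => m l) rs; rewrite !mnmE.
have P0 := @sum_monomials_neq0 _ xpredT _ mu c a0 (in2W muI) isT c0.
have [p [tp p1 Pp]] := dominance d2 P0; exists p => //.
apply: contraNneq Pp => <-; apply/eqP.
rewrite (raddf_sum (meval _)) /=; apply: eq_bigr => r _.
rewrite mevalZ mevalX /z0 p1 expr1n mul1r; congr (_ * _).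
by apply: eq_bigr => l _; rewrite mnmE.
Qed.

(** Index [ord0] carries phi with weight N. On W(1, 1), after division, only the terms of least
    exponent in phi survive, and they form a nonzero polynomial in [coords]. *)
Lemma separate_critical (phi : mp -> CC) N :
  (size L1 + size L2 + size L3 + size L4 < R.+1)%N ->
  polyfun 3 phi -> (forall x f, phi (x *: f) = x ^+ N * phi f) ->
  (forall p, of_type d 1 1 p -> phi (det_form p) = 0) ->
  (exists2 p, of_type d a b p & phi (det_form p) != 0) ->
  exists psi K, separates d a b psi K.
Proof.
move=> MR phiP phiZ phi11 [pw tpw phipw].
pose z' (l : 'I_R.+1) := if unlift ord0 l is Some j then z j else phi.
pose e (l : 'I_R.+1) := if unlift ord0 l is Some j then 1%N else N.
have z0P : polyfun 3 z0 by exact: pf_coef.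
have zP l : polyfun 3 (z l) by exact: pf_coef.
have z'P l : polyfun 3 (z' l) by rewrite /z'; case: unlift.
have z0Z c f : z0 (c *: f) = c * z0 f by exact: mcoeffZ.
have zZ (l : 'I_R) c f : z l (c *: f) = c * z l f by exact: mcoeffZ.
have z'Z l c f : z' l (c *: f) = c ^+ e l * z' l f.
  by rewrite /z' /e; case: unlift => [j|]; rewrite ?expr1.
have [q [c [[a0 c0] Hc]]] := slice_relation z0P z'P z0Z z'Z u1 u2 u3 u4 MR.
(* The least exponent of phi among terms with nonzero coefficient; dividing by this power lowers the
   total weight by N i0. *)
have [as_ cs smin] := @arg_minnP _ a0 (fun r => c r != 0) (fun r => r ord0) c0.
pose i0 : nat := as_ ord0; rewrite -/i0 in smin.
pose ex (r : {ffun 'I_R.+1 -> 'I_q.+1}) := (q * \sum_l e l - \sum_l e l * r l)%N.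
pose psi f := \sum_r c r * (z0 f ^+ ex r *
  (phi f ^+ (r ord0 - i0) * \prod_(j < R) z j f ^+ r (lift ord0 j))).
have eE : e ord0 = N by rewrite /e unlift_none.
have psiE f : weighted_sum z0 z' e c f = phi f ^+ i0 * psi f.
  rewrite /weighted_sum /psi mulr_sumr; apply: eq_bigr => r _.
  have [->|cr] := eqVneq (c r) 0; first by rewrite !mul0r mulr0.
  rewrite [RHS]mulrCA; congr (_ * _); rewrite [RHS]mulrCA; congr (_ * _).
  rewrite mulrA -exprD subnKC ?smin // big_ord_recl /z' unlift_none.
  by congr (_ * _); apply: eq_bigr => j _; rewrite liftK.
have A := polyfun_algebra 3.
have psiP : polyfun 3 psi.
  apply: (fa_sum A) => r; apply: (fa_mul A); first exact: (fa_const A).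
  apply: (fa_mul A); first exact: (fa_exp A).
  by apply: (fa_mul A); [exact: (fa_exp A) | apply: (fa_prod A) => j; exact: (fa_exp A)].
exists psi, (q * \sum_l e l - N * i0)%N; split=> //.
- move=> x f; rewrite /psi mulr_sumr; apply: eq_bigr => r _.
  have [->|cr] := eqVneq (c r) 0; first by rewrite !mul0r mulr0.
  rewrite [RHS]mulrCA; congr (_ * _); rewrite z0Z phiZ !exprMn -exprM.
  have -> : \prod_(j < R) z j (x *: f) ^+ r (lift ord0 j) =
      \prod_(j < R) (x ^+ r (lift ord0 j) * z j f ^+ r (lift ord0 j)).
    by apply: eq_bigr => j _; rewrite zZ exprMn.
  rewrite big_split /= prodrXr regroup -!exprD /ex; congr (x ^+ _ * _).
  have : (\sum_l e l * r l <= q * \sum_l e l)%N.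
    by rewrite big_distrr /=; apply: leq_sum => l _; rewrite mulnC leq_mul2r -ltnS ltn_ord orbT.
  have -> : (\sum_l e l * r l = N * r ord0 + \sum_(j < R) r (lift ord0 j))%N.
    rewrite big_ord_recl eE; congr (_ + _)%N; apply: eq_bigr => j _.
    by rewrite /e liftK mul1n.
  have := leq_mul (leqnn N) (smin r cr); rewrite mulnBr.
  move: (q * _)%N (N * r ord0)%N (N * i0)%N (\sum_(j < R) _)%N => W s t u; lia.
- have aa := along_lines_algebra quad.
  have l1 : along_lines (fun p => phi (det_form p) ^+ i0).
    by apply: (fa_exp aa); exact: along_lines_det_form.
  apply: (along_lines_domain (@of_type_line _ _ _) l1 (along_lines_det_form psiP) _ tpw).
    move=> p tp; rewrite -psiE; move: p tp; apply: dense => //.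
    exact: weighted_sum_polyfun.
  exact: expf_neq0.
pose mu (r : {ffun 'I_R.+1 -> 'I_q.+1}) : 'X_{1..R} := [multinom (r (lift ord0 l) : nat) | l < R].
have muI : {in (fun r : {ffun 'I_R.+1 -> 'I_q.+1} => r ord0 == i0 :> nat) &, injective mu}.
  move=> r s; rewrite !unfold_in => /eqP r0 /eqP s0 rs; apply/ffunP => l; apply: val_inj.
  case: (unliftP ord0 l) => [j ->|->]; last by rewrite /= r0 s0.
  by have := congr1 (fun m : 'X_{1..R} => m j) rs; rewrite !mnmE.
have P0 := @sum_monomials_neq0 _ _ _ mu c as_ muI (eqxx _) cs.
have [p [tp p1 Pp]] := dominance d2 P0; exists p => //.
apply: contraNneq Pp => <-; apply/eqP.
rewrite (raddf_sum (meval _)) /psi /= big_mkcond; apply: eq_bigr => r _.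
have [->|cr] := eqVneq (c r) 0; first by rewrite scale0r meval0 mul0r if_same.
rewrite phi11 // /z0 p1 expr1n mul1r expr0n subn_eq0.
have -> : (r ord0 <= i0)%N = (r ord0 == i0 :> nat) by rewrite eqn_leq smin // andbT.
case: eqVneq => _; last by rewrite mul0r mulr0.
rewrite mevalZ mevalX mul1r; congr (_ * _).
by apply: eq_bigr => l _; rewrite mnmE.
Qed.

End Separate.

Lemma mem_power_monomials (i : 'I_4) k : (U_(i) *+ k)%MM \in monomials k.
Proof. by rewrite mem_monomials mdegMn mdeg1 mul1n. Qed.

Lemma size_rem_mem (T : eqType) (s : seq T) x : x \in s -> (size (rem x s)).+1 = size s.
Proof. by move=> xs; rewrite (perm_size (perm_to_rem xs)). Qed.

Lemma size_rem_monomial (i : 'I_4) k : (size (rem (U_(i) *+ k)%MM (monomials k))).+1 = nmono k.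
Proof. exact/size_rem_mem/mem_power_monomials. Qed.

Lemma supported_filter (Q : pred 'X_{1..4}) S t : supported S t ->
  (forall m, ~~ Q m -> t@_m = 0) -> supported (filter Q S) t.
Proof.
move=> St Qt m mt; rewrite mem_filter St // andbT.
by apply: contraLR mt => /Qt /eqP; rewrite mcoeff_eq0.
Qed.

Section LowTypes.
Variables (d a b : nat).
Hypotheses (ab : (1 <= a <= b)%N) (b2 : (2 <= b)%N) (bd : (b + b <= d)%N) (d4 : (4 <= d)%N).

(** After reduction modulo t1, t2 has no term x^b, so y^b is its coefficient to normalise. *)
Let m1 : 'X_{1..4} := (U_(o0) *+ a)%MM.
Let m3 : 'X_{1..4} := (U_(o0) *+ (d - a))%MM.
Let m2 : 'X_{1..4} := (U_(o1) *+ b)%MM.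
Let L1 := rem m1 (monomials a).
Let L3 := rem m3 (monomials (d - a)).
Let L2 := rem m2 (low_monomials a b).
Let L4 := low_monomials a (d - b).

Let m2L : m2 \in low_monomials a b.
Proof.
rewrite mem_filter mem_power_monomials andbT mulmnE mnm1E /=.
by case/andP: ab.
Qed.

Let uniqs : [/\ uniq (m1 :: L1), uniq (m2 :: L2), uniq (m3 :: L3) & uniq L4].
Proof.
by split; rewrite ?filter_uniq ?uniq_monomials //; apply: uniq_rem_head => //;
  rewrite ?mem_power_monomials ?filter_uniq ?uniq_monomials.
Qed.

Let dense phi : polyfun 3 phi ->
  (forall p, in_slice L1 L2 L3 L4 m1 m2 m3 p -> phi (det_form p) = 0) ->
  forall p, of_type d a b p -> phi (det_form p) = 0.
Proof.
move=> phiP H; have abd : (a + b <= d)%N by lia.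
apply: dense_reduced => // p [p1 p2 p3 p4] low.
have lowm (m : 'X_{1..4}) : ~~ (m o0 < a)%N -> p.2.1@_m = 0 /\ p.2.2@_m = 0.
  by rewrite -leqNgt; exact: low.
apply: H; split.
- by apply: supported_rem; [exact: mem_power_monomials | exact: supported_monomials].
- by apply: supported_rem; [exact: mem_power_monomials | exact: supported_monomials].
- apply: supported_rem => //; apply: supported_filter; first exact: supported_monomials.
  by move=> m /lowm[].
- by apply: supported_filter; [exact: supported_monomials | move=> m /lowm[]].
Qed.

Let sizeE : (size L1 + size L2 + size L3 + size L4 + 3 + nmono (b - a) + nmono (d - b - a) =
  nmono a + nmono b + nmono (d - a) + nmono (d - b))%N.
Proof.
have s1 : (size L1).+1 = nmono a by exact: size_rem_monomial.
have s3 : (size L3).+1 = nmono (d - a) by exact: size_rem_monomial.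
have s2 : (size L2).+1 = size (low_monomials a b).
  exact: size_rem_mem.
have s2' := @size_low_monomials a b; have s4 := @size_low_monomials a (d - b).
have /s2' {}s2' : (a <= b)%N by lia.
have /s4 : (a <= d - b)%N by lia.
rewrite -/L4 -s2' -s1 -s3 -s2 => <-; clear.
move: (size L1) (size L2) (size L3) (size L4) (nmono _) (nmono _); lia.
Qed.

Lemma separate_low : (5 <= d)%N -> exists psi K, separates d a b psi K.
Proof.
move=> d5; have d2 : (2 < d)%N by apply: leq_trans d4.
have [u1 u2 u3 u4] := uniqs; apply: (separate_strict d2 u1 u2 u3 u4 dense).
have := type_count ab b2 bd d5; have := size_coords d2; have := sizeE.
move: (size L1) (size L2) (size L3) (size L4) (size (coords d)); clear; lia.
Qed.

Lemma separate_low_critical phi N : d = 4 -> a = 1%N -> b = 2 ->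
  polyfun 3 phi -> (forall x f, phi (x *: f) = x ^+ N * phi f) ->
  (forall p, of_type d 1 1 p -> phi (det_form p) = 0) ->
  (exists2 p, of_type d a b p & phi (det_form p) != 0) ->
  exists psi K, separates d a b psi K.
Proof.
move=> dE aE bE; have d2 : (2 < d)%N by apply: leq_trans d4.
have [u1 u2 u3 u4] := uniqs; apply: (separate_critical d2 u1 u2 u3 u4 dense).
have n1 : nmono 1 = 4 by have := nmonoE 1; lia.
have n2 : nmono 2 = 10 by have := nmonoE 2; lia.
have n3 : nmono 3 = 20 by have := nmonoE 3; lia.
have n4 : nmono 4 = 35 by have := nmonoE 4; lia.
have := size_coords d2; have := sizeE.
have -> : (b - a = 1)%N by rewrite aE bE.
have -> : (d - b - a = 1)%N by rewrite dE aE bE.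
have -> : (d - a = 3)%N by rewrite dE aE.
have -> : (d - b = 2)%N by rewrite dE bE.
move: (size L1) (size L2) (size L3) (size L4) (size (coords d)); rewrite aE bE dE n1 n2 n3 n4; clear; lia.
Qed.

End LowTypes.

Lemma separate_type22 phi N :
  polyfun 3 phi -> (forall x f, phi (x *: f) = x ^+ N * phi f) ->
  (forall p, of_type 4 1 1 p -> phi (det_form p) = 0) ->
  (exists2 p, of_type 4 2 2 p & phi (det_form p) != 0) ->
  exists psi K, separates 4 2 2 psi K.
Proof.
pose s0 : 'X_{1..4} := (U_(o0) *+ 2)%MM; pose s1 : 'X_{1..4} := (U_(o1) *+ 2)%MM.
(* x^2 and y^2 have been cleared from t2, so z^2 is normalised instead. *)
pose s2 : 'X_{1..4} := (U_(o2) *+ 2)%MM.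
pose S := [seq m <- [seq m <- monomials 2 | m != s0] | m != s1].
have ne (i j : 'I_4) : i != j -> (U_(i) *+ 2)%MM != (U_(j) *+ 2)%MM :> 'X_{1..4}.
  move=> ij; apply/eqP => /(congr1 (fun m : 'X_{1..4} => m i)).
  by rewrite !mulmnE !mnm1E eqxx eq_sym (negbTE ij).
have sM i : (U_(i) *+ 2)%MM \in monomials 2 by exact: mem_power_monomials.
have s2S : s2 \in S by rewrite !mem_filter sM !ne.
have uS : uniq S by rewrite !filter_uniq // uniq_monomials.
have u1 : uniq (s0 :: rem s0 (monomials 2)) by exact: (uniq_rem_head (sM o0) (uniq_monomials 2)).
have u2 : uniq (s2 :: rem s2 S) by exact: uniq_rem_head.
apply: (@separate_critical 4 2 2 _ _ _ _ _ _ _ isT u1 u2 u1 uS).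
  move=> psi psiP H; apply: dense_type22 => // p [p1 p2 p3 p4] H0; apply: H.
  have S2 t : t \is 2.-homog -> t@_s0 = 0 -> t@_s1 = 0 -> supported S t.
    move=> ht t0 t1; do 2![apply: supported_filter; last by move=> m /negPn/eqP ->].
    exact: supported_monomials.
  have [c0 e0] := H0 _ (or_introl (erefl _)); have [c1 e1] := H0 _ (or_intror (erefl _)).
  split; [exact: (supported_rem (sM o0) (supported_monomials p1)) | exact: (supported_rem (sM o0) (supported_monomials p2))
    | apply: (supported_rem s2S); exact: S2 | exact: S2].
have z1 := size_rem_monomial o0 2.
have z0 : (size [seq m <- monomials 2 | m != s0]).+1 = nmono 2.
  exact: (size_filter_neq (uniq_monomials 2) (sM o0)).
have zS : (size S).+1 = size [seq m <- monomials 2 | m != s0].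
  by apply: size_filter_neq; rewrite ?filter_uniq ?uniq_monomials // mem_filter (sM o1) ne.
have zS' : (size (rem s2 S)).+1 = size S.
  exact: size_rem_mem.
have n2 : nmono 2 = 10 by have := nmonoE 2; lia.
have n4 : nmono 4 = 35 by have := nmonoE 4; lia.
move: (@size_coords 4 isT) z1 z0 zS zS'; rewrite n2 n4 -/s0.
move: (size (coords 4)) (size (rem s0 _)) (size (rem s2 S)) (size S) (size [seq m <- _ | m != s0]); clear.
lia.
Qed.

Lemma separate_types d a b : (1 <= a <= b)%N -> (2 <= b)%N -> (b + b <= d)%N -> (4 <= d)%N ->
  exists psi K, separates d a b psi K.
Proof.
move=> ab b2 bd d4; have [d5|d5] := leqP 5 d; first exact: separate_low.
have {d4 d5} dE : d = 4 by lia.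
subst d; have bE : b = 2 by lia.
have [phi [N [phiP phiZ phi0 phiL]]] := resultant_lines 0.
have phi11 := resultant_lines_type11 phiP phiL.
have mNq : - quadric_t \is 2.-homog by rewrite rpredN quadric_t_homog.
subst b; have [aE|aE] : a = 1%N \/ a = 2 by lia.
  apply: (separate_low_critical ab b2 bd) phi11 _ => //.
  (* The cyclic quartic has type (1, 2) through w^4 = w w^3, and type (2, 2) below through w^4 = w^2
     w^2. *)
  rewrite aE; exists (('X_o3, 'X_o3 ^+ 3), (- quadric_t, curve_s 0)).
    by split; [exact: homogX1 | exact: homogXn | exact: mNq | exact: curve_s_homog].
  by rewrite /det_form /= mulNr -exprS.
subst a; apply: separate_type22 phi11 _ => //.
exists (('X_o3 ^+ 2, 'X_o3 ^+ 2), (- quadric_t, curve_s 0)).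
  by split; [exact: homogXn | exact: homogXn | exact: mNq | exact: curve_s_homog].
by rewrite /det_form /= mulNr -exprD.
Qed.

Lemma separate_all d : (4 <= d)%N -> exists psi K, [/\ polyfun 3 psi,
  forall x f, psi (x *: f) = x ^+ K * psi f,
  forall a b p, (1 <= a <= b)%N -> (2 <= b)%N -> (b + b <= d)%N ->
    of_type d a b p -> psi (det_form p) = 0
  & exists2 p, of_type d 1 1 p & psi (det_form p) != 0].
Proof.
move=> d4.
pose T (ab : nat * nat) := [&& 1 <= ab.1 <= ab.2, 2 <= ab.2 & ab.2 + ab.2 <= d]%N.
have /boolp.choice [psi] : forall ab : nat * nat, exists psiK : (mp -> CC) * nat,
    T ab -> separates d ab.1 ab.2 psiK.1 psiK.2.
  move=> ab; case Tab: (T ab); last by exists ((fun=> 0), 0%N).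
  by have /and3P[h1 h2 h3] := Tab; have [psi [K H]] := separate_types h1 h2 h3 d4; exists (psi, K).
move=> Hpsi; pose r := [seq ab <- [seq (a, b) | a <- iota 0 d, b <- iota 0 d] | T ab].
have rT ab : (ab \in r) = T ab.
  rewrite mem_filter; case Tab: (T ab) => //=; case: ab Tab => a b /and3P[/= h1 h2 h3].
  by apply/allpairsP; exists (a, b); rewrite /= !mem_iota; split=> //; lia.
pose Psi f := \prod_(ab <- r) (psi ab).1 f; pose K := (\sum_(ab <- r) (psi ab).2)%N.
(* Outside [T] the chosen function is arbitrary; [psi'] is polynomial for every index and agrees
   with it on [r]. *)
pose psi' ab := if T ab then (psi ab).1 else (fun=> 0).
have psi'P ab : polyfun 3 (psi' ab).
  rewrite /psi'; case Tab: (T ab); last exact: pf_const.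
  by have [] := Hpsi _ Tab.
have PsiE f : Psi f = \prod_(ab <- r) psi' ab f.
  by rewrite /Psi !big_seq; apply: eq_bigr => ab; rewrite rT /psi' => ->.
exists Psi, K; split.
- apply: fa_ext (fa_prod (polyfun_algebra 3) _ _ psi'P) => f.
  by rewrite PsiE.
- move=> x f; rewrite /Psi /K -prodrXr -big_split !big_seq; apply: eq_bigr => ab.
  by rewrite rT => Tab; have [_ -> _ _] := Hpsi _ Tab.
- move=> a b p h1 h2 h3 tp; have Tab : T (a, b) by apply/and3P.
  rewrite /Psi; have := Hpsi _ Tab => -[_ _ /(_ _ tp) z _].
  by apply/eqP; rewrite prodf_seq_eq0; apply/hasP; exists (a, b); rewrite ?rT //= z.
have aa := along_lines_algebra quad.
have [||ab|p tp] := @along_lines_prod_neq0 quad (of_type d 1 1) _ r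
    (fun ab p => psi' ab (det_form p)) (@of_type_line d 1 1).
- by exists 0; split; exact: rpred0.
- by move=> ab; apply: along_lines_det_form.
- rewrite rT => Tab; have [_ _ _ [p tp Hp]] := Hpsi _ Tab.
  by exists p => //; rewrite /psi' Tab.
by exists p => //; rewrite PsiE.
Qed.

(** * Restriction to four variables *)

Lemma det_formE (t1 s1 t2 s2 : mp) : det_form ((t1, s1), (t2, s2)) = t1 * s1 + t2 * s2.
Proof. by []. Qed.

Lemma product_type d e (t s : mp) : (1 <= e <= d.-1)%N -> t \is e.-homog -> s \is (d - e)%N.-homog ->
  exists c t' s', [/\ (1 <= c)%N, (c + c <= d)%N, t' \is c.-homog, s' \is (d - c)%N.-homog
    & t * s = t' * s'].
Proof.
move=> he ht hs; have [ed|ed] := leqP (e + e) d; first by exists e, t, s; split=> //; case/andP: he.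
exists (d - e)%N, s, t; split=> //; try lia; last exact: mulrC.
by have -> : (d - (d - e) = e)%N by lia.
Qed.

Section Restriction.
Variable n : nat.

Definition rho_vars : n.+1.-tuple mp :=
  [tuple if (i < 4)%N then 'X_(inord i) else 0 | i < n.+1].

Definition rho (f : poly_n n) : mp := f \mPo rho_vars.
Lemma rhoD f g : rho (f + g) = rho f + rho g. Proof. exact: comp_mpolyD. Qed.
Lemma rhoM f g : rho (f * g) = rho f * rho g. Proof. exact: rmorphM. Qed.
Lemma rhoZ c f : rho (c *: f) = c *: rho f. Proof. exact: comp_mpolyZ. Qed.

Lemma rho_homog k f : f \is k.-homog -> rho f \is k.-homog.
Proof.
move=> hf; apply: homog_comp => // i; rewrite tnth_mktuple.
by case: ifP => _; [exact: homogX1 | exact: rpred0].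
Qed.

Lemma polyfun_rho d phi : polyfun 3 phi ->
  exists2 phi', polyfun n phi' & forall f, f \is d.-homog -> phi' f = phi (rho f).
Proof.
elim=> [c|m|g h _ [g' pg Eg] _ [h' ph Eh]|g h _ [g' pg Eg] _ [h' ph Eh]].
- by exists (fun=> c) => //; exact: pf_const.
- have [|phi' [pphi' _ E]] := @linear_polyfun n d (fun f => (rho f)@_m).
    by move=> a f g; rewrite rhoD rhoZ mcoeffD mcoeffZ.
  by exists phi'.
- by exists (fun f => g' f + h' f); [exact: pf_add | move=> f hf; rewrite Eg ?Eh].
- by exists (fun f => g' f * h' f); [exact: pf_mul | move=> f hf; rewrite Eg ?Eh].
Qed.

Lemma closed_rho d N phi : polyfun 3 phi -> (forall x f, phi (x *: f) = x ^+ N * phi f) ->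
  zariski_closed n d (fun f => [/\ f \is d.-homog, f != 0 & phi (rho f) = 0]).
Proof.
move=> pphi phiZ; have [phi' pphi' E] := polyfun_rho d pphi.
exists unit, (fun=> N), (fun=> phi'); split=> [_|f].
  by split=> // c f hf; rewrite !E ?dhomogZ // rhoZ.
split=> [[hf f0 phif]|[hf [f0 /(_ tt)]]]; last by rewrite E.
by do !split=> //; move=> _; rewrite E.
Qed.

Lemma decomp2_type d f : has_strength_decomp n d 2 f ->
  exists a b p, [/\ (1 <= a <= b)%N, (b + b <= d)%N, of_type d a b p & rho f = det_form p].
Proof.
move=> [e [t [s [H ->]]]].
have rhos i : rho (t i) \is (e i).-homog /\ rho (s i) \is (d - e i)%N.-homog.
  by have [_ [ht hs]] := H i; split; exact: rho_homog.
pose i1 : 'I_2 := lift ord0 ord0.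
have [c0 [t0 [s0 [c01 c0d ht0 hs0 E0]]]] := product_type (H 0).1 (rhos 0).1 (rhos 0).2.
have [c1 [t1 [s1 [c11 c1d ht1 hs1 E1]]]] := product_type (H i1).1 (rhos i1).1 (rhos i1).2.
have -> : rho (\sum_(i < 2) t i * s i) = t0 * s0 + t1 * s1.
  by rewrite big_ord_recl big_ord1 rhoD !rhoM -E0 -E1.
have [c01'|c10] := leqP c0 c1.
  by exists c0, c1, ((t0, s0), (t1, s1)); split=> //; rewrite c01.
by exists c1, c0, ((t1, s1), (t0, s0)); split=> //; rewrite ?c11 ?(ltnW c10) // addrC.
Qed.

(* One of the two summands is zero, so its type can be chosen to make b >= 2. *)
Lemma decomp1_type d f : (4 <= d)%N -> has_strength_decomp n d 1 f ->
  exists a b p, [/\ (1 <= a <= b)%N, (2 <= b)%N, (b + b <= d)%N, of_type d a b p & rho f = det_form p].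
Proof.
move=> d4 [e [t [s [H ->]]]]; have [he [ht hs]] := H 0.
have [c [t0 [s0 [c1 cd ht0 hs0 E0]]]] := product_type he (rho_homog ht) (rho_homog hs).
rewrite big_ord1 rhoM E0.
have [c2|c2] := leqP 2 c.
  by exists 2, c, ((0, 0), (t0, s0)); split=> //; [split=> //; exact: rpred0 | rewrite det_formE mul0r add0r].
exists c, 2, ((t0, s0), (0, 0)); split; rewrite ?c1 ?(ltnW c2) //.
  by split=> //; exact: rpred0.
by rewrite det_formE mul0r addr0.
Qed.

Lemma decomp1_product d f : has_strength_decomp n d 1 f ->
  exists e (t s : mp), [/\ (1 <= e <= d.-1)%N, t \is e.-homog, s \is (d - e)%N.-homog & rho f = t * s].
Proof.
move=> [e [t [s [H ->]]]]; have [he [ht hs]] := H 0.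
exists (e 0), (rho (t 0)), (rho (s 0)); split=> //; try exact: rho_homog.
by rewrite big_ord1 rhoM.
Qed.

Hypothesis n3 : (3 <= n)%N.

Lemma four_variables : (4 <= n.+1)%N. Proof. by []. Qed.

Definition iota_vars : 4.-tuple (poly_n n) := [tuple 'X_(widen_ord four_variables i) | i < 4].

(** [rho] maps any decomposition of [iota4 g] in n+1 variables to one of g, so lower bounds on
    strength are inherited from four variables. *)
Definition iota4 (g : mp) : poly_n n := g \mPo iota_vars.

Lemma iotaD f g : iota4 (f + g) = iota4 f + iota4 g. Proof. exact: comp_mpolyD. Qed.
Lemma iotaM f g : iota4 (f * g) = iota4 f * iota4 g. Proof. exact: rmorphM. Qed.

Lemma iota_homog k g : g \is k.-homog -> iota4 g \is k.-homog.
Proof. by move=> hg; apply: homog_comp => // i; rewrite tnth_mktuple; exact: homogX1. Qed.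

Lemma iotaK : cancel iota4 rho.
Proof.
move=> g; rewrite /iota4 comp_mpolyE /rho raddf_sum [RHS]mpolyE; apply: eq_bigr => m _.
rewrite /= comp_mpolyZ rmorph_prod /= mpolyXE_id; congr (_ *: _).
apply: eq_bigr => i _; apply: etrans (rmorphXn (comp_mpoly _) _ _) _; congr (_ ^+ _) => /=.
rewrite tnth_mktuple comp_mpolyXU -tnth_nth tnth_mktuple /= ltn_ord.
by congr 'X_ _; apply: val_inj; rewrite /= inordK.
Qed.

Lemma decomp_det d a b p : (1 <= a <= d.-1)%N -> (1 <= b <= d.-1)%N -> of_type d a b p ->
  has_strength_decomp n d 2 (iota4 (det_form p)).
Proof.
case: p => -[t1 s1] [t2 s2] ha hb [p1 p2 p3 p4].
exists (fun i : 'I_2 => if i == 0 then a else b),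
  (fun i : 'I_2 => iota4 (if i == 0 then t1 else t2)),
  (fun i : 'I_2 => iota4 (if i == 0 then s1 else s2)); split.
  by move=> i; case: ifP => _; do !split=> //; exact: iota_homog.
rewrite big_ord_recl big_ord1 -[lift ord0 ord0 == 0]/false -[ord0 == 0]/true.
by rewrite det_formE iotaD !iotaM.
Qed.

End Restriction.

Theorem theorem6p10 (n d : nat) :
  (3 <= n)%N -> (4 <= d)%N -> proj_reducible n d (S2 n d).
Proof.
move=> n3 d4; have [k dE] : exists k, d = k.+4 by exists (d - 4)%N; lia.
have [phi [N [pphi phiZ phi0 phiL]]] := resultant_lines k.
have phi11 := resultant_lines_type11 pphi phiL.
have [psi [K [ppsi psiZ psi0 [p tp psip]]]] := separate_all d4.
exists (fun f => [/\ f \is d.-homog, f != 0 & phi (@rho n f) = 0]).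
exists (fun f => [/\ f \is d.-homog, f != 0 & psi (@rho n f) = 0]).
have rho0 : rho 0 = 0 :> mp by move=> ?; exact: raddf0.
split; first exact: closed_rho phiZ.
split; first exact: closed_rho psiZ.
split.
  move=> f [f0 [hf [_ [D _]]]].
  have [a [b [q [ab bd tq Eq]]]] := decomp2_type D.
  have [b2|b2] := leqP 2 b; first by right; split=> //; rewrite Eq (psi0 a b).
  left; split=> //; rewrite Eq.
  have [aE bE] : a = 1%N /\ b = 1%N by lia.
  by apply: phi11; rewrite -dE; move: tq; rewrite aE bE.
split.
  exists (iota4 n3 (cyclic_surface k)); split; last by move=> [_ _]; rewrite iotaK => /eqP; apply/negP.
  split; [|split; [|split; [|split]]] => //.
  (* The zero form is excluded because it would factor as 0 times 0. *)
  - apply/eqP => /(congr1 (@rho n)); rewrite iotaK (_ : rho 0 = 0); last exact: raddf0.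
    have /(_ (@rpred0 _ _) (@rpred0 _ _)) := @cyclic_surface_irreducible k 1 0 0 isT.
    by rewrite mul0r.
  - by rewrite dE; apply/iota_homog/cyclic_surface_homog.
  - have -> : cyclic_surface k = det_form (('X_o3, 'X_o3 ^+ k.+3), (- quadric_t, curve_s k)).
      by rewrite det_formE mulNr -exprS.
    rewrite dE; apply: (@decomp_det _ _ _ 1 2) => //.
    split; rewrite /= ?subSS ?subn0; [exact: homogX1 | exact: homogXn | | exact: curve_s_homog].
    by rewrite rpredN quadric_t_homog.
  case=> [|[|r]] //= _ /decomp1_product [e [t [s [he ht hs]]]]; rewrite iotaK.
  by rewrite dE in he hs; apply: cyclic_surface_irreducible hs.
exists (iota4 n3 (det_form p)); split; last by move=> [_ _]; rewrite iotaK => /eqP; apply/negP.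
split; [|split; [|split; [|split]]] => //.
- apply: contraNneq psip => /(congr1 (@rho n)); rewrite iotaK (_ : rho 0 = 0); last exact: raddf0.
  (* psi vanishes at 0, since the zero quadruple has type (2, 2). *)
  move=> ->; apply/eqP; have <- : det_form 0 = 0 by rewrite /det_form mul0r addr0.
  by apply: (psi0 2 2) => //; split; exact: rpred0.
- by apply/iota_homog/(det_form_homog _ _ tp); lia.
- by apply: (@decomp_det _ _ _ 1 1) => //; lia.
case=> [|[|r]] //= _ /(decomp1_type d4) [a [b [q [ab b2 bd tq]]]]; rewrite iotaK => Eq.
by move: psip; rewrite Eq (psi0 a b) ?eqxx.
Qed.
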